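(* Let $\alpha,\beta\in\mathbb C$ and let $W=\mathbb C$ be the $H$-bimodule on which $M$ acts trivially from both sides and $F_{0,d+1}$ acts as $\alpha$ from the left and as $\beta$ from the right. Let $e^{\epsilon_i/2}$ stand for the function $\exp(\chi_i/2)$ ($i=1,2$), and set $$l_{\pm\epsilon_1}^2=l_{\pm\epsilon_2}^2=-\alpha\beta,\qquad l^2_{\pm(\epsilon_1+\epsilon_2)}=l^2_{\pm(\epsilon_1-\epsilon_2)}=0,\qquad l^2_{\pm2\epsilon_1}=l^2_{\pm2\epsilon_2}=-\Big(\frac{\alpha-\beta}{2}\Big)^2.$$ Then for all $f\in E^W(G,H)$ and all $I$, $$\Psi_I(\Omega_{\mathfrak g}\cdot f)=\Psi_I(f\cdot\Omega_{\mathfrak g})=\Big(L(k)+\sum_{\gamma\in R^+}\frac{l_\gamma^2\,B^*(\gamma,\gamma)}{(e^{\gamma/2}-e^{-\gamma/2})^2}\Big)\Psi_I(f),$$ where $R$ is the root system of type $BC_2$ consisting of $\pm\epsilon_1,\pm\epsilon_2,\pm2\epsilon_1,\pm2\epsilon_2,\pm\epsilon_1\pm\epsilon_2$.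
   Context: Group. Let $p\ge q\ge0$ be integers, $d=p+q>2$, $\eta=\operatorname{diag}(1^{p+1},(-1)^{q+1})$ on $\mathbb R^{d+2}$ with basis $e_0,\dots,e_{d+1}$, $G=SO(p+1,q+1)_0$, $B(X,Y)=\operatorname{tr}(XY)$ on $\mathfrak g=\mathfrak{so}(p+1,q+1)$, $\Omega_{\mathfrak g}$ the quadratic Casimir element with respect to $B$. $F_{\mu\nu}\in\mathfrak g$ is given by $F_{\mu\nu}e_\rho=\eta_{\nu\rho}e_\mu-\eta_{\mu\rho}e_\nu$. $H=MA$ is the centraliser of $F_{0,d+1}$ in $G$, $A=\exp(\mathbb RF_{0,d+1})$, and $M$ is the intersection of the kernels of all continuous homomorphisms $MA\to\mathbb R_{>0}$. $E^W(G,H)$ is the set of smooth $f:G\to W$ with $f(hgh')=h\cdot f(g)\cdot h'$ for $g\in G$, $h,h'\in H$. $U(\mathfrak g)$ acts by $(X\cdot f)(g)=\frac{d}{ds}f(g\exp(sX))|_{s=0}$ and $(f\cdot X)(g)=\frac d{ds}f(\exp(sX)g)|_{s=0}$. Coordinates. $(\chi_1,\chi_2)$ ranges over the following real surfaces in $\mathbb C^2$: $Y_\emptyset=i\{(a,b):0<a<b<\pi\}$; $Y_{\{0\}}=\{0\}\times\mathbb R_{>0}+i\{(a,\pi):0<a<\pi\}$; $Y_{\{1\}}=\mathbb R_{>0}(-1,1)+(0,\pi)i(1,1)$; $Y_{\{2\}}=\mathbb R_{>0}\times\{0\}+i\{(0,a):0<a<\pi\}$; $Y_{\{0,1\}}=\{(a,b):0<a<b\}+i(\pi,\pi)$;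 $Y_{\{0,2\}}=\mathbb R_{>0}^2+i(0,\pi)$; $Y_{\{1,2\}}=\{(a,b):0<a<b\}$. Put $Y_{\{1\}'}=Y_{\{1\}}$. Let $t_{\phi,\psi}=\exp(\phi F_{0,1}+\psi F_{d,d+1})$. If $q>0$, define $x_I:Y_I\to G$ by - $x_\emptyset=\exp\big(\tfrac{\chi_1+\chi_2-2\pi i}{2i}F_{0,1}+\tfrac{\chi_1-\chi_2}{2i}F_{d,d+1}\big)$; - $x_{\{0\}}=\exp\big(\tfrac{\operatorname{Re}\chi_2}{2}(F_{0,d}-F_{1,d+1})+\tfrac{\chi_1-i\pi}{2i}(F_{0,1}+F_{d,d+1})\big)$; - $x_{\{2\}}=\exp\big(\tfrac{\operatorname{Re}\chi_1}{2}(F_{0,d}-F_{1,d+1})+\tfrac{\chi_2}{2i}(F_{0,1}+F_{d,d+1})\big)t_{0,\pi}$; - $x_{\{1\}}=\exp\big(\tfrac{\chi_1+\chi_2-2i\pi}{2i}F_{0,1}+\tfrac{\operatorname{Re}(\chi_1-\chi_2)}{2}F_{2,d+1}\big)$; - $x_{\{1\}'}=\exp\big(\tfrac{\chi_1+\chi_2-2i\pi}{2i}F_{d,d+1}+\tfrac{\operatorname{Re}(\chi_1-\chi_2)}{2}F_{0,d-1}\big)$ (only for $q>1$); - $x_{\{0,1\}}=\exp(Z)$, $x_{\{0,2\}}=\exp(Z)t_{\pi/2,\pi/2}$, $x_{\{1,2\}}=\exp(Z)t_{0,\pi}$ with $Z=\tfrac{\operatorname{Re}(\chi_1+\chi_2)}{2}F_{0,d}+\tfrac{\operatorname{Re}(\chi_1-\chi_2)}{2}F_{1,d+1}$.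 If $q=0$, the only index is $I=\{1\}$, with $x_{\{1\}}=\exp\big(\tfrac{\chi_1+\chi_2-2i\pi}{2i}F_{0,1}+\tfrac{\chi_1-\chi_2}{2}F_{d,d+1}\big)$. $\Psi_I(f)=f\circ x_I\in C^\infty(Y_I)$. On $Y_I$, $\partial_{\chi_1},\partial_{\chi_2}$ denote the complex vector fields (sections of $TY_I\otimes\mathbb C$) with $\partial_{\chi_i}\chi_j=\delta_{ij}$. Operator. Let $\epsilon_1,\epsilon_2$ be orthonormal, $B^*(\epsilon_i,\epsilon_j)=\delta_{ij}$; for $\gamma=a\epsilon_1+b\epsilon_2$ put $e^\gamma=\exp(a\chi_1+b\chi_2)$ and $\partial_\gamma=a\partial_{\chi_1}+b\partial_{\chi_2}$. Let $R^+=\{\epsilon_1,\epsilon_2,2\epsilon_1,2\epsilon_2,\epsilon_1+\epsilon_2,\epsilon_1-\epsilon_2\}$ and $k_{\pm\epsilon_i}=0$, $k_{\pm2\epsilon_i}=\tfrac12$, $k_{\pm\epsilon_1\pm\epsilon_2}=\tfrac{d-2}{2}$. Then $$L(k)=\partial_{\chi_1}^2+\partial_{\chi_2}^2+\sum_{\gamma\in R^+}k_\gamma\frac{1+e^{-\gamma}}{1-e^{-\gamma}}\partial_\gamma.$$ *)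

(* Defs.v *)
From HB Require Import structures.
From mathcomp Require Import all_boot all_order all_algebra complex.
From mathcomp Require Import all_classical all_reals all_analysis.

Set Implicit Arguments.
Unset Strict Implicit.
Unset Printing Implicit Defensive.

Import Order.TTheory GRing.Theory Num.Theory.
Import numFieldNormedType.Exports.

Local Open Scope classical_set_scope.
Local Open Scope ring_scope.
Local Open Scope complex_scope.

Local Notation Re := complex.Re.
Local Notation Im := complex.Im.

Section ComplexValued.
Variable R : realType.

Definition cexp (z : R[i]) : R[i] :=
  (expR (Re z) * cos (Im z)) +i* (expR (Re z) * sin (Im z)).

(* Derivative of a complex-valued function of a real variable. *)
Definition cderive1 (h : R -> R[i]) (t : R) : R[i] :=
  derive1 (fun s => Re (h s)) t +i* derive1 (fun s => Im (h s)) t.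

Definition is_cderive1 (h : R -> R[i]) (t : R) (l : R[i]) : Prop :=
  is_derive t 1 (fun s => Re (h s)) (Re l) /\
  is_derive t 1 (fun s => Im (h s)) (Im l).

End ComplexValued.

Section Smooth.
Variables (R : realType) (V : normedModType R).

Fixpoint iter_derive (vs : seq V) (f : V -> R) : V -> R :=
  if vs is v :: vs' then fun x => 'D_v (iter_derive vs' f) x else f.

(* C^oo on an open set of a finite-dimensional space: all iterated directional
   derivatives exist and are continuous. *)
Definition Csmooth (U : set V) (f : V -> R) : Prop :=
  forall (vs : seq V) (x : V), U x ->
    {for x, continuous (iter_derive vs f)} /\
    (forall v : V, derivable (iter_derive vs f) x v).

(* Smoothness on an embedded submanifold A: f is locally the restriction to A
   of a smooth function on the ambient space.  The values of f outside A are
   irrelevant. *)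
Definition smooth_on (A : set V) (f : V -> R[i]) : Prop :=
  forall x, A x -> exists (U : set V) (u v : V -> R),
    [/\ open U, U x, Csmooth U u, Csmooth U v &
        forall y, U y -> A y -> f y = u y +i* v y].

End Smooth.

Definition expm (R : realType) (n : nat) (X : 'M[R]_n.+1) : 'M[R]_n.+1 :=
  limn (series (fun k => (k`!%:R)^-1 *: X ^+ k)).

Section Group.
Variables (R : realType) (p q : nat).
Let d := (p + q)%N.
Local Notation mat := 'M[R]_((p + q).+2).

Definition eta_coef (mu nu : nat) : R :=
  if mu == nu then (if (mu <= p)%N then 1 else -1) else 0.

Definition eta : mat := \matrix_(i, j) eta_coef i j.

(* Column rho is F_{mu,nu} e_rho = eta_{nu,rho} e_mu - eta_{mu,rho} e_nu. *)
Definition Fmx (mu nu : nat) : mat :=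
  \matrix_(i, j) ((i == mu :> nat)%:R * eta_coef nu j
                  - (i == nu :> nat)%:R * eta_coef mu j).

Definition SO_pq : set mat := [set g | g^T *m eta *m g = eta /\ \det g = 1].

Definition SO0_pq : set mat := connected_component SO_pq 1%:M.

Definition so_defect (X : mat) : mat := X^T *m eta + eta *m X.

Fact so_defect_linear : linear so_defect.
Proof.
move=> a X Y; rewrite /so_defect linearP /= mulmxDl mulmxDr -scalemxAl.
by rewrite -scalemxAr scalerDr addrACA.
Qed.

HB.instance Definition _ :=
  GRing.isLinear.Build R mat mat *:%R so_defect so_defect_linear.

Definition so_alg : {vspace mat} := lker (linfun so_defect).

Lemma so_algP (X : mat) :
  reflect (X^T *m eta + eta *m X = 0) (X \in so_alg).
Proof. by rewrite memv_ker lfunE; apply: eqP. Qed.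

Definition H_grp : set mat :=
  [set g | SO0_pq g /\ g *m Fmx 0 d.+1 = Fmx 0 d.+1 *m g].

Definition is_pos_hom (chi : mat -> R) : Prop :=
  [/\ forall h, H_grp h -> 0 < chi h,
      forall h h', H_grp h -> H_grp h' -> chi (h *m h') = chi h * chi h' &
      {within H_grp, continuous chi}].

Definition M_grp : set mat :=
  [set h | H_grp h /\ forall chi, is_pos_hom chi -> chi h = 1].

(* A continuous action of H on C from either side: as GL(C) is commutative,
   left and right actions are both given by characters H -> C^*. *)
Definition is_character (lam : mat -> R[i]) : Prop :=
  [/\ lam 1%:M = 1,
      forall h h', H_grp h -> H_grp h' -> lam (h *m h') = lam h * lam h',
      {within H_grp, continuous (fun h => Re (lam h))} &
      {within H_grp, continuous (fun h => Im (lam h))}].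

(* The action lam of H on C is trivial on M and its differential sends
   F_{0,d+1} to alpha. *)
Definition acts_by (lam : mat -> R[i]) (alpha : R[i]) : Prop :=
  [/\ is_character lam,
      forall m, M_grp m -> lam m = 1 &
      is_cderive1 (fun t => lam (expm (t *: Fmx 0 d.+1))) 0 alpha].

(* E^W(G,H) for W = C with left action lam and right action rho.  Functions on
   G are represented by functions on matrices, only the values on G matter. *)
Definition in_EW (lam rho : mat -> R[i]) (f : mat -> R[i]) : Prop :=
  smooth_on SO0_pq f /\
  forall h g h', H_grp h -> SO0_pq g -> H_grp h' ->
    f (h *m g *m h') = lam h * f g * rho h'.

Definition lieL (X : mat) (f : mat -> R[i]) (g : mat) : R[i] :=
  cderive1 (fun s => f (g *m expm (s *: X))) 0.

Definition lieR (f : mat -> R[i]) (X : mat) (g : mat) : R[i] :=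
  cderive1 (fun s => f (expm (s *: X) *m g)) 0.

Definition B_form (X Y : mat) : R := \tr (X *m Y).

Definition B_dual_bases (m : nat) (X Y : m.-tuple mat) : Prop :=
  [/\ basis_of so_alg X, basis_of so_alg Y &
      forall i j : 'I_m, B_form (tnth X i) (tnth Y j) = (i == j)%:R].

(* For B-dual bases X and Y, the Casimir element is Omega = \sum_i X_i Y_i. *)
Definition casimirL (m : nat) (X Y : m.-tuple mat) (f : mat -> R[i])
    (g : mat) : R[i] :=
  \sum_(i < m) lieL (tnth X i) (lieL (tnth Y i) f) g.

Definition casimirR (m : nat) (f : mat -> R[i]) (X Y : m.-tuple mat)
    (g : mat) : R[i] :=
  \sum_(i < m) lieR (lieR f (tnth X i)) (tnth Y i) g.

End Group.

Inductive cell := C_empty | C_0 | C_1 | C_1' | C_2 | C_01 | C_02 | C_12.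

Definition cell_index (q : nat) (I : cell) : bool :=
  match I with
  | C_1 => true
  | C_1' => (1 < q)%N
  | _ => (0 < q)%N
  end.

Section Surfaces.
Variable R : realType.
Local Notation C2 := (R[i] * R[i])%type.

(* Each Y_I is the image of an open domain of R^2 under an affine chart. *)
Definition chart (I : cell) (s t : R) : C2 :=
  match I with
  | C_empty => (0 +i* s, 0 +i* t)
  | C_0 => (0 +i* s, t +i* pi)
  | C_1 | C_1' => (- s +i* t, s +i* t)
  | C_2 => (s +i* 0, 0 +i* t)
  | C_01 => (s +i* pi, t +i* pi)
  | C_02 => (s +i* 0, t +i* pi)
  | C_12 => (s +i* 0, t +i* 0)
  end.

Definition chart_dom (I : cell) (s t : R) : Prop :=
  match I with
  | C_empty => 0 < s /\ s < t /\ t < pi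
  | C_0 => (0 < s /\ s < pi) /\ 0 < t
  | C_1 | C_1' | C_2 => 0 < s /\ (0 < t /\ t < pi)
  | C_01 | C_12 => 0 < s /\ s < t
  | C_02 => 0 < s /\ 0 < t
  end.

Definition Y_surf (I : cell) : set C2 :=
  [set y | exists s t, chart_dom I s t /\ y = chart I s t].

Definition tangent (I : cell) (k : 'I_2) : C2 :=
  if k == 0 then chart I 1 0 - chart I 0 0 else chart I 0 1 - chart I 0 0.

Definition coord (j : 'I_2) (y : C2) : R[i] := if j == 0 then y.1 else y.2.

Definition dir_derive (v : C2) (u : C2 -> R[i]) (y : C2) : R[i] :=
  cderive1 (fun s : R => u (y.1 + s%:C * v.1, y.2 + s%:C * v.2)) 0.

Definition tangent_mx (I : cell) : 'M[R[i]]_2 :=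
  \matrix_(k, j) coord j (tangent I k).

(* The complex combination of the tangent directions of Y_I that maps chi_j
   to delta_{ij}. *)
Definition dchi (I : cell) (i : 'I_2) (u : C2 -> R[i]) (y : C2) : R[i] :=
  \sum_(k < 2) invmx (tangent_mx I) i k * dir_derive (tangent I k) u y.

End Surfaces.

Section Slices.
Variables (R : realType) (p q : nat).
Let d := (p + q)%N.
Local Notation mat := 'M[R]_((p + q).+2).
Local Notation Fmx := (@Fmx R p q).

Definition t_elt (phi psi : R) : mat := expm (phi *: Fmx 0 1 + psi *: Fmx d d.+1).

(* On Y_I the quotients by I2 = 2i are real, and so is (c1 - c2) / 2 in the
   case q = 0; there Re only turns a real element of R[i] into an element of R. *)
Definition x_elt (I : cell) (y : R[i] * R[i]) : mat :=
  let: (c1, c2) := y in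
  let I2 : R[i] := 2 * (0 +i* 1) in
  let ipi : R[i] := 0 +i* pi in
  let Z := (Re (c1 + c2) / 2) *: Fmx 0 d + (Re (c1 - c2) / 2) *: Fmx 1 d.+1 in
  match I with
  | C_empty => expm (Re ((c1 + c2 - 2 * ipi) / I2) *: Fmx 0 1
                     + Re ((c1 - c2) / I2) *: Fmx d d.+1)
  | C_0 => expm ((Re c2 / 2) *: (Fmx 0 d - Fmx 1 d.+1)
                 + Re ((c1 - ipi) / I2) *: (Fmx 0 1 + Fmx d d.+1))
  | C_2 => expm ((Re c1 / 2) *: (Fmx 0 d - Fmx 1 d.+1)
                 + Re (c2 / I2) *: (Fmx 0 1 + Fmx d d.+1)) *m t_elt 0 pi
  | C_1 =>
      if q == 0%N then
        expm (Re ((c1 + c2 - 2 * ipi) / I2) *: Fmx 0 1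
              + Re ((c1 - c2) / 2) *: Fmx d d.+1)
      else
        expm (Re ((c1 + c2 - 2 * ipi) / I2) *: Fmx 0 1
              + (Re (c1 - c2) / 2) *: Fmx 2 d.+1)
  | C_1' => expm (Re ((c1 + c2 - 2 * ipi) / I2) *: Fmx d d.+1
                  + (Re (c1 - c2) / 2) *: Fmx 0 d.-1)
  | C_01 => expm Z
  | C_02 => expm Z *m t_elt (pi / 2) (pi / 2)
  | C_12 => expm Z *m t_elt 0 pi
  end.

Definition Psi (I : cell) (f : mat -> R[i]) : R[i] * R[i] -> R[i] :=
  fun y => f (x_elt I y).

End Slices.

(* The root a epsilon_1 + b epsilon_2 is the pair (a, b). *)
Definition root := (int * int)%type.

Definition short_roots : seq root := [:: (1, 0); (-1, 0); (0, 1); (0, -1)].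
Definition long_roots : seq root := [:: (2, 0); (-2, 0); (0, 2); (0, -2)].
Definition middle_roots : seq root := [:: (1, 1); (1, -1); (-1, 1); (-1, -1)].

Definition pos_roots : seq root :=
  [:: (1, 0); (0, 1); (2, 0); (0, 2); (1, 1); (1, -1)].

Definition Bstar (g h : root) : int := g.1 * h.1 + g.2 * h.2.

Section Operator.
Variable R : realType.
Local Notation C2 := (R[i] * R[i])%type.

Definition k_mult (d : nat) (g : root) : R[i] :=
  if g \in short_roots then 0
  else if g \in long_roots then 2^-1
  else if g \in middle_roots then (d%:R - 2) / 2
  else 0.

Definition l_sqr (alpha beta : R[i]) (g : root) : R[i] :=
  if g \in short_roots then - (alpha * beta)
  else if g \in long_roots then - ((alpha - beta) / 2) ^+ 2
  else 0.

Definition pairing (g : root) (y : C2) : R[i] := g.1%:~R * y.1 + g.2%:~R * y.2.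

Definition droot (I : cell) (g : root) (u : C2 -> R[i]) (y : C2) : R[i] :=
  g.1%:~R * dchi I 0 u y + g.2%:~R * dchi I 1 u y.

Definition L_op (d : nat) (I : cell) (u : C2 -> R[i]) (y : C2) : R[i] :=
  dchi I 0 (dchi I 0 u) y + dchi I 1 (dchi I 1 u) y
  + \sum_(g <- pos_roots)
      k_mult d g * ((1 + cexp (- pairing g y)) / (1 - cexp (- pairing g y)))
      * droot I g u y.

Definition potential (alpha beta : R[i]) (y : C2) : R[i] :=
  \sum_(g <- pos_roots)
    l_sqr alpha beta g * (Bstar g g)%:~R
    / (cexp (pairing g y / 2) - cexp (- (pairing g y / 2))) ^+ 2.

End Operator.

(* Main.v *)
(** Read [f] along right-regularised curves [exp(sX) x] through the point [x = x_I(y)]: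
    its first and second derivatives there are a linear form [N X] and a bilinear form
    [N2 X X'] on [so(p+1,q+1)], extended to complex matrices.  Equivariance makes the
    elements of [Lie H] act by scalars on one side and those of [Ad(x) (Lie H)] on the other.
    In every cell there are complex vectors [v+, v-] in [span(e_1, .., e_d)] and [w+, w-] in
    [span(e_0, e_{d+1})], with [<v,v> = 1] and [<w,w> = -1], such that [w+ /\ v+] and
    [w- /\ v-] represent [d/dchi_1 + d/dchi_2] and [d/dchi_1 - d/dchi_2], and such that the
    boosts by [(chi_1 + chi_2)/2] of the plane [(v+, w+)] and by [(chi_1 - chi_2)/2] of
    [(v-, w-)] send [v+, v-] into [x span(e_1, .., e_d)] and [w+, w-] into
    [x span(e_0, e_{d+1})].  The Casimir element is a sum of squares of bivectors of this frame.
    Every bivector other than these two is a combination of elements of [Lie H] and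
    [Ad(x) (Lie H)]; it contributes a first-order term with a hyperbolic cotangent (from a
    commutator) or a potential (from the product of two scalars), and half-angle identities
    turn these into the coefficients of [L(k)] and of the potential. *)
Require Import Defs.
From HB Require Import structures.
From mathcomp Require Import all_boot all_order all_algebra complex.
From mathcomp Require Import all_classical all_reals all_analysis.
From mathcomp Require Import ring lra zify.

Set Implicit Arguments.
Unset Strict Implicit.
Unset Printing Implicit Defensive.

Import Order.TTheory GRing.Theory Num.Theory.
Import numFieldNormedType.Exports.

Local Open Scope classical_set_scope.
Local Open Scope ring_scope.
Local Open Scope complex_scope.

(** * The matrix exponential *)

Section MatrixExponential.
Variables (R : realType) (n : nat).
Implicit Types (X Y P : 'M[R]_n.+1) (s t : R).

(** The plane spanned by [e_0] and [e_{d+1}] has signature (1,1), so two orthogonal vectors of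
    square -1 in it cannot both be real, whereas only real one-parameter groups act on [f]. This
    shapes the proof: the 2-jet of [f] at [x] is treated as algebraic data, [N] and [N2] are linear
    over [R[i]], and every consequence of equivariance becomes a multilinear identity that passes
    from real basis bivectors to complex ones.

    The angles [chi_1] and [chi_2] themselves arise from the four mixed bivectors of
    [v+, v-, w+, w-]: their span splits into two planes, and the two boosts together act on these as
    hyperbolic rotations by the sum and the difference of the angles [(chi_1 +- chi_2)/2]. The
    [d - 2] remaining basis vectors, paired with [w+] and [w-], give the multiplicity of the middle
    roots. The weights enter through [w+ /\ w- = zeta (e_0 /\ e_{d+1})] with [zeta^2 = -1].

    That bivectors of [span(e_1, .., e_d)] act by zero is a separate point: it rests on elements of
    [H] that conjugate [F_{jk}] to [-F_{jk}]. *)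

Lemma mx_entry_le_norm X i j : `|X i j| <= `|X|.
Proof.
by rewrite [leRHS]/Num.Def.normr/= mx_normrE; exact: (le_bigmax _ _ (i, j)).
Qed.

(** The entrywise sup norm is not submultiplicative: each product sums [n.+1] terms, hence the
    factor [n.+1] in the base. *)
Lemma mx_exp_entry_bound X k i j : `|(X ^+ k) i j| <= (n.+1%:R * `|X|) ^+ k.
Proof.
elim: k i j => [|k IHk] i j.
  by rewrite !expr0 mxE; case: (i == j); rewrite ?normr1 ?normr0.
rewrite !exprS mxE (le_trans (ler_norm_sum _ _ _))//.
rewrite -mulrA mulr_natl -[X in _ *+ X]card_ord -sumr_const.
apply: ler_sum => l _; rewrite normrM ler_pM//; exact: mx_entry_le_norm.
Qed.

(** Comparison with [C] times the exponential series at [K * |x|]. *)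
Lemma is_cvg_pseries_fact (a : nat -> R) (C K x : R) :
  (forall k, `|a k| <= C * K ^+ k) -> 0 <= K ->
  cvgn (pseries (fun k => a k / k`!%:R) x).
Proof.
move=> aK K0; apply: normed_cvg.
apply: (@series_le_cvg _ _ (fun k => C * exp_coeff (K * `|x|) k)) => [k|k|k|].
- exact: normr_ge0.
- have C0 : 0 <= C by have := le_trans (normr_ge0 _) (aK 0); rewrite expr0 mulr1.
  by rewrite mulr_ge0// exp_coeff_ge0// mulr_ge0.
- rewrite /exp_coeff /= !normrM normfV [`|k`!%:R|]ger0_norm// normrX exprMn.
  have -> : `|a k| / k`!%:R * `|x| ^+ k = `|a k| * (`|x| ^+ k / k`!%:R) by ring.
  have -> : C * (K ^+ k * `|x| ^+ k / k`!%:R) =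
      C * K ^+ k * (`|x| ^+ k / k`!%:R) by ring.
  by rewrite ler_wpM2r// divr_ge0// exprn_ge0.
- by apply: is_cvg_seriesZ; exact: is_cvg_series_exp_coeff.
Qed.

(** The shift [l] makes the statement cover the derived series as well: differentiating the entry
    series termwise replaces [l] by [l.+1]. *)
Lemma is_cvg_expm_entry X l i j (x : R) :
  cvgn (pseries (fun k => (X ^+ (l + k)) i j / k`!%:R) x).
Proof.
apply: (@is_cvg_pseries_fact _ ((n.+1%:R * `|X|) ^+ l) (n.+1%:R * `|X|)) => [k|].
  by rewrite -exprD; exact: mx_exp_entry_bound.
by rewrite mulr_ge0.
Qed.

(** Moves the limit from the space of matrices to single entries, with [s] as the variable, so that
    the theory of real power series applies. *)
Lemma expm_scaleE X s i j :
  expm (s *: X) i j = limn (pseries (fun k => (X ^+ k) i j / k`!%:R) s).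
Proof.
rewrite /expm.
suff /cvg_lim -> : series (fun k => (k`!%:R)^-1 *: (s *: X) ^+ k) @ \oo -->
    (\matrix_(i, j) limn (pseries (fun k => (X ^+ k) i j / k`!%:R) s)
     : 'M[R]_n.+1).
- by rewrite mxE.
- exact: norm_hausdorff.
apply/cvgrPdist_le => /= e e0; near=> m.
rewrite /Num.Def.normr/= mx_normrE (bigmax_le _ (ltW e0))//= => ij _.
rewrite !mxE/=.
have -> : series (fun k : nat => k`!%:R^-1 *: (s *: X) ^+ k) m ij.1 ij.2 =
    pseries (fun k => (X ^+ k) ij.1 ij.2 / k`!%:R) s m.
  rewrite /pseries /series /= summxE; apply: eq_bigr => k _.
  by rewrite exprZn !mxE; ring.
move: ij; near: m; apply: filter_forall => /= ij.
by have /cvgrPdist_le/(_ _ e0) := @is_cvg_expm_entry X 0 ij.1 ij.2 s.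
Unshelve. all: by end_near. Qed.

Lemma mulmx_expmE Y X t i j : (Y *m expm (t *: X)) i j =
  limn (pseries (fun k => (Y *m X ^+ k) i j / k`!%:R) t).
Proof.
rewrite mxE; apply/esym/cvg_lim => //.
rewrite (_ : pseries _ t = (fun m => \sum_(l < n.+1)
    Y i l * pseries (fun k => (X ^+ k) l j / k`!%:R) t m)).
  apply: cvg_big => [|l _]; first exact: add_continuous.
  rewrite expm_scaleE; apply: cvgMl_tmp; exact: (@is_cvg_expm_entry X 0).
apply/funext => m; rewrite /pseries /series /=.
under [RHS]eq_bigr do rewrite mulr_sumr.
rewrite exchange_big; apply: eq_bigr => k _ /=.
by rewrite mxE mulr_suml mulr_suml; apply: eq_bigr => l _; rewrite !mulrA.
Qed.

Lemma expm_mulmxE Y X t i j : (expm (t *: X) *m Y) i j =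
  limn (pseries (fun k => (X ^+ k *m Y) i j / k`!%:R) t).
Proof.
rewrite mxE; apply/esym/cvg_lim => //.
rewrite (_ : pseries _ t = (fun m => \sum_(l < n.+1)
    pseries (fun k => (X ^+ k) i l / k`!%:R) t m * Y l j)).
  apply: cvg_big => [|l _]; first exact: add_continuous.
  rewrite expm_scaleE; apply: cvgMr_tmp; exact: (@is_cvg_expm_entry X 0).
apply/funext => m; rewrite /pseries /series /=.
under [RHS]eq_bigr do rewrite mulr_suml.
rewrite exchange_big; apply: eq_bigr => k _ /=.
by rewrite mxE mulr_suml mulr_suml; apply: eq_bigr => l _; ring.
Qed.

Lemma comm_expm Y X t : Y *m X = X *m Y -> Y *m expm (t *: X) = expm (t *: X) *m Y.
Proof.
move=> YX; apply/matrixP => i j; rewrite mulmx_expmE expm_mulmxE.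
suff YXk k : Y *m X ^+ k = X ^+ k *m Y by under eq_fun do rewrite YXk.
elim: k => [|k IHk]; first by rewrite expr0 mulmx1 mul1mx.
by rewrite exprS mulmxA YX -mulmxA IHk mulmxA.
Qed.

(** Termwise differentiation inside a radius larger than [|t|]; the cases [l = 0, 1, 2] of the
    shifted convergence result supply the three series that this requires. *)
Lemma is_derive_expm_entry X t i j :
  is_derive t 1 (fun s => expm (s *: X) i j) ((X *m expm (t *: X)) i j).
Proof.
have dE l : pseries_diffs (fun k => (X ^+ (l + k)) i j / k`!%:R) =
    (fun k => (X ^+ (l.+1 + k)) i j / k`!%:R).
  apply/funext => k; rewrite /pseries_diffs factS natrM invfM addnS mulrCA.
  by rewrite mulVKf.
have cvgX := @is_cvg_expm_entry X.
have -> : (fun s => expm (s *: X) i j) =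
    (fun s => limn (pseries (fun k => (X ^+ (0 + k)) i j / k`!%:R) s)).
  by apply/funext => s; exact: expm_scaleE.
suff -> : (X *m expm (t *: X)) i j =
    limn (pseries (pseries_diffs (fun k => (X ^+ (0 + k)) i j / k`!%:R)) t).
  apply: (@pseries_snd_diffs _ _ (`|t| + 1)) => //; rewrite ?dE//.
  by rewrite [ltRHS]ger0_norm ?addr_ge0// ltrDl.
by rewrite dE mulmx_expmE; under eq_fun do rewrite -[X *m _]exprS.
Qed.

End MatrixExponential.

Section MatrixCurves.
Variable R : realType.

(** Entrywise, so that the rules for real-valued derivatives apply to matrices of any shape. *)
Definition mx_is_derive m n (g : R -> 'M[R]_(m, n)) (t : R) (D : 'M[R]_(m, n)) :=
  forall i j, is_derive t 1 (fun s => g s i j) (D i j).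

Lemma mx_is_derive_cst m n (A : 'M[R]_(m, n)) t : mx_is_derive (fun=> A) t 0.
Proof. by move=> i j; rewrite mxE; exact: is_derive_cst. Qed.

Lemma mx_is_deriveM m n p (g : R -> 'M[R]_(m, n)) (h : R -> 'M[R]_(n, p)) t Dg Dh :
  mx_is_derive g t Dg -> mx_is_derive h t Dh ->
  mx_is_derive (fun s => g s *m h s) t (Dg *m h t + g t *m Dh).
Proof.
move=> dg dh i j.
have -> : (fun s => (g s *m h s) i j) =
    \sum_k (fun s => g s i k * h s k j).
  by apply/funext => s; rewrite mxE fct_sumE.
apply: is_derive_eq.
  apply: is_derive_sum => k; apply: is_deriveM; [exact: dg|exact: dh].
rewrite !mxE -big_split; apply: eq_bigr => k _ /=.
by rewrite addrC [_ *: Dg _ _]mulrC.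
Qed.

Lemma mx_is_derive_expm n (X : 'M[R]_n.+1) t :
  mx_is_derive (fun s => expm (s *: X)) t (X *m expm (t *: X)).
Proof. by move=> i j; exact: is_derive_expm_entry. Qed.

Lemma mx_is_derive0_cst m n (g : R -> 'M[R]_(m, n)) :
  (forall t, mx_is_derive g t 0) -> forall t, g t = g 0.
Proof.
move=> dg t; apply/matrixP => i j.
by apply: (@is_derive_0_is_cst _ (fun s => g s i j)) => x; have := dg x i j; rewrite mxE.
Qed.

Lemma expm0 n : expm (0 : 'M[R]_n.+1) = 1.
Proof.
apply/matrixP => i j; rewrite -(scale0r 0) expm_scaleE; apply/cvg_lim => //.
rewrite -cvg_shiftS /=; apply: cvg_near_cst; near=> m.
rewrite /pseries /series /= big_nat_recl// big1 ?addr0 => [|k _].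
  by rewrite !expr0 mulr1 invr1 mulr1.
by rewrite [X in _ * X]exprS mul0r mulr0.
Unshelve. all: by end_near. Qed.

(** The derivative of the product cancels because [X] commutes with its own exponential. Uniqueness
    for the linear equation follows, and with it the rules for sums, intertwiners, transposes and
    plane rotations, each by exhibiting a solution. *)
Lemma expm_ode_conserved n m (X : 'M[R]_n.+1) (g : R -> 'M[R]_(n.+1, m)) t :
  (forall t, mx_is_derive g t (X *m g t)) -> expm (t *: - X) *m g t = g 0.
Proof.
move=> dg; rewrite (@mx_is_derive0_cst _ _ (fun t => expm (t *: - X) *m g t)).
  by rewrite scale0r expm0 mul1mx.
move=> s; have := mx_is_deriveM (mx_is_derive_expm (- X) s) (dg s).
rewrite mulmxA [in X in _ + X](_ : _ *m X = X *m expm (s *: - X)).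
  by rewrite !mulNmx addNr.
by rewrite comm_expm// mulNmx mulmxN.
Qed.

Lemma expmNK n (X : 'M[R]_n.+1) : expm (- X) *m expm X = 1.
Proof.
have := expm_ode_conserved 1 (mx_is_derive_expm X).
by rewrite scale0r expm0 !scale1r.
Qed.

Lemma expmKN n (X : 'M[R]_n.+1) : expm X *m expm (- X) = 1.
Proof. by rewrite -[X in expm X *m _]opprK expmNK. Qed.

Lemma expm_ode_uniq n m (X : 'M[R]_n.+1) (g : R -> 'M[R]_(n.+1, m)) t :
  (forall t, mx_is_derive g t (X *m g t)) -> g t = expm (t *: X) *m g 0.
Proof.
move=> dg; rewrite -(expm_ode_conserved t dg) mulmxA scalerN expmKN.
by rewrite mul1mx.
Qed.

Lemma expmD n (X Y : 'M[R]_n.+1) :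
  X *m Y = Y *m X -> expm (X + Y) = expm X *m expm Y.
Proof.
move=> XY; have /(_ 1) := @expm_ode_uniq _ _ (X + Y)
  (fun t => expm (t *: X) *m expm (t *: Y)).
rewrite !scale1r scale0r expm0 mul1mx scale0r expm0 mulmx1 => -> // t.
have := mx_is_deriveM (mx_is_derive_expm X t) (mx_is_derive_expm Y t).
by rewrite -mulmxA [in X in _ + X]mulmxA -(comm_expm _ (esym XY)) -mulmxA mulmxDl.
Qed.

Lemma expm_intertwine n k (X : 'M[R]_n.+1) (Y : 'M[R]_k.+1) (A : 'M[R]_(n.+1, k.+1)) :
  X *m A = A *m Y -> expm X *m A = A *m expm Y.
Proof.
move=> XA; have /(_ 1) := @expm_ode_uniq _ _ X (fun t => A *m expm (t *: Y)).
rewrite !scale1r scale0r expm0 mulmx1 => -> // t.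
have := mx_is_deriveM (mx_is_derive_cst A t) (mx_is_derive_expm Y t).
by rewrite mul0mx add0r mulmxA -XA -mulmxA.
Qed.

Lemma expm_tr n (X : 'M[R]_n.+1) : expm X^T = (expm X)^T.
Proof.
have /(_ 1) := @expm_ode_uniq _ _ X^T (fun t => (expm (t *: X))^T).
rewrite !scale1r scale0r expm0 trmx1 mulmx1 => -> // t i j.
have -> : (fun s => (expm (s *: X))^T i j) = (fun s => expm (s *: X) j i).
  by apply/funext => s; rewrite mxE.
have -> : (X^T *m (expm (t *: X))^T) i j = (X *m expm (t *: X)) j i.
  by rewrite -trmx_mul (comm_expm _ erefl) mxE.
exact: is_derive_expm_entry.
Qed.

End MatrixCurves.

(** * Differentiability from continuous directional derivatives *)

Section ContinuouslyDerivable.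
Variable R : realType.

(** One formula for increments of either sign; of the intermediate point only the bound on its
    absolute value is kept. *)
Lemma MVT_from0 (g dg : R -> R) (h : R) :
  (forall c : R, `|c| <= `|h| -> is_derive c 1 g (dg c)) ->
  exists2 c, `|c| <= `|h| & g h - g 0 = h * dg c.
Proof.
move=> dgP.
have gc a b : (forall c, c \in `[a, b]%R -> `|c| <= `|h|) ->
    {within `[a, b], continuous g}.
  by move=> ab; apply: derivable_within_continuous => c /ab/dgP[].
have [h0|h0] := leP 0 h.
  have hn c : c \in `[0, h]%R -> `|c| <= `|h|.
    by rewrite in_itv/= => /andP[c0 ch]; rewrite !ger0_norm// (le_trans c0).
  have [|c cab ->] := @MVT_segment _ g dg 0 h h0 _ (gc _ _ hn).
    by move=> c cab; apply/dgP/hn; move: cab; rewrite !in_itv/= => /andP[/ltW-> /ltW->].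
  by exists c; [exact: hn|rewrite subr0 mulrC].
have hn c : c \in `[h, 0]%R -> `|c| <= `|h|.
  by rewrite in_itv/= => /andP[hc c0]; rewrite !ler0_norm ?lerN2// (le_trans hc).
have [|c cab gE] := @MVT_segment _ g dg h 0 (ltW h0) _ (gc _ _ hn).
  by move=> c cab; apply/dgP/hn; move: cab; rewrite !in_itv/= => /andP[/ltW-> /ltW->].
exists c; first exact: hn.
by rewrite -opprB gE; ring.
Qed.

Variable V : normedModType R.

(** The directions are added one at a time: the mean value theorem handles each segment, and
    continuity at [x] of the derivative in that direction bounds the error by [e] times the
    coefficient. *)
Lemma directional_increment (U : set V) (u : V -> R) (x : V)
    (I : eqType) (w : I -> V) (s : seq I) (e : R) :
  open U -> U x -> 0 < e ->
  (forall y v, U y -> derivable u y v) ->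
  (forall i, i \in s -> {for x, continuous (fun y => 'D_(w i) u y)}) ->
  exists2 r, 0 < r & forall h : I -> R, (forall i, i \in s -> `|h i| < r) ->
    `|u (x + \sum_(i <- s) h i *: w i) - u x - \sum_(i <- s) h i * 'D_(w i) u x|
      <= e * \sum_(i <- s) `|h i|.
Proof.
move=> Uo Ux e0 du; elim: s => [|a s IHs] cu.
  by exists 1 => // h _; rewrite !big_nil addr0 subrr subr0 normr0 mulr0.
have [|r1 r10 IH] := IHs; first by move=> i si; apply: cu; rewrite inE si orbT.
have /cvgrPdist_le/(_ _ e0) cua := cu a (mem_head _ _).
have /nbhs_ballP[r2 /= r20 xr2] : nbhs x (U `&` [set y | `|'D_(w a) u x - 'D_(w a) u y| <= e]).
  by apply: filterI => //; exact: open_nbhs_nbhs.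
(* Coefficients below [r2 / S] keep every intermediate point within [r2] of [x]; the summand 1 makes
   [S] positive and the final inequality strict. *)
pose S := 1 + \sum_(i <- a :: s) `|w i|.
have S0 : 0 < S by rewrite ltr_pwDl// sumr_ge0.
exists (Num.min r1 (r2 / S)); first by rewrite lt_min r10 divr_gt0.
move=> h hr; rewrite !big_cons.
set z := \sum_(j <- s) h j *: w j.
have hr1 i : i \in s -> `|h i| < r1.
  by move=> si; have := hr i; rewrite inE si orbT lt_min => /(_ isT)/andP[].
have hr2 i : i \in a :: s -> `|h i| < r2 / S.
  by move=> si; have := hr i si; rewrite lt_min => /andP[].
have near_x c : `|c| <= `|h a| -> ball x r2 (x + z + c *: w a).
  move=> ca; rewrite -ball_normE /= opprD opprD addrA addrA subrr add0r -opprD normrN.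
  have -> : r2 = r2 / S * S by rewrite divfK// gt_eqF.
  rewrite (le_lt_trans (ler_normD _ _))//.
  have -> : r2 / S * S = r2 / S + r2 / S * \sum_(i <- a :: s) `|w i|.
    by rewrite /S mulrDr mulr1.
  have r2S : 0 < r2 / S by rewrite divr_gt0.
  rewrite ltr_pwDl// big_cons mulrDr addrC lerD//.
    by rewrite normrZ ler_wpM2r// (le_trans ca)// ltW// hr2// mem_head.
  rewrite (le_trans (ler_norm_sum _ _ _))// mulr_sumr big_seq [leRHS]big_seq.
  by apply: ler_sum => i si; rewrite normrZ ler_wpM2r// ltW// hr2// inE si orbT.
have [|c ca gE] := @MVT_from0 (fun t => u (x + z + t *: w a))
    (fun t => 'D_(w a) u (x + z + t *: w a)) (h a).
  move=> c /near_x/xr2[/= Uc _].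
  have dE : (fun k : R => k^-1 *: ((fun t => u (x + z + t *: w a)) (k *: 1 + c) -
        u (x + z + c *: w a))) =
      (fun k => k^-1 *: (u (k *: w a + (x + z + c *: w a)) - u (x + z + c *: w a))).
    apply/funext => k; congr (_ *: (u _ - _)).
    by rewrite [k *: 1]mulr1 scalerDl [RHS]addrC addrA addrAC.
  by split; rewrite /derivable /derive dE//; exact: du.
have [Uc Dc] := xr2 _ (near_x _ ca).
have -> : u (x + (h a *: w a + z)) - u x - (h a * 'D_(w a) u x +
    \sum_(j <- s) h j * 'D_(w j) u x) =
  (u (x + z) - u x - \sum_(j <- s) h j * 'D_(w j) u x) -
    h a * ('D_(w a) u x - 'D_(w a) u (x + z + c *: w a)).
  move: gE; rewrite scale0r addr0 [h a *: _ + z]addrC addrA => gE.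
  rewrite [h a * (_ - _)]mulrBr -gE; ring.
rewrite (le_trans (ler_normB _ _))// [leRHS]mulrDr [leRHS]addrC lerD//; first exact: IH.
by rewrite normrM mulrC ler_wpM2r.
Qed.

End ContinuouslyDerivable.

Section MatrixFunctions.
Variables (R : realType) (m n : nat).
Local Notation mat := 'M[R]_(m, n).

Definition C1_on (U : set mat) (u : mat -> R) : Prop :=
  forall y v, U y -> derivable u y v /\ {for y, continuous (fun z => 'D_v u z)}.

(** [Csmooth] speaks of directional derivatives only, while the chain rule along curves needs a
    total derivative. The candidate is the linear map assembled from the partial derivatives along
    elementary matrices. *)
Lemma C1_differentiable (U : set mat) (u : mat -> R) x :
  open U -> C1_on U u -> U x -> differentiable u x.
Proof.
move=> Uo uC1 Ux.
pose E (i : 'I_m * 'I_n) : mat := delta_mx i.1 i.2.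
pose d (h : mat) := \sum_i h i.1 i.2 * 'D_(E i) u x.
have dlin : linear d.
  move=> a y z; rewrite /d scaler_sumr -big_split; apply: eq_bigr => i _ /=.
  by rewrite !mxE mulrDl -mulrA.
pose dM := GRing.isLinear.Build _ _ _ _ _ dlin.
pose dL : {linear mat -> R} := HB.pack d dM.
have dc : continuous dL.
  move=> y; have FF := nbhs_filter y.
  suff : (\sum_i h i.1 i.2 * 'D_(E i) u x) @[h --> y] --> d y by exact.
  apply: (@cvg_big _ _ _ _ _ _ _ _ _ _ _ FF) => [|i _].
    exact: add_continuous.
  by apply: cvgMr_tmp; exact: coord_continuous.
have uE : (u : mat -> R^o) \o shift x =
      cst (u x : R^o) + (dL : mat -> R^o) +o_ (0 : mat) (id : mat -> mat).
  apply/eqaddoP => _/posnumP[e] /=; rewrite fctE /=.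
  (* The error is a sum over [m * n] entries, each at most [|h|]; the extra 1 avoids a zero
     denominator. *)
  pose e1 := e%:num / (1 + (m * n)%:R).
  have e10 : 0 < e1 by rewrite divr_gt0// ltr_pwDl.
  have [|||||r r0 ur] := @directional_increment _ _ U u x _ E (index_enum _) e1 => //.
  - by move=> y v Uy; have [] := uC1 y v Uy.
  - by move=> i _; have [] := uC1 x (E i) Ux.
  have hr : \forall h \near (0 : mat), `|h| < r by exact: nbhs0_lt.
  near=> h.
  have hE : h = \sum_i h i.1 i.2 *: E i.
    by rewrite {1}[h]matrix_sum_delta pair_bigA.
  suff : `|u (x + \sum_i h i.1 i.2 *: E i) - u x - \sum_i h i.1 i.2 * 'D_(E i) u x|
      <= e%:num * `|h|.
    by rewrite -hE opprD addrA [h + x]addrC.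
  apply: le_trans (ur (fun i => h i.1 i.2) _) _.
    move=> i _; apply: le_lt_trans (_ : `|h| < r).
      by rewrite [leRHS]/Num.Def.normr/= mx_normrE; exact: (le_bigmax _ _ i).
    by near: h; exact: hr.
  rewrite /e1 -mulrA ler_wpM2l// ler_pdivrMl ?ltr_pwDl//.
  apply: (@le_trans _ _ (\sum_(i : 'I_m * 'I_n) `|h|)).
    apply: ler_sum => i _.
    by rewrite [leRHS]/Num.Def.normr/= mx_normrE; exact: (le_bigmax _ _ i).
  rewrite sumr_const card_prod !card_ord -[_ *+ _]mulr_natl.
  by rewrite ler_wpM2r// lerDr.
apply/diff_locallyP; rewrite (diff_unique dc uE); split => //.
Unshelve. all: by end_near. Qed.

Lemma C1_deriveE (U : set mat) (u : mat -> R) x v :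
  open U -> C1_on U u -> U x ->
  'D_v u x = \sum_(ij : 'I_m * 'I_n) v ij.1 ij.2 * 'D_(delta_mx ij.1 ij.2) u x.
Proof.
move=> Uo uC1 Ux; have du := C1_differentiable Uo uC1 Ux.
rewrite deriveE// {1}[v]matrix_sum_delta pair_bigA raddf_sum; apply: eq_bigr => ij _.
by rewrite /= linearZ deriveE.
Qed.

Lemma C1_is_derive_comp (U : set mat) (u : mat -> R) (g : R -> mat) t D :
  open U -> C1_on U u -> U (g t) -> mx_is_derive g t D ->
  is_derive t 1 (fun s => u (g s)) ('D_D u (g t)).
Proof.
move=> Uo uC1 Ut dg; have du := C1_differentiable Uo uC1 Ut.
have dgt : derivable g t 1 by apply/derivable_mxP => i j; have [] := dg i j.
have dgd : differentiable g t by exact/derivable1_diffP.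
have dug : differentiable (u \o g) t by exact: differentiable_comp.
split; first exact/derivable1_diffP.
rewrite [LHS]deriveE// diff_comp//= -[X in 'd u _ X]deriveE//.
rewrite -deriveE// derive_mx//; congr ('D__ u _).
by apply/matrixP => i j; rewrite mxE; have [_] := dg i j.
Qed.

Lemma mx_is_derive_near (U : set mat) (g : R -> mat) t D :
  open U -> U (g t) -> mx_is_derive g t D -> \forall s \near t, U (g s).
Proof.
move=> Uo Ut dg.
have dgt : derivable g t 1 by apply/derivable_mxP => i j; have [] := dg i j.
have /differentiable_continuous gc : differentiable g t by exact/derivable1_diffP.
by apply: gc; exact: open_nbhs_nbhs.
Qed.

End MatrixFunctions.

(** * Two-jets of smooth complex-valued functions *)

Section ComplexDerivatives.
Variable R : realType.
Implicit Types (h k : R -> R[i]) (c l z : R[i]).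

Lemma ReD z l : complex.Re (z + l) = complex.Re z + complex.Re l.
Proof. by case: z l => ? ? []. Qed.

Lemma ImD z l : complex.Im (z + l) = complex.Im z + complex.Im l.
Proof. by case: z l => ? ? []. Qed.

Lemma ReM z l :
  complex.Re (z * l) = complex.Re z * complex.Re l - complex.Im z * complex.Im l.
Proof. by case: z l => ? ? []. Qed.

Lemma ImM z l :
  complex.Im (z * l) = complex.Re z * complex.Im l + complex.Im z * complex.Re l.
Proof. by case: z l => ? ? []. Qed.

Lemma Re_sum (I : Type) (s : seq I) (F : I -> R[i]) :
  complex.Re (\sum_(i <- s) F i) = \sum_(i <- s) complex.Re (F i).
Proof. exact: raddf_sum. Qed.

Lemma Im_sum (I : Type) (s : seq I) (F : I -> R[i]) :
  complex.Im (\sum_(i <- s) F i) = \sum_(i <- s) complex.Im (F i).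
Proof. exact: raddf_sum. Qed.

Lemma ReZ (x : R) z : complex.Re (x%:C * z) = x * complex.Re z.
Proof. by case: z => a b /=; rewrite mul0r subr0. Qed.

Lemma ImZ (x : R) z : complex.Im (x%:C * z) = x * complex.Im z.
Proof. by case: z => a b /=; rewrite mul0r addr0. Qed.

Lemma is_cderive1_val h t l : is_cderive1 h t l -> cderive1 h t = l.
Proof.
move=> [[_ dRe] [_ dIm]]; rewrite /cderive1 !derive1E dRe dIm.
by case: l {dRe dIm}.
Qed.

Lemma is_cderive1_near h k t l :
  (\forall s \near t, h s = k s) -> is_cderive1 h t l -> is_cderive1 k t l.
Proof.
move=> hk [dRe dIm]; split.
- by apply: near_eq_is_derive dRe; near=> s; congr complex.Re; near: s.
- by apply: near_eq_is_derive dIm; near=> s; congr complex.Im; near: s.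
Unshelve. all: by end_near. Qed.

Lemma is_cderive1_eq h t l l' : is_cderive1 h t l -> l = l' -> is_cderive1 h t l'.
Proof. by move=> + <-. Qed.

Lemma is_cderive1_cst c (t : R) : is_cderive1 (fun=> c) t 0.
Proof. by split; exact: is_derive_cst. Qed.

Lemma is_cderive1D h k t l z : is_cderive1 h t l -> is_cderive1 k t z ->
  is_cderive1 (fun s => h s + k s) t (l + z).
Proof.
move=> [hRe hIm] [kRe kIm]; split.
- by under eq_fun do rewrite ReD; rewrite ReD; exact: is_deriveD.
- by under eq_fun do rewrite ImD; rewrite ImD; exact: is_deriveD.
Qed.

Lemma is_cderive1M h k t l z : is_cderive1 h t l -> is_cderive1 k t z ->
  is_cderive1 (fun s => h s * k s) t (l * k t + h t * z).
Proof.
move=> [hRe hIm] [kRe kIm]; split.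
- under eq_fun do rewrite ReM.
  apply: (is_derive_eq (is_deriveB (is_deriveM hRe kRe) (is_deriveM hIm kIm))).
  rewrite ReD !ReM; rewrite /GRing.scale /=; ring.
- under eq_fun do rewrite ImM.
  apply: (is_derive_eq (is_deriveD (is_deriveM hRe kIm) (is_deriveM hIm kRe))).
  rewrite ImD !ImM; rewrite /GRing.scale /=; ring.
Qed.

Lemma is_cderive1Z c h t l : is_cderive1 h t l ->
  is_cderive1 (fun s => c * h s) t (c * l).
Proof.
move=> dh; apply: is_cderive1_eq (is_cderive1M (is_cderive1_cst c t) dh) _.
by rewrite mul0r add0r.
Qed.

Lemma is_cderive1_sum (I : Type) (s : seq I) (h : I -> R -> R[i]) (l : I -> R[i]) t :
  (forall i, is_cderive1 (h i) t (l i)) ->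
  is_cderive1 (fun x => \sum_(i <- s) h i x) t (\sum_(i <- s) l i).
Proof.
move=> dh; elim: s => [|i s IHs].
  by under eq_fun do rewrite big_nil; rewrite big_nil; exact: is_cderive1_cst.
by under eq_fun do rewrite big_cons; rewrite big_cons; exact: is_cderive1D.
Qed.

End ComplexDerivatives.

Section Jets.
Variables (R : realType) (m n : nat).
Local Notation mat := 'M[R]_(m, n).
Local Notation idx := ('I_m * 'I_n)%type.

Definition mxC (V : mat) : 'M[R[i]]_(m, n) := map_mx (real_complex R) V.

Definition jetD (a : idx -> R[i]) (V : 'M[R[i]]_(m, n)) : R[i] :=
  \sum_(e : idx) V e.1 e.2 * a e.

(** [W] is the direction of the outer derivative and [V] that of the inner one. Complex directions
    are allowed although [f] lives on real matrices: this is the complexification of the Hessian. *)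
Definition jetQ (b : idx -> idx -> R[i]) (W V : 'M[R[i]]_(m, n)) : R[i] :=
  \sum_(e : idx) \sum_(e' : idx) V e.1 e.2 * (W e'.1 e'.2 * b e' e).

Lemma Csmooth_C1 (U : set mat) (u : mat -> R) vs :
  Csmooth U u -> C1_on U (iter_derive vs u).
Proof.
by move=> uS y v Uy; have [_ /(_ v)] := uS vs y Uy; have [] := uS (v :: vs) y Uy.
Qed.

(** Expanding the moving direction [V s] in elementary matrices leaves a finite sum of products of
    an entry with a C^1 function along [g], to which the product rule applies. *)
Lemma C1_second_derivative (U : set mat) (u : mat -> R) (g V : R -> mat) (W V' : mat) :
  open U -> Csmooth U u -> U (g 0) ->
  mx_is_derive g 0 W -> mx_is_derive V 0 V' ->
  is_derive (0 : R) (1 : R) (fun s => 'D_(V s) u (g s))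
    (\sum_(e : idx) V' e.1 e.2 * 'D_(delta_mx e.1 e.2) u (g 0) +
     \sum_(e : idx) \sum_(e' : idx) V 0 e.1 e.2 *
       (W e'.1 e'.2 * 'D_(delta_mx e'.1 e'.2) ('D_(delta_mx e.1 e.2) u) (g 0))).
Proof.
move=> Uo uS U0 dg dV.
apply: (@near_eq_is_derive _ _ _
  (fun s => \sum_(e : idx) V s e.1 e.2 * 'D_(delta_mx e.1 e.2) u (g s))).
  near=> s; rewrite (C1_deriveE _ Uo (@Csmooth_C1 U u [::] uS))//.
  by near: s; exact: mx_is_derive_near dg.
have -> : (fun s => \sum_(e : idx) V s e.1 e.2 * 'D_(delta_mx e.1 e.2) u (g s)) =
    \sum_(e : idx) (fun s => V s e.1 e.2 * 'D_(delta_mx e.1 e.2) u (g s)).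
  by apply/funext => s; rewrite fct_sumE.
pose dsum e : R := V 0 e.1 e.2 * 'D_W ('D_(delta_mx e.1 e.2) u) (g 0) +
  'D_(delta_mx e.1 e.2) u (g 0) * V' e.1 e.2.
suff /(is_derive_eq) : is_derive (0 : R) (1 : R)
    (\sum_(e : idx) (fun s => V s e.1 e.2 * 'D_(delta_mx e.1 e.2) u (g s)))
    (\sum_(e : idx) dsum e).
  apply; rewrite /dsum big_split [LHS]addrC; congr (_ + _); apply: eq_bigr => e _ /=.
    exact: mulrC.
  by rewrite (C1_deriveE _ Uo (@Csmooth_C1 U u [:: _] uS))// mulr_sumr.
have dP e : is_derive (0 : R) (1 : R)
    (fun s => V s e.1 e.2 * 'D_(delta_mx e.1 e.2) u (g s)) (dsum e).
  apply: is_deriveM; first exact: dV.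
  exact: (C1_is_derive_comp Uo (@Csmooth_C1 U u [:: _] uS)).
elim: (index_enum _) => [|e s IHs]; last first.
  by rewrite !big_cons; exact: is_deriveD.
by rewrite !big_nil; exact: is_derive_cst.
Unshelve. all: by end_near. Qed.

(** The coefficients are the partial derivatives at [x] of one local extension of [f]; the curves
    stay in [A], where [f] and the extension agree. Everything after this point uses [f] near [x]
    only through [a] and [b]. In the second clause the inner derivative must be known for all [s]
    near 0, hence the requirement on [g s] for every [s]. *)
Lemma smooth_on_jet (A : set mat) (f : mat -> R[i]) (x : mat) :
  smooth_on A f -> A x -> exists a b,
  (forall (g : R -> mat) D, (forall s, A (g s)) -> g 0 = x ->
     mx_is_derive g 0 D ->
     is_cderive1 (fun s => f (g s)) 0 (jetD a (mxC D))) /\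
  (forall (g : R -> R -> mat) (V : R -> mat) W V',
     (forall s t, A (g s t)) -> g 0 0 = x ->
     (forall s, mx_is_derive (g s) 0 (V s)) ->
     mx_is_derive (fun s => g s 0) 0 W -> mx_is_derive V 0 V' ->
     is_cderive1 (fun s => cderive1 (fun t => f (g s t)) 0) 0
       (jetD a (mxC V') + jetQ b (mxC W) (mxC (V 0)))).
Proof.
move=> fS Ax; have [U [u [v [Uo Ux uS vS fE]]]] := fS x Ax.
have uC1 := @Csmooth_C1 U u [::] uS; have vC1 := @Csmooth_C1 U v [::] vS.
have curve (g : R -> mat) D : (forall s, A (g s)) -> U (g 0) ->
    mx_is_derive g 0 D ->
    is_cderive1 (fun s => f (g s)) 0 ('D_D u (g 0) +i* 'D_D v (g 0)).
  move=> gA gU dg.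
  apply: (@is_cderive1_near _ (fun s => u (g s) +i* v (g s))).
    near=> s; rewrite fE//; near: s; exact: mx_is_derive_near dg.
  split.
    exact: (C1_is_derive_comp Uo uC1 gU dg).
  exact: (C1_is_derive_comp Uo vC1 gU dg).
exists (fun e => 'D_(delta_mx e.1 e.2) u x +i* 'D_(delta_mx e.1 e.2) v x).
exists (fun e' e => 'D_(delta_mx e'.1 e'.2) ('D_(delta_mx e.1 e.2) u) x +i*
                    'D_(delta_mx e'.1 e'.2) ('D_(delta_mx e.1 e.2) v) x).
split=> [g D gA g0 dg|g V W V' gA g0 dg dW dV].
  have := curve g D gA; rewrite g0 => /(_ Ux dg) /is_cderive1_eq; apply.
  rewrite /jetD !(C1_deriveE _ Uo _ Ux)//.
  by apply/eqP; rewrite eq_complex Re_sum Im_sum /=; apply/andP; split;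
    apply/eqP/eq_bigr => e _; rewrite mxE ?ReZ ?ImZ.
have U0 : U (g 0 0) by rewrite g0.
apply: (@is_cderive1_near _
    (fun s => 'D_(V s) u (g s 0) +i* 'D_(V s) v (g s 0))).
  near=> s; apply/esym/is_cderive1_val; apply: curve => //.
  by near: s; exact: mx_is_derive_near dW.
split.
- apply: (is_derive_eq (C1_second_derivative Uo uS U0 dW dV)).
  rewrite g0 ReD !Re_sum; congr (_ + _); apply: eq_bigr => e _.
    by rewrite mxE ReZ.
  by rewrite Re_sum; apply: eq_bigr => e' _; rewrite !mxE !ReZ.
- apply: (is_derive_eq (C1_second_derivative Uo vS U0 dW dV)).
  rewrite g0 ImD !Im_sum; congr (_ + _); apply: eq_bigr => e _.
    by rewrite mxE ImZ.
  by rewrite Im_sum; apply: eq_bigr => e' _; rewrite !mxE !ImZ.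
Unshelve. all: by end_near. Qed.

End Jets.

Section Complexification.
Variable R : realType.

Lemma mxCM m n k (A : 'M[R]_(m, n)) (B : 'M[R]_(n, k)) :
  mxC (A *m B) = mxC A *m mxC B.
Proof. exact: map_mxM. Qed.

Lemma mxCB m n (A B : 'M[R]_(m, n)) : mxC (A - B) = mxC A - mxC B.
Proof. exact: map_mxB. Qed.

Lemma mxCD m n (A B : 'M[R]_(m, n)) : mxC (A + B) = mxC A + mxC B.
Proof. exact: map_mxD. Qed.

Lemma mxCZ m n c (A : 'M[R]_(m, n)) : mxC (c *: A) = c%:C *: mxC A.
Proof. exact: map_mxZ. Qed.

Lemma mxC_tr m n (A : 'M[R]_(m, n)) : mxC A^T = (mxC A)^T.
Proof. by apply/matrixP => i j; rewrite !mxE. Qed.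

End Complexification.

(** * Exponentials in the orthogonal group *)

Section Rotations.
Variables (R : realType) (n : nat).
Implicit Types (X : 'M[R]_n.+1) (a b : 'cV[R]_n.+1).

Definition coshR (t : R) : R := (expR t + expR (- t)) / 2.
Definition sinhR (t : R) : R := (expR t - expR (- t)) / 2.

Lemma is_derive_coshR (t : R) : is_derive t 1 coshR (sinhR t).
Proof.
rewrite /coshR /sinhR; apply: is_derive_eq; rewrite /GRing.scale /=; ring.
Qed.

Lemma is_derive_sinhR (t : R) : is_derive t 1 sinhR (coshR t).
Proof.
rewrite /coshR /sinhR; apply: is_derive_eq; rewrite /GRing.scale /=; ring.
Qed.

(** The parameter [k] unites rotations ([k = -1], cosine and sine) and boosts ([k = 1], hyperbolic
    cosine and sine). *)
Lemma expm_plane (c s : R -> R) (k : R) X a b (t : R) :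
  (forall t : R, is_derive t 1 c (k * s t)) ->
  (forall t : R, is_derive t 1 s (c t)) -> c 0 = 1 -> s 0 = 0 ->
  X *m a = b -> X *m b = k *: a ->
  expm (t *: X) *m a = c t *: a + s t *: b.
Proof.
move=> dc ds c0 s0 Xa Xb.
rewrite (@expm_ode_uniq _ _ _ X (fun t => c t *: a + s t *: b)); last first.
  move=> u i j.
  have -> : (fun s0 => (c s0 *: a + s s0 *: b) i j) =
     (fun s0 => c s0 * a i j + s s0 * b i j) by apply/funext => v; rewrite !mxE.
  have dcu := dc u; have dsu := ds u.
  apply: is_derive_eq.
  rewrite mulmxDr -!scalemxAr Xa Xb !mxE /GRing.scale /=; ring.
by rewrite c0 s0 scale1r scale0r addr0.
Qed.

Lemma expm_rotation X a b t : X *m a = b -> X *m b = - a ->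
  expm (t *: X) *m a = cos t *: a + sin t *: b.
Proof.
move=> Xa Xb.
have dc (u : R) : is_derive u 1 cos (-1 * sin u) by rewrite mulN1r; exact: is_derive_cos.
by have := expm_plane t dc (@is_derive_sin R) (cos0 R) (sin0 R) Xa; apply; rewrite scaleN1r.
Qed.

Lemma expm_boost X a b t : X *m a = b -> X *m b = a ->
  expm (t *: X) *m a = coshR t *: a + sinhR t *: b.
Proof.
move=> Xa Xb.
have dc (u : R) : is_derive u 1 coshR (1 * sinhR u) by rewrite mul1r; exact: is_derive_coshR.
have c0 : coshR 0 = 1 by rewrite /coshR oppr0 expR0; field.
have s0 : sinhR 0 = 0 by rewrite /sinhR oppr0 subrr mul0r.
by have := expm_plane t dc is_derive_sinhR c0 s0 Xa; apply; rewrite scale1r.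
Qed.

Lemma expm_fix X a t : X *m a = 0 -> expm (t *: X) *m a = a.
Proof.
move=> Xa; apply/esym.
apply: (@expm_ode_uniq _ _ _ X (fun=> a) t) => u.
rewrite Xa; exact: mx_is_derive_cst.
Qed.

End Rotations.

(** * Bivectors as infinitesimal rotations of a quadratic space *)

Section Bivectors.
Variables (K : comPzRingType) (n : nat) (eta : 'M[K]_n).
Hypothesis eta_sym : eta^T = eta.
Implicit Types (u v w : 'cV[K]_n) (Z : 'M[K]_n).

(** The map sending [w] to [<v,w> u - <u,w> v]; with this sign [F_{mu,nu}] is the bivector of [e_mu]
    and [e_nu]. *)
Definition bivec u v : 'M[K]_n := (u *m v^T - v *m u^T) *m eta.

Definition dotp u v : K := (u^T *m eta *m v) 0 0.

Lemma dotpC u v : dotp u v = dotp v u.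
Proof.
rewrite /dotp; have -> : v^T *m eta *m u = (u^T *m eta *m v)^T.
  by rewrite !trmx_mul trmxK eta_sym mulmxA.
by rewrite [RHS]mxE.
Qed.

Lemma dotpDr u v w : dotp u (v + w) = dotp u v + dotp u w.
Proof. by rewrite /dotp mulmxDr mxE. Qed.

Lemma dotpZr c u v : dotp u (c *: v) = c * dotp u v.
Proof. by rewrite /dotp -scalemxAr mxE. Qed.

Lemma dotpDl u v w : dotp (v + w) u = dotp v u + dotp w u.
Proof. by rewrite dotpC dotpDr !(dotpC u). Qed.

Lemma dotpZl c u v : dotp (c *: v) u = c * dotp v u.
Proof. by rewrite dotpC dotpZr (dotpC u). Qed.

Lemma mulmx_rank1 u v w : u *m v^T *m eta *m w = dotp v w *: u.
Proof.
rewrite -!mulmxA; have -> : v^T *m (eta *m w) = (dotp v w)%:M.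
  by rewrite [LHS]mx11_scalar /dotp mulmxA.
by rewrite mul_mx_scalar.
Qed.

Lemma mul_bivec u v w : bivec u v *m w = dotp v w *: u - dotp u w *: v.
Proof. by rewrite /bivec !mulmxBl !mulmx_rank1. Qed.

Lemma bivecC u v : bivec v u = - bivec u v.
Proof. by rewrite /bivec -[RHS]mulNmx opprB. Qed.

Lemma bivecDl u v w : bivec (u + v) w = bivec u w + bivec v w.
Proof.
rewrite /bivec -mulmxDl; congr (_ *m _).
by rewrite raddfD/= mulmxDl mulmxDr opprD addrACA.
Qed.

Lemma bivecZl a u w : bivec (a *: u) w = a *: bivec u w.
Proof.
rewrite /bivec scalemxAl; congr (_ *m _).
by rewrite scalerBr linearZ/= -scalemxAl -scalemxAr.
Qed.

Lemma bivec0l w : bivec 0 w = 0.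
Proof. by rewrite -(scale0r 0) bivecZl scale0r. Qed.

Lemma bivecDr u v w : bivec w (u + v) = bivec w u + bivec w v.
Proof. by rewrite bivecC bivecDl opprD -!bivecC. Qed.

Lemma bivecZr a u w : bivec w (a *: u) = a *: bivec w u.
Proof. by rewrite bivecC bivecZl -scalerN -bivecC. Qed.

Lemma bivecNl u w : bivec (- u) w = - bivec u w.
Proof. by rewrite -scaleN1r bivecZl scaleN1r. Qed.

Lemma bivecNr u w : bivec w (- u) = - bivec w u.
Proof. by rewrite -scaleN1r bivecZr scaleN1r. Qed.

Lemma bivecvv u : bivec u u = 0.
Proof. by rewrite /bivec subrr mul0mx. Qed.

Lemma bivec_antisym u v : (bivec u v)^T *m eta + eta *m bivec u v = 0.
Proof.
rewrite /bivec trmx_mul eta_sym raddfB/= !trmx_mul !trmxK -mulmxA -mulmxDr.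
by rewrite -mulmxDl addrC subrKA subrr mul0mx mulmx0.
Qed.

(** The rule [Ad(Z)(u /\ v) = Zu /\ Zv], kept free of inverses. *)
Lemma bivec_conj Z u v : Z^T *m eta *m Z = eta ->
  Z *m bivec u v = bivec (Z *m u) (Z *m v) *m Z.
Proof.
move=> ZE; rewrite /bivec.
have -> : Z *m u *m (Z *m v)^T - Z *m v *m (Z *m u)^T =
    Z *m (u *m v^T - v *m u^T) *m Z^T.
  by rewrite !trmx_mul mulmxBr mulmxBl !mulmxA.
by rewrite -{1}ZE !mulmxA.
Qed.

Lemma bivec_comm Z u v : Z^T *m eta + eta *m Z = 0 ->
  Z *m bivec u v - bivec u v *m Z = bivec (Z *m u) v + bivec u (Z *m v).
Proof.
move=> /eqP; rewrite addrC addr_eq0 => /eqP ZE.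
rewrite /bivec -[_ *m eta *m Z]mulmxA ZE mulmxN opprK !mulmxA -!mulmxDl.
congr (_ *m _); rewrite !trmx_mul mulmxBr mulmxBl !mulmxA.
by rewrite addrACA [RHS]addrACA [X in _ = _ + X]addrC.
Qed.

(** The vectors [delta_mx i 0] are real, so this expansion is what carries identities from real
    bivectors to complex ones. The matrix [Z] stays outside because the identities are also needed
    in the frame moved by [x]. *)
Lemma bivec_sum_deltas Z u v : bivec (Z *m u) (Z *m v) =
  \sum_i \sum_j (u i 0 * v j 0) *:
    bivec (Z *m delta_mx i 0) (Z *m delta_mx j 0).
Proof.
have colE (w : 'cV[K]_n) : Z *m w = \sum_i w i 0 *: (Z *m delta_mx i 0).
  rewrite {1}[w]matrix_sum_delta mulmx_sumr; apply: eq_bigr => i _.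
  by rewrite big_ord1 scalemxAr.
have suml (w : 'cV[K]_n) (F : 'I_n -> 'cV[K]_n) :
    bivec (\sum_i F i) w = \sum_i bivec (F i) w.
  apply: (big_morph (bivec^~ w)) => [x y|]; first exact: bivecDl.
  exact: bivec0l.
have sumr (w : 'cV[K]_n) (F : 'I_n -> 'cV[K]_n) :
    bivec w (\sum_i F i) = \sum_i bivec w (F i).
  apply: (big_morph (bivec w)) => [x y|]; first exact: bivecDr.
  by rewrite -(scale0r 0) bivecZr scale0r.
rewrite [Z *m u]colE suml; apply: eq_bigr => i _; rewrite bivecZl [Z *m v]colE sumr.
by rewrite scaler_sumr; apply: eq_bigr => j _; rewrite bivecZr scalerA.
Qed.

End Bivectors.

Section Signature.
Variables (K : comPzRingType) (p m : nat).

Definition ev (k : nat) : 'cV[K]_m := \col_i (i == k :> nat)%:R.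

Definition sgn_eta (k : nat) : K := if (k <= p)%N then 1 else -1.

Definition etaK : 'M[K]_m := \matrix_(i, j) ((i == j)%:R * sgn_eta i).

Lemma sgn_eta_sqr k : sgn_eta k * sgn_eta k = 1.
Proof. by rewrite /sgn_eta; case: ifP => _; rewrite ?mulrNN mulr1. Qed.

Lemma etaK_tr : etaK^T = etaK.
Proof.
by apply/matrixP => i j; rewrite !mxE eq_sym; case: eqP => [->|]; rewrite ?mul0r.
Qed.

Lemma etaK_sqr : etaK *m etaK = 1%:M.
Proof.
apply/matrixP => i j; rewrite !mxE (bigD1 i)//= !mxE eqxx mul1r big1 => [|l li].
  by case: eqVneq => [->|]; rewrite ?mul1r ?sgn_eta_sqr ?mul0r ?mulr0 addr0.
by rewrite !mxE eq_sym (negPf li) !mul0r.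
Qed.

Lemma etaK_ev k : etaK *m ev k = sgn_eta k *: ev k.
Proof.
apply/matrixP => i j; rewrite !mxE (bigD1 i)//= !mxE eqxx mul1r big1 => [|l li].
  by rewrite addr0; case: (eqVneq (i : nat) k) => [->|]; rewrite ?mulr0.
by rewrite !mxE eq_sym (negPf li) !mul0r.
Qed.

Lemma ev_dot j k : (j < m)%N -> (ev j)^T *m ev k = ((j == k)%:R)%:M.
Proof.
move=> jm; apply/matrixP => a b; rewrite !mxE !ord1 eqxx mulr1n.
rewrite (bigD1 (Ordinal jm))//= !mxE /= eqxx mul1r big1 ?addr0// => i ij.
by rewrite !mxE (negPf (_ : i != j :> nat)) ?mul0r.
Qed.

Lemma dotp_ev j k : (j < m)%N -> dotp etaK (ev j) (ev k) = (j == k)%:R * sgn_eta k.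
Proof.
move=> jn; rewrite /dotp -mulmxA etaK_ev -scalemxAr ev_dot// !mxE eqxx mulr1n.
by rewrite mulrC.
Qed.

Lemma bivec_evE k l (i j : 'I_m) : bivec etaK (ev k) (ev l) i j =
  (i == k :> nat)%:R * ((j == l :> nat)%:R * sgn_eta j)
  - (i == l :> nat)%:R * ((j == k :> nat)%:R * sgn_eta j).
Proof.
have evE a b : (ev a *m (ev b)^T *m etaK) i j =
    (i == a :> nat)%:R * ((j == b :> nat)%:R * sgn_eta j).
  rewrite -mulmxA -[_^T *m etaK]trmxK trmx_mul etaK_tr trmxK etaK_ev.
  rewrite !mxE big_ord1 !mxE mulrC [in RHS]mulrC.
  by case: (eqVneq (j : nat) b) => [->|_]; rewrite ?mulr1 ?mul1r// ?mulr0 ?mul0r.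
by rewrite /bivec mulmxBl mxE [X in _ + X]mxE !evE.
Qed.

End Signature.

(** * The identity component of SO(p+1,q+1) and its one-parameter subgroups *)

Section OrthogonalGroup.
Variables (R : realType) (p q : nat).
Let d := (p + q)%N.
Local Notation n := (p + q).+2.
Local Notation mat := 'M[R]_n.
Local Notation eta := (etaK R p n).
Local Notation Fmx := (@Fmx R p q).
Implicit Types X Y g h : mat.

Lemma eta_etaK : Defs.eta R p q = eta.
Proof.
apply/matrixP => i j; rewrite !mxE /eta_coef -(inj_eq val_inj) /= /sgn_eta.
by case: eqP => _; rewrite ?mul1r ?mul0r.
Qed.

Lemma Fmx_bivec mu nu : Fmx mu nu = bivec eta (ev R n mu) (ev R n nu).
Proof.
have cE k (j : 'I_n) : eta_coef R p k j = (j == k :> nat)%:R * sgn_eta R p j.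
  by rewrite /eta_coef /sgn_eta eq_sym; case: eqVneq => [<-|]; rewrite ?mul1r ?mul0r.
by apply/matrixP => i j; rewrite bivec_evE mxE !cE.
Qed.

Lemma so_algE X : (X \in so_alg R p q) = (X^T *m eta + eta *m X == 0).
Proof. by rewrite -eta_etaK; apply/so_algP/eqP. Qed.

Lemma bivec_so (u v : 'cV[R]_n) : bivec eta u v \in so_alg R p q.
Proof. by rewrite so_algE; apply/eqP; exact: bivec_antisym (etaK_tr _ _ _) _ _. Qed.

Lemma conj_so g h X : g^T *m eta *m g = eta -> g *m h = 1 ->
  X \in so_alg R p q -> g *m X *m h \in so_alg R p q.
Proof.
move=> gE gh; rewrite !so_algE !addr_eq0 => /eqP XE.
have gh' : g^T *m eta = eta *m h by rewrite -[LHS]mulmx1 -[1%:M]gh mulmxA gE.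
have hg : h^T *m eta = eta *m g.
  by rewrite -[RHS]trmxK trmx_mul etaK_tr gh' trmx_mul etaK_tr.
apply/eqP; rewrite !trmx_mul -!mulmxA gh' [X^T *m _]mulmxA XE mulmxA.
by rewrite mulmxN mulNmx !mulmxA hg.
Qed.

Lemma expm_SO X : X \in so_alg R p q -> @SO_pq R p q (expm X).
Proof.
have orth Y : Y \in so_alg R p q -> (expm Y)^T *m eta *m expm Y = eta.
  rewrite so_algE addr_eq0 => /eqP YE.
  by rewrite -expm_tr (@expm_intertwine _ _ _ _ (- Y)) ?mulmxN// -mulmxA expmNK mulmx1.
rewrite /SO_pq eta_etaK => Xso; split; first exact: orth.
(* Orthogonality of [expm X] leaves the sign of its determinant open; as the square of
   [expm (X / 2)], itself orthogonal, it has determinant 1. *)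
have -> : X = 2^-1 *: X + 2^-1 *: X by rewrite -scalerDl (_ : _ + _ = 1) ?scale1r//; field.
rewrite expmD// det_mulmx.
have /(congr1 determinant) : (expm (2^-1 *: X))^T *m eta *m expm (2^-1 *: X) = eta.
  by apply: orth; rewrite memvZ.
rewrite !det_mulmx det_tr mulrAC -[RHS]mul1r; apply: mulIf.
have : \det (eta *m eta) = 1 by rewrite etaK_sqr det1.
by rewrite det_mulmx => /(congr1 (fun x => x == 0)); rewrite mulf_eq0 oner_eq0 orbb => ->.
Qed.

Lemma SO_mul g h : @SO_pq R p q g -> @SO_pq R p q h -> @SO_pq R p q (g *m h).
Proof.
rewrite /SO_pq eta_etaK => -[gE gd] [hE hd]; split; last by rewrite det_mulmx gd hd mulr1.
rewrite trmx_mul; have -> : h^T *m g^T *m eta *m (g *m h) =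
  h^T *m (g^T *m eta *m g) *m h by rewrite !mulmxA.
by rewrite gE.
Qed.

Lemma SO0_SO g : @SO0_pq R p q g -> @SO_pq R p q g.
Proof. exact: connected_component_sub. Qed.

(** The image of the real line under a continuous curve is connected, so it cannot leave the
    component in which it starts. *)
Lemma expm_curve_SO0 (c : R -> mat) t :
  (forall s, @SO_pq R p q (c s)) -> (forall s, derivable c s 1) ->
  @SO0_pq R p q (c 0) -> @SO0_pq R p q (c t).
Proof.
move=> cSO dc c0; apply: connected_component_trans c0 _.
apply: (@connected_component_max _ _ (range c)).
- by exists 0.
- by move=> _ [s _ <-].
- apply: connected_continuous_connected.
    by apply/connected_intervalP => x y _ _ z _.
  apply: continuous_subspaceT => s.
  by apply: differentiable_continuous; exact/derivable1_diffP.
- by exists t.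
Qed.

Lemma mx_derivable m k (c : R -> 'M[R]_(m, k)) t D :
  mx_is_derive c t D -> derivable c t 1.
Proof. by move=> dc; apply/derivable_mxP => i j; have [] := dc i j. Qed.

Lemma SO0_expml X g :
  X \in so_alg R p q -> @SO0_pq R p q g -> @SO0_pq R p q (expm X *m g).
Proof.
move=> Xso gG; rewrite -[X]scale1r.
apply: (@expm_curve_SO0 (fun s => expm (s *: X) *m g)) => [s|s|].
- by apply: SO_mul; [apply: expm_SO; rewrite memvZ|exact: SO0_SO].
- apply: mx_derivable.
  by apply: mx_is_deriveM; [exact: mx_is_derive_expm|exact: mx_is_derive_cst].
- by rewrite scale0r expm0 mul1mx.
Qed.

Lemma SO0_expmr X g :
  X \in so_alg R p q -> @SO0_pq R p q g -> @SO0_pq R p q (g *m expm X).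
Proof.
move=> Xso gG; rewrite -[X]scale1r.
apply: (@expm_curve_SO0 (fun s => g *m expm (s *: X))) => [s|s|].
- by apply: SO_mul; [exact: SO0_SO|apply: expm_SO; rewrite memvZ].
- apply: mx_derivable.
  by apply: mx_is_deriveM; [exact: mx_is_derive_cst|exact: mx_is_derive_expm].
- by rewrite scale0r expm0 mulmx1.
Qed.

Lemma SO0_1 : @SO0_pq R p q 1%:M.
Proof.
apply: connected_component_refl; split; last exact: det1.
by rewrite trmx1 mul1mx mulmx1.
Qed.

Lemma SO0_expm X : X \in so_alg R p q -> @SO0_pq R p q (expm X).
Proof. by move=> Xso; rewrite -[expm X]mulmx1; apply: SO0_expml => //; exact: SO0_1. Qed.

Lemma H_expm X : X \in so_alg R p q -> X *m Fmx 0 d.+1 = Fmx 0 d.+1 *m X ->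
  @H_grp R p q (expm X).
Proof. by move=> Xso XF; split; [exact: SO0_expm|exact: expm_intertwine]. Qed.

Lemma H_1 : @H_grp R p q 1%:M.
Proof. by split; [exact: SO0_1|rewrite mul1mx mulmx1]. Qed.

Lemma Fmx_so mu nu : Fmx mu nu \in so_alg R p q.
Proof. by rewrite Fmx_bivec bivec_so. Qed.

Lemma mul_Fmx_ev mu nu k : (mu < n)%N -> (nu < n)%N ->
  Fmx mu nu *m ev R n k =
    ((nu == k)%:R * sgn_eta R p k) *: ev R n mu - ((mu == k)%:R * sgn_eta R p k) *: ev R n nu.
Proof. by move=> mun nun; rewrite Fmx_bivec mul_bivec !dotp_ev. Qed.

Lemma Fmx_comm_bivec X u v : X \in so_alg R p q ->
  X *m bivec eta u v - bivec eta u v *m X = bivec eta (X *m u) v + bivec eta u (X *m v).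
Proof. by rewrite so_algE => /eqP; exact: bivec_comm. Qed.

Lemma Fmx_disjoint mu nu k l : (mu < n)%N -> (nu < n)%N ->
  mu != k -> mu != l -> nu != k -> nu != l ->
  Fmx mu nu *m Fmx k l = Fmx k l *m Fmx mu nu.
Proof.
move=> mun nun mk ml nk nl; apply/eqP; rewrite -subr_eq0 [Fmx k l]Fmx_bivec.
rewrite Fmx_comm_bivec ?Fmx_so// !mul_Fmx_ev// (negPf mk) (negPf ml) (negPf nk) (negPf nl).
by rewrite !mul0r !scale0r subrr /bivec !mul0mx trmx0 !mulmx0 !subrr mul0mx addr0.
Qed.

End OrthogonalGroup.

(** * Characters of H on rotations and boosts of span(e_1, .., e_d) *)

Section Characters.
Variables (R : realType) (p q : nat).
Let d := (p + q)%N.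
Local Notation n := (p + q).+2.
Local Notation mat := 'M[R]_n.
Local Notation eta := (etaK R p n).
Local Notation Fmx := (@Fmx R p q).
Local Notation ev := (ev R n).
Local Notation sgn := (sgn_eta R p).
Implicit Types X Y g h : mat.

Lemma Fmx_ev1 j k : (j < n)%N -> (k < n)%N -> j != k -> Fmx j k *m ev j = - sgn j *: ev k.
Proof.
move=> jn kn jk; rewrite mul_Fmx_ev// eqxx eq_sym (negPf jk) mul0r scale0r sub0r.
by rewrite mul1r scaleNr.
Qed.

Lemma Fmx_ev2 j k : (j < n)%N -> (k < n)%N -> j != k -> Fmx j k *m ev k = sgn k *: ev j.
Proof.
move=> jn kn jk; rewrite mul_Fmx_ev// eqxx (negPf jk) mul0r scale0r subr0.
by rewrite mul1r.
Qed.

Lemma expm_Fmx_fix j k l t : (j < n)%N -> (k < n)%N -> l != j -> l != k ->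
  expm (t *: Fmx j k) *m ev l = ev l.
Proof.
move=> jn kn lj lk; apply: expm_fix; rewrite mul_Fmx_ev// ![_ == l]eq_sym.
by rewrite (negPf lj) (negPf lk) !mul0r !scale0r subrr.
Qed.

Lemma expm_Fmx_rot1 j k t : (j < n)%N -> (k < n)%N -> j != k -> sgn j = sgn k ->
  expm (t *: Fmx j k) *m ev j = cos t *: ev j - (sgn k * sin t) *: ev k.
Proof.
move=> jn kn jk s; rewrite (expm_rotation t (Fmx_ev1 jn kn jk)).
  by rewrite scalerA mulrN scaleNr s [sin t * _]mulrC.
by rewrite -scalemxAr Fmx_ev2// scalerA mulNr s sgn_eta_sqr scaleN1r.
Qed.

Lemma expm_Fmx_rot2 j k t : (j < n)%N -> (k < n)%N -> j != k -> sgn j = sgn k ->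
  expm (t *: Fmx j k) *m ev k = cos t *: ev k + (sgn k * sin t) *: ev j.
Proof.
move=> jn kn jk s; rewrite (expm_rotation t (Fmx_ev2 jn kn jk)).
  by rewrite scalerA [sin t * _]mulrC.
by rewrite -scalemxAr Fmx_ev1// scalerA mulrN s sgn_eta_sqr scaleN1r.
Qed.

Lemma expm_Fmx_boost1 j k t : (j < n)%N -> (k < n)%N -> j != k -> sgn j = - sgn k ->
  expm (t *: Fmx j k) *m ev j = coshR t *: ev j + (sgn k * sinhR t) *: ev k.
Proof.
move=> jn kn jk s; rewrite (expm_boost t (Fmx_ev1 jn kn jk)).
  by rewrite scalerA s opprK [sinhR t * _]mulrC.
by rewrite -scalemxAr Fmx_ev2// scalerA s opprK sgn_eta_sqr scale1r.
Qed.

Lemma expm_Fmx_boost2 j k t : (j < n)%N -> (k < n)%N -> j != k -> sgn j = - sgn k ->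
  expm (t *: Fmx j k) *m ev k = coshR t *: ev k + (sgn k * sinhR t) *: ev j.
Proof.
move=> jn kn jk s; rewrite (expm_boost t (Fmx_ev2 jn kn jk)).
  by rewrite scalerA [sinhR t * _]mulrC.
by rewrite -scalemxAr Fmx_ev1// scalerA s opprK sgn_eta_sqr scale1r.
Qed.

Lemma expm_Fmx_pi j k l : (j < n)%N -> (k < n)%N -> j != k -> sgn j = sgn k ->
  expm (pi *: Fmx j k) *m ev l = (if (l == j) || (l == k) then -1 else 1) *: ev l.
Proof.
move=> jn kn jk s; have [->|lj] := eqVneq l j.
  by rewrite expm_Fmx_rot1// cospi sinpi mulr0 scale0r subr0.
have [->|lk] := eqVneq l k; first by rewrite expm_Fmx_rot2// cospi sinpi mulr0 scale0r addr0.
by rewrite scale1r expm_Fmx_fix.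
Qed.

Lemma expm_orth X : X \in so_alg R p q -> (expm X)^T *m eta *m expm X = eta.
Proof. by move=> /expm_SO []; rewrite eta_etaK. Qed.

Lemma conj_Fmx g (e1 e2 : R) j k : g^T *m eta *m g = eta ->
  g *m ev j = e1 *: ev j -> g *m ev k = e2 *: ev k ->
  g *m Fmx j k = (e1 * e2) *: (Fmx j k *m g).
Proof.
move=> gE gj gk; rewrite Fmx_bivec bivec_conj// gj gk bivecZl bivecZr scalerA.
by rewrite -scalemxAl.
Qed.

Variable lam : mat -> R[i].
Hypothesis lamP : is_character lam.

(** A commutative target does not see conjugation, so [lam] agrees at [exp(sX)] and [exp(-sX)] and
    its square there is 1. Taking [s = t / 2] and squaring removes the sign. *)
Lemma character_reversed X Z t : X \in so_alg R p q -> Z \in so_alg R p q ->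
  X *m Fmx 0 d.+1 = Fmx 0 d.+1 *m X -> @H_grp R p q (expm Z) ->
  expm Z *m X = - (X *m expm Z) -> lam (expm (t *: X)) = 1.
Proof.
move=> Xso Zso XF ZH ZX; have [lam1 lamM _ _] := lamP.
have XH s : @H_grp R p q (expm (s *: X)).
  by apply: H_expm; rewrite ?memvZ// -scalemxAl -scalemxAr XF.
have ZNH : @H_grp R p q (expm (- Z)).
  split; first by apply: SO0_expm; rewrite memvN.
  have [_ ZF] := ZH.
  rewrite -[LHS]mulmx1 -[1%:M](expmKN Z) [in LHS]mulmxA -[_ *m Fmx _ _ *m _]mulmxA -ZF.
  by rewrite mulmxA expmNK mul1mx.
have lamZ : lam (expm Z) != 0.
  apply/eqP => l0; have := lamM _ _ ZH ZNH.
  by rewrite expmKN lam1 l0 mul0r => /eqP; rewrite oner_eq0.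
have XNH s : @H_grp R p q (expm (- (s *: X))) by rewrite -scaleNr; exact: XH.
have XNX s : lam (expm (s *: X)) = lam (expm (- (s *: X))).
  have E : expm (- (s *: X)) *m expm Z = expm Z *m expm (s *: X).
    by apply: expm_intertwine; rewrite mulNmx -scalemxAl -scalemxAr ZX scalerN.
  have := congr1 lam E; rewrite (lamM _ _ (XNH s) ZH) (lamM _ _ ZH (XH s)).
  by rewrite [RHS]mulrC => /(mulIf lamZ).
have lam2 s : lam (expm (s *: X)) * lam (expm (s *: X)) = 1.
  by rewrite {2}XNX -(lamM _ _ (XH s) (XNH s)) expmKN.
have <- : (t / 2) *: X + (t / 2) *: X = t *: X.
  by rewrite -scalerDl; congr (_ *: _); field.
by rewrite expmD// (lamM _ _ (XH _) (XH _)) lam2.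
Qed.

Hypotheses (qp : (q <= p)%N) (d2 : (2 < p + q)%N).

Lemma sgnP j k : (sgn j = sgn k) <-> ((j <= p)%N = (k <= p)%N).
Proof.
have N11 : (-1 : R) <> 1.
  by move/eqP; rewrite -subr_eq0 -opprD oppr_eq0 (_ : 1 + 1 = 2%:R) ?pnatr_eq0.
rewrite /sgn_eta; case: (j <= p)%N; case: (k <= p)%N; split => //.
- by move/esym.
Qed.

(** It suffices to find in [H] an element fixing [F_{0,d+1}] and reversing [F_{jk}]: a product of
    half turns that changes the sign of exactly one of [e_j], [e_k]. *)
Lemma character_Fmx j k t : (0 < j <= d)%N -> (0 < k <= d)%N ->
  lam (expm (t *: Fmx j k)) = 1.
Proof.
move=> jd kd; have [<-|jk] := eqVneq j k.
  have [lam1 _ _ _] := lamP.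
  by rewrite Fmx_bivec bivecvv scaler0 expm0.
have Fso := @Fmx_so R p q.
have jkF : Fmx j k *m Fmx 0 d.+1 = Fmx 0 d.+1 *m Fmx j k.
  by apply: Fmx_disjoint; lia.
(* A half turn in the plane [(l, m)] of equal signs meets the plane [(j, k)] in exactly one axis. It
   needs a further index [m] between 1 and [d] with the same sign as [l]. *)
have typeA l m : (0 < l <= d)%N -> (0 < m <= d)%N -> l != m -> sgn l = sgn m ->
    l \in [:: j; k] -> m \notin [:: j; k] -> lam (expm (t *: Fmx j k)) = 1.
  move=> ld md lm slm ljk mjk; apply: (@character_reversed _ (pi *: Fmx l m)) => //.
  - by rewrite memvZ.
  - apply: H_expm; first by rewrite memvZ.
    by rewrite -scalemxAl -scalemxAr Fmx_disjoint//; lia.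
  - have Zv v : expm (pi *: Fmx l m) *m ev v = (if (v == l) || (v == m) then -1 else 1) *: ev v.
      by apply: expm_Fmx_pi => //; lia.
    rewrite (conj_Fmx _ (Zv j) (Zv k)); last by apply: expm_orth; rewrite memvZ.
    move: ljk mjk jk; rewrite !inE negb_or => /orP[] /eqP -> /andP[mj mk] jk.
      by rewrite eqxx /= [k == j]eq_sym (negPf jk) [k == m]eq_sym (negPf mk) mulr1 scaleN1r.
    by rewrite eqxx (negPf jk) [j == m]eq_sym (negPf mj) mul1r scaleN1r.
(* When [{j, k}] exhausts the inner indices of its sign, the other axis of the half turn is taken to
   be 0 or [d.+1]. A single such half turn would reverse [F_{0,d+1}]; the two performed together, in
   the planes [(0, 1)] and [(d, d.+1)], preserve it. *)
have typeB : (0 < q)%N -> (j \in [:: 1; d]) != (k \in [:: 1; d]) ->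
    lam (expm (t *: Fmx j k)) = 1.
  move=> q0 jk1d; pose Z := pi *: Fmx 0 1 + pi *: Fmx d d.+1.
  have Zso : Z \in so_alg R p q by rewrite memvD// memvZ.
  have Zv v : expm Z *m ev v = (if v \in [:: 0; 1; d; d.+1] then -1 else 1) *: ev v.
    rewrite expmD; last first.
      by rewrite -!scalemxAl -!scalemxAr Fmx_disjoint//; lia.
    rewrite -mulmxA expm_Fmx_pi; [|lia|lia|lia|apply/sgnP; lia].
    rewrite -scalemxAr expm_Fmx_pi; [|lia|lia|lia|apply/sgnP; lia].
    rewrite scalerA !inE; congr (_ *: _).
    by case: (eqVneq v d); case: (eqVneq v d.+1); case: (eqVneq v 0%N);
       case: (eqVneq v 1%N) => //= *; rewrite ?mulr1 ?mul1r//; lia.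
  apply: (@character_reversed _ Z) => //.
  - split; first exact: SO0_expm.
    rewrite (conj_Fmx (expm_orth Zso) (Zv _) (Zv _)) !inE !eqxx ?orbT /= mulrNN mulr1.
    by rewrite scale1r.
  - rewrite (conj_Fmx (expm_orth Zso) (Zv _) (Zv _)) (_ : _ * _ = -1) ?scaleN1r//.
    have -> : (j \in [:: 0; 1; d; d.+1]) = (j \in [:: 1; d]) by rewrite !inE; lia.
    have -> : (k \in [:: 0; 1; d; d.+1]) = (k \in [:: 1; d]) by rewrite !inE; lia.
    by move: jk1d; case: (j \in _); case: (k \in _) => //; rewrite ?mulr1 ?mul1r.
have [k2 k2P] : exists m, (0 < m <= 2)%N && (m != k) 
  by case: (eqVneq k 1%N) => k1; [exists 2|exists 1]; lia.
have [j2 j2P] : exists m, (0 < m <= 2)%N && (m != j) 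
  by case: (eqVneq j 1%N) => j1; [exists 2|exists 1]; lia.
have [jp|pj] := leqP j p; have [kp|pk] := leqP k p.
- have [p2|p3] := leqP p 2; first by apply: typeB; rewrite ?inE; lia.
  have [m mP] : exists m, [&& (0 < m <= 3)%N, m != j & m != k].
    exists (if (j != 1) && (k != 1) then 1 else if (j != 2) && (k != 2) then 2 else 3)%N.
    by case: ifP => ?; [|case: ifP => ?]; lia.
  by apply: (typeA j m); rewrite ?inE ?sgnP; lia.
- by apply: (typeA j j2); rewrite ?inE ?sgnP; lia.
- by apply: (typeA k k2); rewrite ?inE ?sgnP; lia.
- have [q2|q3] := leqP q 2; first by apply: typeB; rewrite ?inE; lia.
  have [m mP] : exists m, [&& (d.-2 <= m <= d)%N, m != j & m != k].
    exists (if (j != d) && (k != d) then d else if (j != d.-1) && (k != d.-1) then d.-1 else d.-2)%N.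
    by case: ifP => ?; [|case: ifP => ?]; lia.
  by apply: (typeA j m); rewrite ?inE ?sgnP; lia.
Qed.

End Characters.

(** * Invariant derivatives of equivariant functions *)

Lemma mx_is_derive_ext (R : realType) m n (g h : R -> 'M[R]_(m, n)) t D :
  g =1 h -> mx_is_derive h t D -> mx_is_derive g t D.
Proof. by move=> /funext ->. Qed.

Section JetLinearity.
Variables (R : realType) (m n : nat).
Local Notation mxCt := 'M[R[i]]_(m, n).
Variables (a : 'I_m * 'I_n -> R[i]) (b : 'I_m * 'I_n -> 'I_m * 'I_n -> R[i]).

Lemma jetD_lin c (V W : mxCt) : jetD a (c *: V + W) = c * jetD a V + jetD a W.
Proof.
rewrite /jetD mulr_sumr -big_split; apply: eq_bigr => e _ /=.
by rewrite !mxE mulrDl mulrA.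
Qed.

Lemma jetQ_linl c (V W Z : mxCt) :
  jetQ b (c *: V + W) Z = c * jetQ b V Z + jetQ b W Z.
Proof.
rewrite /jetQ mulr_sumr -big_split; apply: eq_bigr => e _ /=.
rewrite mulr_sumr -big_split; apply: eq_bigr => e' _ /=.
by rewrite !mxE; ring.
Qed.

Lemma jetQ_linr c (V W Z : mxCt) :
  jetQ b Z (c *: V + W) = c * jetQ b Z V + jetQ b Z W.
Proof.
rewrite /jetQ mulr_sumr -big_split; apply: eq_bigr => e _ /=.
rewrite mulr_sumr -big_split; apply: eq_bigr => e' _ /=.
by rewrite !mxE; ring.
Qed.

Lemma jetD_is_cderive1 (V : R -> 'M[R]_(m, n)) t V' :
  mx_is_derive V t V' -> is_cderive1 (fun s => jetD a (mxC (V s))) t (jetD a (mxC V')).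
Proof.
move=> dV; apply: is_cderive1_sum => e.
have dr : is_cderive1 (fun s => mxC (V s) e.1 e.2) t (mxC V' e.1 e.2).
  have -> : (fun s => mxC (V s) e.1 e.2) = (fun s => (V s e.1 e.2)%:C).
    by apply/funext => s; rewrite mxE.
  by rewrite mxE; split; [exact: dV|exact: is_derive_cst].
apply: is_cderive1_eq (is_cderive1M dr (is_cderive1_cst (a e) t)) _.
by rewrite mulr0 addr0.
Qed.

End JetLinearity.

Section EquivariantJets.
Variables (R : realType) (p q : nat).
Let d := (p + q)%N.
Local Notation n := (p + q).+2.
Local Notation mat := 'M[R]_n.
Local Notation so := (so_alg R p q).
Local Notation G := (@SO0_pq R p q).
Variables (f : mat -> R[i]) (x : mat) (a : 'I_n * 'I_n -> R[i]).
Variable b : 'I_n * 'I_n -> 'I_n * 'I_n -> R[i].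
Hypothesis Gx : G x.
Hypothesis J1 : forall (g : R -> mat) D, (forall s, G (g s)) -> g 0 = x ->
  mx_is_derive g 0 D -> is_cderive1 (fun s => f (g s)) 0 (jetD a (mxC D)).
Hypothesis J2 : forall (g : R -> R -> mat) (V : R -> mat) W V',
  (forall s t, G (g s t)) -> g 0 0 = x ->
  (forall s, mx_is_derive (g s) 0 (V s)) ->
  mx_is_derive (fun s => g s 0) 0 W -> mx_is_derive V 0 V' ->
  is_cderive1 (fun s => cderive1 (fun t => f (g s t)) 0) 0
    (jetD a (mxC V') + jetQ b (mxC W) (mxC (V 0))).
Implicit Types X Y : mat.

Definition jetN (Z : 'M[R[i]]_n) : R[i] := jetD a (Z *m mxC x).

(** The mixed derivative at 0 of [f(exp(tZ) exp(sW) x)]: [Z] is the left factor and the inner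
    derivative. The order matters, since moving an element of the Lie algebra of [H] from the second
    slot to the first costs a commutator. *)
Definition jetN2 (Z W : 'M[R[i]]_n) : R[i] :=
  jetD a (Z *m W *m mxC x) + jetQ b (W *m mxC x) (Z *m mxC x).

Lemma expm_curve0 X : mx_is_derive (fun s : R => expm (s *: X)) 0 X.
Proof.
have := mx_is_derive_expm X (0 : R); rewrite scale0r expm0.
by rewrite (mulmx1 X).
Qed.

Lemma expm_curve_mulr X (g : mat) : mx_is_derive (fun s : R => expm (s *: X) *m g) 0 (X *m g).
Proof.
have := mx_is_deriveM (expm_curve0 X) (mx_is_derive_cst g 0).
by rewrite mulmx0 addr0.
Qed.

Lemma expm_curve_mull X (g : mat) : mx_is_derive (fun s : R => g *m expm (s *: X)) 0 (g *m X).
Proof.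
have := mx_is_deriveM (mx_is_derive_cst g 0) (expm_curve0 X).
by rewrite mul0mx add0r.
Qed.

Lemma is_cderive1_lieR X : X \in so ->
  is_cderive1 (fun s => f (expm (s *: X) *m x)) 0 (jetN (mxC X)).
Proof.
move=> Xso; rewrite /jetN -mxCM; apply: J1.
- by move=> s; apply: SO0_expml; rewrite ?memvZ.
- by rewrite /= scale0r expm0 mul1mx.
- exact: expm_curve_mulr.
Qed.

Lemma lieR_jet X : X \in so -> lieR f X x = jetN (mxC X).
Proof. by move=> Xso; apply/is_cderive1_val/is_cderive1_lieR. Qed.

Lemma is_cderive1_lieR2 X Y : X \in so -> Y \in so ->
  is_cderive1 (fun s => lieR f X (expm (s *: Y) *m x)) 0 (jetN2 (mxC X) (mxC Y)).
Proof.
move=> Xso Yso; rewrite /jetN2 -!mxCM.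
have := @J2 (fun s t => expm (t *: X) *m (expm (s *: Y) *m x))
  (fun s => X *m (expm (s *: Y) *m x)) (Y *m x) (X *m Y *m x).
rewrite !scale0r !expm0 !mul1mx; apply => //.
- by move=> s t; do 2![apply: SO0_expml; rewrite ?memvZ//].
- by move=> s; exact: expm_curve_mulr.
- by apply: (mx_is_derive_ext _ (expm_curve_mulr Y x)) => s; rewrite mul1mx.
- have := mx_is_deriveM (mx_is_derive_cst X 0) (expm_curve_mulr Y x).
  by rewrite mul0mx add0r mulmxA.
Qed.

Lemma lieR2_jet X Y : X \in so -> Y \in so ->
  lieR (lieR f X) Y x = jetN2 (mxC X) (mxC Y).
Proof. by move=> Xso Yso; apply/is_cderive1_val/is_cderive1_lieR2. Qed.

Lemma lieL2_jet X Y : X \in so -> Y \in so ->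
  lieL X (lieL Y f) x =
    jetD a (mxC (x *m X *m Y)) + jetQ b (mxC (x *m X)) (mxC (x *m Y)).
Proof.
move=> Xso Yso; apply/is_cderive1_val.
have := @J2 (fun s t => x *m expm (s *: X) *m expm (t *: Y))
  (fun s => x *m expm (s *: X) *m Y) (x *m X) (x *m X *m Y).
rewrite !scale0r !expm0 !mulmx1; apply => //.
- by move=> s t; do 2![apply: SO0_expmr; rewrite ?memvZ//].
- by move=> s; exact: expm_curve_mull.
- by apply: (mx_is_derive_ext _ (expm_curve_mull X x)) => s; rewrite mulmx1.
- have := mx_is_deriveM (expm_curve_mull X x) (mx_is_derive_cst Y 0).
  by rewrite mulmx0 addr0.
Qed.

Section LeftWeight.
Variables (Y : mat) (al : R[i]) (l : R -> R[i]).
Hypotheses (Yso : Y \in so) (dl : is_cderive1 l 0 al) (l0 : l 0 = 1).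
Hypothesis fl : forall s g, G g -> f (expm (s *: Y) *m g) = l s * f g.

Lemma left_weight_lieR g : G g -> lieR f Y g = al * f g.
Proof.
move=> Gg; rewrite /lieR; under eq_fun do rewrite fl//.
apply/is_cderive1_val.
apply: is_cderive1_eq (is_cderive1M dl (is_cderive1_cst (f g) 0)) _.
by rewrite mulr0 addr0.
Qed.

Lemma left_weight_N : jetN (mxC Y) = al * f x.
Proof. by rewrite -lieR_jet// left_weight_lieR. Qed.

Lemma left_weight_N2 X : X \in so -> jetN2 (mxC Y) (mxC X) = al * jetN (mxC X).
Proof.
move=> Xso; rewrite -lieR2_jet//; apply/is_cderive1_val.
have -> : (fun s => lieR f Y (expm (s *: X) *m x)) =
    (fun s => al * f (expm (s *: X) *m x)).
  apply/funext => s; rewrite left_weight_lieR//.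
  by apply: SO0_expml; rewrite ?memvZ.
exact/is_cderive1Z/is_cderive1_lieR.
Qed.

Lemma conj_expm_so X s : X \in so -> expm (- (s *: Y)) *m X *m expm (s *: Y) \in so.
Proof.
move=> Xso; apply: conj_so => //; last exact: expmNK.
by apply: expm_orth; rewrite memvN memvZ.
Qed.

(** Here [exp(sY)] stands next to [x], to the right of [exp(tX)]. Pulling it to the far left, where
    it acts by the scalar [l s], replaces [X] by its conjugate, whose derivative in [s] is the
    commutator. *)
Lemma left_weight_N2r X : X \in so ->
  jetN2 (mxC X) (mxC Y) =
    al * jetN (mxC X) + jetN (mxC X *m mxC Y - mxC Y *m mxC X).
Proof.
move=> Xso; rewrite -lieR2_jet//; apply/is_cderive1_val.
(* Chosen so that [exp(tX) exp(sY) = exp(sY) exp(t Xs(s))]. *)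
pose Xs s := expm (- (s *: Y)) *m X *m expm (s *: Y).
have dXs : mx_is_derive Xs 0 (X *m Y - Y *m X).
  have dN : mx_is_derive (fun s : R => expm (- (s *: Y))) 0 (- Y).
    by have := expm_curve0 (- Y); under eq_fun do rewrite scalerN.
  have := mx_is_deriveM (mx_is_deriveM dN (mx_is_derive_cst X 0)) (expm_curve0 Y).
  rewrite scale0r oppr0 expm0 mulmx0 addr0 (mulmx1 (- Y *m X)) (mul1mx X).
  by rewrite mulNmx addrC.
have -> : (fun s => lieR f X (expm (s *: Y) *m x)) =
    (fun s => l s * jetN (mxC (Xs s))).
  apply/funext => s; apply/is_cderive1_val.
  have -> : (fun t => f (expm (t *: X) *m (expm (s *: Y) *m x))) =
     (fun t => l s * f (expm (t *: Xs s) *m x)).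
    apply/funext => t; rewrite -fl; last by apply: SO0_expml; rewrite ?memvZ ?conj_expm_so.
    rewrite !mulmxA; congr (f (_ *m x)); apply: expm_intertwine.
    by rewrite -scalemxAl -scalemxAr /Xs !mulmxA expmKN mul1mx.
  by apply/is_cderive1Z/is_cderive1_lieR; exact: conj_expm_so.
have dN : is_cderive1 (fun s => jetN (mxC (Xs s))) 0 (jetN (mxC (X *m Y - Y *m X))).
  have := jetD_is_cderive1 a (mx_is_deriveM dXs (mx_is_derive_cst x 0)).
  rewrite mulmx0 addr0; rewrite /jetN mxCM.
  by under eq_fun do rewrite mxCM.
have := is_cderive1M dl dN.
rewrite l0 mul1r /Xs scale0r oppr0 expm0 (mulmx1 (_ *m X)) (mul1mx X).
by rewrite -!mxCM -mxCB.
Qed.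

End LeftWeight.

Section RightWeight.
Variables (Y Y' : mat) (be : R[i]) (r : R -> R[i]).
Hypotheses (Yso : Y \in so) (dr : is_cderive1 r 0 be).
Hypothesis fr : forall s g, G g -> f (g *m expm (s *: Y)) = f g * r s.
Hypothesis YY' : Y' *m x = x *m Y.

Lemma right_weight_N : jetN (mxC Y') = be * f x.
Proof.
rewrite /jetN -mxCM YY'.
have : is_cderive1 (fun s => f (x *m expm (s *: Y))) 0 (jetD a (mxC (x *m Y))).
  apply: J1; last exact: expm_curve_mull.
    by move=> s; apply: SO0_expmr; rewrite ?memvZ.
  by rewrite /= scale0r expm0 mulmx1.
under eq_fun do rewrite fr//.
move=> /is_cderive1_val <-; rewrite mulrC; apply/is_cderive1_val.
exact: is_cderive1Z.
Qed.

(** [Y'] is [Ad(x) Y]: to second order it is realised by [x exp(sY)], where the group element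
    already stands at the right end, so that no commutator appears. *)
Lemma right_weight_N2 X : X \in so -> jetN2 (mxC X) (mxC Y') = be * jetN (mxC X).
Proof.
move=> Xso; rewrite /jetN2 -mulmxA -!mxCM YY'.
have : is_cderive1 (fun s => cderive1 (fun t => f (expm (t *: X) *m (x *m expm (s *: Y)))) 0) 0
   (jetD a (mxC (X *m (x *m Y))) + jetQ b (mxC (x *m Y)) (mxC (X *m (x *m expm (0 *: Y))))).
  apply: (@J2 (fun s t => expm (t *: X) *m (x *m expm (s *: Y)))
     (fun s => X *m (x *m expm (s *: Y)))).
  - by move=> s t; apply: SO0_expml; rewrite ?memvZ//; apply: SO0_expmr; rewrite ?memvZ.
  - by rewrite !scale0r !expm0 mulmx1 mul1mx.
  - by move=> s; exact: expm_curve_mulr.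
  - apply: (mx_is_derive_ext _ (expm_curve_mull Y x)) => s.
    by rewrite /= scale0r expm0 mul1mx.
  - have := mx_is_deriveM (mx_is_derive_cst X 0) (expm_curve_mull Y x).
    by rewrite mul0mx add0r.
rewrite scale0r expm0 mulmx1 => /is_cderive1_val <-; apply/is_cderive1_val.
have -> : (fun s => cderive1 (fun t => f (expm (t *: X) *m (x *m expm (s *: Y)))) 0) =
    (fun s => jetN (mxC X) * r s).
  apply/funext => s; rewrite mulrC; apply/is_cderive1_val.
  have -> : (fun t => f (expm (t *: X) *m (x *m expm (s *: Y)))) =
     (fun t => r s * f (expm (t *: X) *m x)).
    apply/funext => t; rewrite mulmxA fr 1?mulrC//.
    by apply: SO0_expml; rewrite ?memvZ.
  exact/is_cderive1Z/is_cderive1_lieR.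
by rewrite mulrC; exact: is_cderive1Z.
Qed.

End RightWeight.

End EquivariantJets.

(** * Radial part of the Casimir element in an adapted frame *)

Section RankOne.
Variables (F : numFieldType) (n : nat).
Local Notation mat := 'M[F]_n.
Variables (N : mat -> F) (N2 : mat -> mat -> F).
Hypothesis Nlin : forall c A B, N (c *: A + B) = c * N A + N B.
Hypothesis N2linl : forall c A B Z, N2 (c *: A + B) Z = c * N2 A Z + N2 B Z.
Hypothesis N2linr : forall c A B Z, N2 Z (c *: A + B) = c * N2 Z A + N2 Z B.

Lemma N_0 : N 0 = 0.
Proof.
by have := Nlin (-1) 0 0; rewrite scaler0 addr0 mulN1r addNr.
Qed.

Lemma N_Z c A : N (c *: A) = c * N A.
Proof. by rewrite -[c *: A]addr0 Nlin N_0 addr0. Qed.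

Lemma N_D A B : N (A + B) = N A + N B.
Proof. by rewrite -[A]scale1r Nlin mul1r scale1r. Qed.

Lemma N2_0l Z : N2 0 Z = 0.
Proof. by have := N2linl (-1) 0 0 Z; rewrite scaler0 addr0 mulN1r addNr. Qed.

Lemma N2_0r Z : N2 Z 0 = 0.
Proof. by have := N2linr (-1) 0 0 Z; rewrite scaler0 addr0 mulN1r addNr. Qed.

Lemma N2_Zl c A Z : N2 (c *: A) Z = c * N2 A Z.
Proof. by rewrite -[c *: A]addr0 N2linl N2_0l addr0. Qed.

Lemma N2_Zr c A Z : N2 Z (c *: A) = c * N2 Z A.
Proof. by rewrite -[c *: A]addr0 N2linr N2_0r addr0. Qed.

Lemma N2_Dl A B Z : N2 (A + B) Z = N2 A Z + N2 B Z.
Proof. by rewrite -[A]scale1r N2linl mul1r scale1r. Qed.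

Lemma N2_Dr A B Z : N2 Z (A + B) = N2 Z A + N2 Z B.
Proof. by rewrite -[A]scale1r N2linr mul1r scale1r. Qed.

Lemma N_sum (I : Type) (r : seq I) (c : I -> F) (A : I -> mat) :
  N (\sum_(k <- r) c k *: A k) = \sum_(k <- r) c k * N (A k).
Proof.
rewrite (big_morph N N_D N_0); apply: eq_bigr => k _; exact: N_Z.
Qed.

Lemma N2_sum (I : Type) (r : seq I) (c : I -> F) (A : I -> mat) :
  N2 (\sum_(k <- r) c k *: A k) (\sum_(k <- r) c k *: A k) =
  \sum_(l <- r) c l * \sum_(k <- r) c k * N2 (A k) (A l).
Proof.
rewrite (big_morph (N2 _) (fun A B => N2_Dr A B _) (N2_0r _)).
apply: eq_bigr => l _; rewrite N2_Zr; congr (_ * _).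
rewrite (big_morph (N2^~ (A l)) (fun A B => N2_Dl A B _) (N2_0l _)).
by apply: eq_bigr => k _; rewrite N2_Zl.
Qed.

(* [Y] acts by the scalar [a] from the left and [Y'] by [b] from the right; the
   identity expresses [D^2] through [Y] and [Y'] and moves [Y] to the left. *)
Lemma rank_one_radial (f a b c s : F) (Y Y' D : mat) :
  s != 0 -> Y' = c *: Y + s *: D ->
  N Y = a * f -> N Y' = b * f ->
  N2 Y Y = a * N Y -> N2 Y Y' = a * N Y' ->
  N2 Y' Y = a * N Y' + N (Y' *m Y - Y *m Y') -> N2 Y' Y' = b * N Y' ->
  N2 D D = (b ^+ 2 - 2 * c * a * b + c ^+ 2 * a ^+ 2) / s ^+ 2 * f
           - c / s * N (D *m Y - Y *m D).
Proof.
move=> s0 YE NY NY' N2YY N2YY' N2Y'Y N2Y'Y'.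
have DE : D = s^-1 *: Y' + (- (c / s)) *: Y.
  rewrite YE scalerDr !scalerA mulVf// scale1r addrAC -scalerDl.
  by rewrite (_ : s^-1 * c + - (c / s) = 0) ?scale0r ?add0r//; field.
have cE : Y' *m Y - Y *m Y' = s *: (D *m Y - Y *m D).
  rewrite YE mulmxDl mulmxDr -!scalemxAl -!scalemxAr opprD addrACA subrr add0r.
  by rewrite scalerBr.
rewrite {1 2}DE !N2_Dl !N2_Dr !N2_Zl !N2_Zr N2YY N2YY' N2Y'Y N2Y'Y' cE N_Z NY NY'.
by field.
Qed.

End RankOne.

Section AdaptedFrame.
Variables (F : numFieldType) (n : nat) (E : 'M[F]_n).
Hypothesis E_sym : E^T = E.
Local Notation mat := 'M[F]_n.
Local Notation vec := 'cV[F]_n.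
Local Notation biv := (bivec E).
Local Notation dot := (dotp E).
Variables (N : mat -> F) (N2 : mat -> mat -> F).
Hypothesis Nlin : forall c A B, N (c *: A + B) = c * N A + N B.
Hypothesis N2linl : forall c A B Z, N2 (c *: A + B) Z = c * N2 A Z + N2 B Z.
Hypothesis N2linr : forall c A B Z, N2 Z (c *: A + B) = c * N2 Z A + N2 Z B.

(* The instances of [*:] below are those of [F], which rewriting with [Nlin] needs. *)
Let bZl c (u w : vec) : biv (c *: u) w = c *: biv u w := bivecZl E c u w.
Let bZr c (u w : vec) : biv w (c *: u) = c *: biv w u := bivecZr E c u w.
Let bDl (u v w : vec) : biv (u + v) w = biv u w + biv v w := bivecDl E u v w.
Let bDr (u v w : vec) : biv w (u + v) = biv w u + biv w v := bivecDr E u v w.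
Let bC (u v : vec) : biv v u = (-1) *: biv u v.
Proof. by rewrite scaleN1r bivecC. Qed.
Let b0l (w : vec) : biv 0 w = 0 := bivec0l E w.
Let b0r (w : vec) : biv w 0 = 0.
Proof. by rewrite bC b0l scaler0. Qed.
Let mul_biv (u v w : vec) : biv u v *m w = dot v w *: u + (- dot u w) *: v.
Proof. by rewrite mul_bivec scaleNr. Qed.
Let negZ a (A : mat) : - (a *: A) = (- a) *: A.
Proof. by rewrite scaleNr. Qed.
Let NZ := N_Z Nlin.
Let ND := N_D Nlin.
Let NDZ A a B : N (A + a *: B) = N A + a * N B.
Proof. by rewrite ND NZ. Qed.
Let N2Zl := N2_Zl N2linl.
Let N2Zr := N2_Zr N2linr.
Let N2Dl := N2_Dl N2linl.
Let N2Dr := N2_Dr N2linr.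
Let NN A : N (- A) = - N A.
Proof. by rewrite -[RHS]mulN1r -NZ scaleN1r. Qed.
Let N2Nl A B : N2 (- A) B = - N2 A B.
Proof. by rewrite -[RHS]mulN1r -N2Zl scaleN1r. Qed.
Let N2Nr A B : N2 B (- A) = - N2 B A.
Proof. by rewrite -[RHS]mulN1r -N2Zr scaleN1r. Qed.

Let left_actD c (A B Y : mat) : N2 Y A = c * N A -> N2 Y B = c * N B ->
  N2 Y (A + B) = c * N (A + B) /\ N2 Y (A - B) = c * N (A - B).
Proof. by move=> hA hB; rewrite !N2Dr !ND NN N2Nr hA hB -mulrBr -mulrDr. Qed.

Let right_actD c (A B Y : mat) : N2 A Y = c * N A -> N2 B Y = c * N B ->
  N2 (A + B) Y = c * N (A + B) /\ N2 (A - B) Y = c * N (A - B).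
Proof. by move=> hA hB; rewrite !N2Dl !ND NN N2Nl hA hB -mulrBr -mulrDr. Qed.

Let comm_actD c (A B Y : mat) :
  N2 A Y = c * N A + N (A *m Y - Y *m A) -> N2 B Y = c * N B + N (B *m Y - Y *m B) ->
  N2 (A + B) Y = c * N (A + B) + N ((A + B) *m Y - Y *m (A + B)) /\
  N2 (A - B) Y = c * N (A - B) + N ((A - B) *m Y - Y *m (A - B)).
Proof.
have commD C : (A + C) *m Y - Y *m (A + C) = (A *m Y - Y *m A) + (C *m Y - Y *m C).
  by rewrite mulmxDl mulmxDr opprD addrACA.
move=> hA hB; rewrite !N2Dl !commD !(ND A) mulNmx mulmxN -opprD NN N2Nl hA hB.
rewrite !(ND (A *m Y - Y *m A)) NN.
by split; ring.
Qed.

Lemma biv_comm (u v w z : vec) : biv u v *m biv w z - biv w z *m biv u v =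
  biv (biv u v *m w) z + biv w (biv u v *m z).
Proof. exact/bivec_comm/bivec_antisym. Qed.

(** The situation at a point, stripped of jets and charts: [P] stands for the span of [e_1, .., e_d]
    and [P'] for its image under [x]; [e0], [e1] are [e_0], [e_{d+1}], and [xe0], [xe1] their images
    under [x]. The pairs in [mid] are the remaining basis vectors with their squares; they belong to
    both [P] and [P']. *)
Variables (f al be zeta : F) (vp vm wp wm e0 e1 xe0 xe1 : vec).
Variables (mid : seq (F * vec)).
Variables (chp shp chm shm : F) (P P' : vec -> Prop).
Hypotheses (hyp : chp ^+ 2 - shp ^+ 2 = 1) (hym : chm ^+ 2 - shm ^+ 2 = 1).
Hypotheses (shp0 : shp != 0) (shm0 : shm != 0).
Let c1 := chp * chm + shp * shm.
Let s1 := chp * shm + shp * chm.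
Let c2 := chp * chm - shp * shm.
Let s2 := shp * chm - chp * shm.
Hypotheses (s10 : s1 != 0) (s20 : s2 != 0).
Hypotheses (dvp : dot vp vp = 1) (dvm : dot vm vm = 1).
Hypotheses (dwp : dot wp wp = -1) (dwm : dot wm wm = -1).
Hypotheses (dvv : dot vp vm = 0) (dww : dot wp wm = 0).
Hypotheses (dpp : dot vp wp = 0) (dpm : dot vp wm = 0).
Hypotheses (dmp : dot vm wp = 0) (dmm : dot vm wm = 0).
Hypothesis dmid : forall e, e \in mid -> [/\ dot e.2 e.2 = e.1, e.1 * e.1 = 1 &
  [/\ dot vp e.2 = 0, dot vm e.2 = 0, dot wp e.2 = 0 & dot wm e.2 = 0]].
Let vp' := chp *: vp + shp *: wp.
Let vm' := chm *: vm + shm *: wm.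
Let wp' := chp *: wp + shp *: vp.
Let wm' := chm *: wm + shm *: vm.
Hypotheses (Pvp : P vp) (Pvm : P vm) (Pmid : forall e, e \in mid -> P e.2).
Hypotheses (Pvp' : P' vp') (Pvm' : P' vm') (Pmid' : forall e, e \in mid -> P' e.2).
Hypothesis PN : forall u v, P u -> P v -> N (biv u v) = 0.
Hypothesis PN2 : forall u v w z, P u -> P v -> N2 (biv u v) (biv w z) = 0.
Hypothesis PN2r : forall u v w z, P u -> P v ->
  N2 (biv w z) (biv u v) = N (biv w z *m biv u v - biv u v *m biv w z).
Hypothesis PN' : forall u v, P' u -> P' v -> N (biv u v) = 0.
Hypothesis PN2' : forall u v w z, P' u -> P' v -> N2 (biv w z) (biv u v) = 0.
Hypothesis zeta2 : zeta ^+ 2 = -1.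
Hypothesis wE : biv wp wm = zeta *: biv e0 e1.
Hypothesis wE' : biv wp' wm' = - zeta *: biv xe0 xe1.
Hypothesis aN : N (biv e0 e1) = al * f.
Hypothesis aN2 : forall w z, N2 (biv e0 e1) (biv w z) = al * N (biv w z).
Hypothesis aN2r : forall w z, N2 (biv w z) (biv e0 e1) =
  al * N (biv w z) + N (biv w z *m biv e0 e1 - biv e0 e1 *m biv w z).
Hypothesis bN : N (biv xe0 xe1) = be * f.
Hypothesis bN2 : forall w z, N2 (biv w z) (biv xe0 xe1) = be * N (biv w z).

Let Tp := biv wp vp.
Let Tm := biv wm vm.
Let T1 := 2^-1 *: (Tp + Tm).
Let T2 := 2^-1 *: (Tp - Tm).

Definition frame : seq (F * vec) := [:: (1, vp); (1, vm); (-1, wp); (-1, wm)] ++ mid.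

(** For orthogonal [u], [v] of squares [e], [e'] equal to 1 or -1, the trace form takes the value
    [-2 e e'] on [u /\ v] with itself, so the Casimir element is [-1/2] times the sum of
    [e e' (u /\ v)^2] over unordered pairs. Summing over ordered pairs halves the constant. *)
Definition frame_casimir : F :=
  - 4^-1 * \sum_(a <- frame) \sum_(b <- frame)
    a.1 * b.1 * N2 (biv a.2 b.2) (biv a.2 b.2).

Let S u v := N2 (biv u v) (biv u v).

Lemma frame_SC u v : S u v = S v u.
Proof. by rewrite /S bC N2Zl N2Zr mulrA mulrNN !mulr1 mul1r. Qed.

Lemma frame_S0 u : S u u = 0.
Proof. by rewrite /S bivecvv (N2_0l N2linl). Qed.

(** The boosted bivector [(ch v + sh w) /\ e] and [v /\ e] both have weight 0, so no potential
    arises; [w /\ e] is a combination of them, and its commutator with [v /\ e] is a multiple of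
    [w /\ v]. *)
Lemma mid_radial v w ch sh e : sh != 0 -> P v -> P' (ch *: v + sh *: w) ->
  dot v w = 0 -> dot v e.2 = 0 -> dot w e.2 = 0 -> e \in mid ->
  S w e.2 = ch / sh * (e.1 * N (biv w v)).
Proof.
move=> sh0 Pv Pv' dvw dve dwe em; have [dee ee _] := dmid em.
have Pe := Pmid em; have Pe' := Pmid' em.
rewrite /S (@rank_one_radial _ _ N N2 Nlin N2linl N2linr f 0 0 ch sh
  (biv v e.2) (biv (ch *: v + sh *: w) e.2) (biv w e.2)) //.
- rewrite biv_comm !mul_biv (dotpC E_sym e.2 v) dve dwe dee (dotpC E_sym w v) dvw.
  rewrite !oppr0 !scale0r !addr0 b0l add0r bZr NZ bC NZ.
  by field.
- by rewrite bDl !bZl.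
- by rewrite PN// mul0r.
- by rewrite PN'// mul0r.
- by rewrite PN2// mul0r.
- by rewrite PN2// mul0r.
- by rewrite PN2r// mul0r add0r.
- by rewrite PN2'// mul0r.
Qed.

(** The boosts in the planes [(v+, w+)] and [(v-, w-)] preserve the planes [(Y1, D1)] and
    [(Y2, D2)]. They act there as hyperbolic rotations by the sum and by minus the difference of the
    two angles, that is by [chi_1] and [- chi_2]; hence [c1], [s1], [c2], [s2]. The [Y] have weights
    on the left and the [Y'] on the side of [x]. *)
Let Y1 := biv vp vm + biv wp wm.
Let Y2 := biv vp vm - biv wp wm.
Let D1 := biv vp wm + biv wp vm.
Let D2 := biv vp wm - biv wp vm.
Let Y1' := biv vp' vm' + biv wp' wm'.
Let Y2' := biv vp' vm' - biv wp' wm'.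

Let biv_comb a b c e (u v w z : vec) :
  biv (a *: u + b *: v) (c *: w + e *: z) = (a * c) *: biv u w + (a * e) *: biv u z +
    ((b * c) *: biv v w + (b * e) *: biv v z).
Proof. by rewrite bDl !bDr !bZl !bZr !scalerA. Qed.

Let Y1'E : Y1' = c1 *: Y1 + s1 *: D1.
Proof.
rewrite /Y1' /Y1 /D1 /vp' /vm' /wp' /wm' !biv_comb /c1 /s1.
move: (biv vp vm) (biv wp wm) (biv vp wm) (biv wp vm) => A B C D.
by apply/matrixP => i j; rewrite !mxE; ring.
Qed.

Let Y2'E : Y2' = c2 *: Y2 + (- s2) *: D2.
Proof.
rewrite /Y2' /Y2 /D2 /vp' /vm' /wp' /wm' !biv_comb /c2 /s2.
move: (biv vp vm) (biv wp wm) (biv vp wm) (biv wp vm) => A B C D.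
by apply/matrixP => i j; rewrite !mxE; ring.
Qed.

Let dots := (dvp, dvm, dwp, dwm, dvv, dww, dpp, dpm, dmp, dmm,
  etrans (dotpC E_sym vm vp) dvv, etrans (dotpC E_sym wm wp) dww,
  etrans (dotpC E_sym wp vp) dpp, etrans (dotpC E_sym wm vp) dpm,
  etrans (dotpC E_sym wp vm) dmp, etrans (dotpC E_sym wm vm) dmm).

Let mulmx_commD (A B C D : mat) a : (A + a *: B) *m (C + a *: D) - (C + a *: D) *m (A + a *: B) =
    (A *m C - C *m A) + a *: (A *m D - D *m A) + a *: (B *m C - C *m B) +
    (a * a) *: (B *m D - D *m B).
Proof.
rewrite !mulmxDl !mulmxDr -!scalemxAl -!scalemxAr.
move: (A *m C) (C *m A) (A *m D) (D *m A) (B *m C) (C *m B) (B *m D) (D *m B).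
by move=> *; apply/matrixP => i j; rewrite !mxE; ring.
Qed.

(** The sign [a] treats both pairs at once. The result is a multiple of [T1] or [T2], which is how
    the hyperbolic cotangents of [chi_1] and [chi_2] come to multiply the derivatives in those very
    coordinates. *)
Let comm_DY a : (a = 1) \/ (a = -1) ->
  (biv vp wm + a *: biv wp vm) *m (biv vp vm + a *: biv wp wm) -
  (biv vp vm + a *: biv wp wm) *m (biv vp wm + a *: biv wp vm) = - (2 * a) *: (Tp + a *: Tm).
Proof.
move=> a1.
rewrite mulmx_commD !biv_comm !mul_biv !dots.
rewrite !oppr0 !opprK !scale0r ?addr0 ?add0r !scale1r !b0l !b0r bZl bZr.
rewrite (bC wp vp) (bC wm vm) /Tp /Tm; move: (biv wp vp) (biv wm vm) => A B.
by apply/matrixP => i j; rewrite !mxE; case: a1 => ->; ring.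
Qed.

Let S_D1D2 : S vp wm + S vm wp = 2^-1 * (N2 D1 D1 + N2 D2 D2).
Proof.
rewrite (frame_SC vm wp) /S /D1 /D2 -[in N2 (_ - _) _]scaleN1r.
by rewrite !N2Dl !N2Dr !N2Zl !N2Zr; field.
Qed.

Let N2Y1 w z : N2 Y1 (biv w z) = (zeta * al) * N (biv w z).
Proof. by rewrite /Y1 N2Dl PN2// wE N2Zl aN2; ring. Qed.

Let N2Y2 w z : N2 Y2 (biv w z) = - zeta * al * N (biv w z).
Proof. by rewrite /Y2 -scaleN1r N2Dl PN2// wE !N2Zl aN2; ring. Qed.

Let commDZ (A B C : mat) a : A *m (B + a *: C) - (B + a *: C) *m A =
  (A *m B - B *m A) + a *: (A *m C - C *m A).
Proof.
rewrite mulmxDl mulmxDr -scalemxAl -scalemxAr.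
move: (A *m B) (B *m A) (A *m C) (C *m A) => *.
by apply/matrixP => i j; rewrite !mxE; ring.
Qed.

Let N2rY1 w z : N2 (biv w z) Y1 =
  zeta * al * N (biv w z) + N (biv w z *m Y1 - Y1 *m biv w z).
Proof. by rewrite /Y1 wE commDZ NDZ N2Dr PN2r// N2Zr aN2r; ring. Qed.

Let N2rY2 w z : N2 (biv w z) Y2 =
  - zeta * al * N (biv w z) + N (biv w z *m Y2 - Y2 *m biv w z).
Proof.
by rewrite /Y2 wE negZ commDZ NDZ N2Dr PN2r// N2Zr aN2r; ring.
Qed.

Let N2Y1' w z : N2 (biv w z) Y1' = - zeta * be * N (biv w z).
Proof. by rewrite /Y1' N2Dr PN2'// wE' N2Zr bN2; ring. Qed.

Let N2Y2' w z : N2 (biv w z) Y2' = zeta * be * N (biv w z).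
Proof. by rewrite /Y2' wE' negZ N2Dr PN2'// N2Zr bN2; ring. Qed.

Let NY1 : N Y1 = zeta * al * f.
Proof. by rewrite /Y1 wE NDZ PN// aN; ring. Qed.

Let NY2 : N Y2 = - zeta * al * f.
Proof. by rewrite /Y2 wE negZ NDZ PN// aN; ring. Qed.

Let NY1' : N Y1' = - zeta * be * f.
Proof. by rewrite /Y1' wE' NDZ PN'// bN; ring. Qed.

Let NY2' : N Y2' = zeta * be * f.
Proof. by rewrite /Y2' wE' negZ NDZ PN'// bN; ring. Qed.

Let M u := \sum_(e <- mid) e.1 * S u e.2.

Let MP u : P u -> M u = 0.
Proof.
move=> Pu; rewrite /M big_seq big1// => e /Pmid Pe.
by rewrite /S PN2// mulr0.
Qed.

Let M_radial v w ch sh : sh != 0 -> P v -> P' (ch *: v + sh *: w) ->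
  dot v w = 0 -> (forall e, e \in mid -> dot v e.2 = 0) ->
  (forall e, e \in mid -> dot w e.2 = 0) ->
  M w = (size mid)%:R * (ch / sh * N (biv w v)).
Proof.
move=> sh0 Pv Pv' vw vmid wmid.
rewrite /M big_seq (eq_bigr (fun=> ch / sh * N (biv w v))) => [|e em].
  by rewrite -big_seq big_const_seq count_predT iter_addr_0 mulr_natl.
have [_ ee _] := dmid em.
rewrite (mid_radial sh0 Pv Pv' vw (vmid _ em) (wmid _ em) em).
(* The sign of [e] occurs once in the Casimir element and once in the commutator; the signature
   therefore drops out and only the number of vectors remains. *)
by transitivity (e.1 * e.1 * (ch / sh * N (biv w v))); [ring|rewrite ee mul1r].
Qed.

Let frame_casimirE : frame_casimir = - 2^-1 * (S vp vm + S wp wm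
  - (S vp wp + S vm wm) - (S vp wm + S vm wp) - M wp - M wm).
Proof.
have row u c : \sum_(b <- frame) c * b.1 * N2 (biv u b.2) (biv u b.2) =
    c * (S u vp + S u vm - S u wp - S u wm + M u).
  rewrite /frame /= !big_cons /=.
  have -> : \sum_(b <- mid) c * b.1 * N2 (biv u b.2) (biv u b.2) = c * M u.
    by rewrite /M mulr_sumr; apply: eq_bigr => e _; rewrite mulrA.
  by rewrite /S; ring.
have Mmid : \sum_(e <- mid) e.1 * (S e.2 vp + S e.2 vm - S e.2 wp - S e.2 wm + M e.2) =
    - M wp - M wm.
  rewrite -!sumrN -big_split /= [LHS]big_seq [RHS]big_seq; apply: eq_bigr => e em.
  rewrite MP; last exact: Pmid.
  rewrite !(frame_SC e.2) {1 2}/S PN2//; last exact: Pmid.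
  by rewrite PN2//; [ring|exact: Pmid].
rewrite /frame_casimir; under eq_bigr do rewrite row.
rewrite /frame /= !big_cons /= Mmid (MP Pvp) (MP Pvm) !frame_S0 (frame_SC vm vp) (frame_SC wp vp).
rewrite (frame_SC wm vp) (frame_SC wp vm) (frame_SC wm vm) (frame_SC wm wp).
by field.
Qed.

(** By type of bivector: [w+ /\ v+] and [w- /\ v-] give the second-order part by the parallelogram
    identity, pairs with [mid] give the cotangents of the half angles, [D1] and [D2] give the
    cotangents of [chi_1], [chi_2] and the potential, and [w+ /\ w-] gives a constant that
    cancels. *)
Lemma frame_radial : frame_casimir =
  N2 T1 T1 + N2 T2 T2
  + (size mid)%:R / 2 * (chp / shp * N Tp + chm / shm * N Tm)
  + c1 / s1 * N T1 + c2 / s2 * N T2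
  - 4^-1 * ((al ^+ 2 + be ^+ 2 + 2 * c1 * al * be) / s1 ^+ 2 +
            (al ^+ 2 + be ^+ 2 + 2 * c2 * al * be) / s2 ^+ 2) * f.
Proof.
have dP e : e \in mid -> dot vp e.2 = 0 by move=> /dmid[_ _ []].
have dM e : e \in mid -> dot vm e.2 = 0 by move=> /dmid[_ _ []].
have dPw e : e \in mid -> dot wp e.2 = 0 by move=> /dmid[_ _ []].
have dMw e : e \in mid -> dot wm e.2 = 0 by move=> /dmid[_ _ []].
rewrite frame_casimirE (M_radial shp0 Pvp Pvp' dpp dP dPw).
rewrite (M_radial shm0 Pvm Pvm' dmm dM dMw) S_D1D2.
have -> : S vp vm = 0 by rewrite /S PN2.
have -> : S wp wm = - al ^+ 2 * f.
  rewrite /S {1}wE N2Zl aN2 wE NZ aN; have := zeta2; rewrite expr2 => z2.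
  transitivity (zeta * zeta * al ^+ 2 * f); first by ring.
  by rewrite z2; ring.
have -> : S vp wp + S vm wm = 2 * (N2 T1 T1 + N2 T2 T2).
  rewrite (frame_SC vp) (frame_SC vm) /S -/Tp -/Tm /T1 /T2 -[in Tp - Tm]scaleN1r.
  by rewrite !N2Zl !N2Zr !N2Dl !N2Dr !N2Zl !N2Zr; field.
have s2N : - s2 != 0 by rewrite oppr_eq0.
(* The weights are [zeta * al] on the left and [- zeta * be] on the side of [x]; the opposite signs
   make the cross term in [al * be] agree in sign with the squares. *)
have K1 : N2 D1 D1 = (be ^+ 2 + 2 * c1 * al * be + c1 ^+ 2 * al ^+ 2) * zeta ^+ 2 / s1 ^+ 2 * f
    + 4 * (c1 / s1 * N T1).
  rewrite (@rank_one_radial _ _ N N2 Nlin N2linl N2linr f (zeta * al) (- zeta * be) c1 s1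
    Y1 Y1' D1 s10 Y1'E NY1 NY1').
  - have := comm_DY (or_introl erefl).
    by rewrite !scale1r => ->; rewrite NZ /T1 NZ; field.
  - by have [] := left_actD (N2Y1 vp vm) (N2Y1 wp wm).
  - by have [] := left_actD (N2Y1 vp' vm') (N2Y1 wp' wm').
  - by have [] := comm_actD (N2rY1 vp' vm') (N2rY1 wp' wm').
  - by have [] := right_actD (N2Y1' vp' vm') (N2Y1' wp' wm').
have K2 : N2 D2 D2 = (be ^+ 2 + 2 * c2 * al * be + c2 ^+ 2 * al ^+ 2) * zeta ^+ 2 / s2 ^+ 2 * f
    + 4 * (c2 / s2 * N T2).
  rewrite (@rank_one_radial _ _ N N2 Nlin N2linl N2linr f (- zeta * al) (zeta * be) c2 (- s2)
    Y2 Y2' D2 s2N Y2'E NY2 NY2').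
  - have := comm_DY (or_intror erefl).
    by rewrite !scaleN1r => ->; rewrite NZ /T2 NZ; field.
  - by have [] := left_actD (N2Y2 vp vm) (N2Y2 wp wm).
  - by have [] := left_actD (N2Y2 vp' vm') (N2Y2 wp' wm').
  - by have [] := comm_actD (N2rY2 vp' vm') (N2rY2 wp' wm').
  - by have [] := right_actD (N2Y2' vp' vm') (N2Y2' wp' wm').
rewrite K1 K2 zeta2.
(* Splitting [c ^+ 2] as [1 + s ^+ 2] isolates a term [al ^+ 2 * f] without denominator; the two
   such terms cancel the contribution of [w+ /\ w-]. What is left is symmetric in [al] and [be]. *)
have c1E : c1 ^+ 2 = 1 + s1 ^+ 2.
  have : c1 ^+ 2 - s1 ^+ 2 = (chp ^+ 2 - shp ^+ 2) * (chm ^+ 2 - shm ^+ 2).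
    by rewrite /c1 /s1; ring.
  by rewrite hyp hym mulr1 => /eqP; rewrite subr_eq => /eqP.
have c2E : c2 ^+ 2 = 1 + s2 ^+ 2.
  have : c2 ^+ 2 - s2 ^+ 2 = (chp ^+ 2 - shp ^+ 2) * (chm ^+ 2 - shm ^+ 2).
    by rewrite /c2 /s2; ring.
  by rewrite hyp hym mulr1 => /eqP; rewrite subr_eq => /eqP.
rewrite c1E c2E; move: (N2 T1 T1) (N2 T2 T2) (N T1) (N T2) (N Tp) (N Tm) => a1 a2 a3 a4 a5 a6.
by field; rewrite s10 s20 shp0 shm0.
Qed.

End AdaptedFrame.

(** * The Casimir element in a frame, and complexified equivariance *)

Section BivecExtension.
Variables (K : comPzRingType) (n : nat) (E : 'M[K]_n).
Local Notation mat := 'M[K]_n.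

(** The predicate [S] selects a coordinate subspace, so that relations valid only for
    [span(e_1, .., e_d)] can be extended too. *)
Lemma bivec_ext (L : mat -> K) (Z : mat) (S : pred 'I_n) :
  (forall c A B, L (c *: A + B) = c * L A + L B) ->
  (forall i j, S i -> S j -> L (bivec E (Z *m delta_mx i 0) (Z *m delta_mx j 0)) = 0) ->
  forall u v : 'cV[K]_n, (forall i, ~~ S i -> u i 0 = 0) ->
    (forall i, ~~ S i -> v i 0 = 0) -> L (bivec E (Z *m u) (Z *m v)) = 0.
Proof.
move=> Llin L0 u v uS vS.
have L00 : L 0 = 0.
  by have := Llin (-1) 0 0; rewrite scaler0 addr0 mulN1r addNr.
rewrite bivec_sum_deltas.
apply: (big_ind (fun A => L A = 0)) => [//|A B LA LB|i _].
  by rewrite -[A]scale1r Llin LA LB mulr0 addr0.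
apply: (big_ind (fun A => L A = 0)) => [//|A B LA LB|j _].
  by rewrite -[A]scale1r Llin LA LB mulr0 addr0.
rewrite -[_ *: bivec _ _ _]addr0 Llin L00 addr0.
have [Si|/uS ->] := boolP (S i); last by rewrite !mul0r.
have [Sj|/vS ->] := boolP (S j); last by rewrite mulr0 mul0r.
by rewrite L0// mulr0.
Qed.

End BivecExtension.

Section CasimirFrame.
Variables (R : realType) (p q : nat).
Let d := (p + q)%N.
Local Notation n := (p + q).+2.
Local Notation mat := 'M[R]_n.
Local Notation so := (so_alg R p q).
Local Notation C := R[i].
Local Notation eta := (etaK R p n).
Local Notation etaC := (etaK C p n).
Local Notation biv := (bivec etaC).

Lemma mxC_eta : mxC eta = etaC.
Proof.
apply/matrixP => i j; rewrite !mxE /sgn_eta rmorphM/= rmorph_nat.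
by case: ifP => _; rewrite ?rmorph1 ?rmorphN1.
Qed.

Lemma mxC_bivec (u v : 'cV[R]_n) : mxC (bivec eta u v) = biv (mxC u) (mxC v).
Proof. by rewrite /bivec mxCM mxCB !mxCM !mxC_tr mxC_eta. Qed.

Lemma mxC_delta m k (i : 'I_m) (j : 'I_k) : mxC (delta_mx i j) = delta_mx i j :> 'M[C]_(m, k).
Proof. by apply/matrixP => a b; rewrite !mxE rmorph_nat. Qed.

Lemma biv_delta i j :
  biv (delta_mx i 0) (delta_mx j 0) = mxC (bivec eta (delta_mx i 0) (delta_mx j 0)).
Proof. by rewrite mxC_bivec !mxC_delta. Qed.

Variables (m : nat) (X X' : m.-tuple mat).
Hypothesis XX' : B_dual_bases X X'.

Lemma dual_bases_complete (Z : mat) : Z \in so ->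
  Z = \sum_(i < m) \tr (Z *m tnth X i) *: tnth X' i.
Proof.
move=> Zso; have [_ bX' dual] := XX'.
have /coord_span ZE : Z \in <<X'>>%VS by rewrite (span_basis bX').
rewrite {1}ZE; apply: eq_bigr => i _; rewrite -tnth_nth; congr (_ *: _).
rewrite mxtrace_mulC [X in \tr (_ *m X)]ZE mulmx_sumr raddf_sum (bigD1 i)//= big1 => [|j ji].
  by rewrite -scalemxAr mxtraceZ -tnth_nth [X in _ * X]dual eqxx mulr1 addr0.
by rewrite -scalemxAr mxtraceZ -tnth_nth [X in _ * X]dual eq_sym (negPf ji) mulr0.
Qed.

(** Both sides are linear in the bivector, and for elementary vectors the identity is the image of
    the real one. *)
Lemma dual_bases_complete_biv (u v : 'cV[C]_n) :
  biv u v = \sum_(i < m) \tr (biv u v *m mxC (tnth X i)) *: mxC (tnth X' i).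
Proof.
apply/matrixP => r c.
pose L (W : 'M[C]_n) := (W - \sum_(i < m) \tr (W *m mxC (tnth X i)) *: mxC (tnth X' i)) r c.
suff /eqP : L (biv u v) = 0 by rewrite /L !mxE subr_eq0 => /eqP.
rewrite -[u]mul1mx -[v]mul1mx.
apply: (bivec_ext (S := xpredT)) => // [a A B|i j _ _].
  rewrite /L; have -> : \sum_(i < m) \tr ((a *: A + B) *m mxC (tnth X i)) *: mxC (tnth X' i) =
      a *: (\sum_(i < m) \tr (A *m mxC (tnth X i)) *: mxC (tnth X' i)) +
      \sum_(i < m) \tr (B *m mxC (tnth X i)) *: mxC (tnth X' i).
    rewrite scaler_sumr -big_split; apply: eq_bigr => i _ /=.
    by rewrite mulmxDl -scalemxAl mxtraceD mxtraceZ scalerDl scalerA.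
  by rewrite !mxE; ring.
rewrite !mul1mx biv_delta /L {1}(dual_bases_complete (@bivec_so R p q _ _)).
have -> : mxC (\sum_(i0 < m) \tr (bivec eta (delta_mx i 0) (delta_mx j 0) *m tnth X i0) *: tnth X' i0) =
  \sum_(i0 < m) \tr (mxC (bivec eta (delta_mx i 0) (delta_mx j 0)) *m mxC (tnth X i0)) *: mxC (tnth X' i0).
  rewrite /mxC raddf_sum; apply: eq_bigr => k _ /=.
  by rewrite map_mxZ -map_mxM trace_map_mx.
by rewrite subrr mxE.
Qed.

(** Completeness of the bivectors of a frame needs only that the frame resolves the matrix [etaC];
    its vectors may be complex, and their number and individual squares are irrelevant. *)
Lemma frame_complete (s : seq (C * 'cV[C]_n)) (Z : 'M[C]_n) :
  \sum_(a <- s) a.1 *: (a.2 *m a.2^T) = etaC -> Z^T *m etaC + etaC *m Z = 0 ->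
  Z = - 4^-1 *: \sum_(a <- s) \sum_(b <- s)
    (a.1 * b.1 * \tr (Z *m biv a.2 b.2)) *: biv a.2 b.2.
Proof.
move=> sE /eqP; rewrite addr_eq0 => /eqP ZE.
have dotN (u v : 'cV[C]_n) : dotp etaC u (Z *m v) = - dotp etaC v (Z *m u).
  rewrite /dotp.
  have -> : u^T *m etaC *m (Z *m v) = - (v^T *m etaC *m (Z *m u))^T; last by rewrite !mxE.
  rewrite !trmx_mul etaK_tr trmxK !mulmxA -[u^T *m Z^T *m etaC]mulmxA ZE.
  by rewrite mulmxN mulNmx opprK !mulmxA.
have trE (u v : 'cV[C]_n) : \tr (Z *m biv u v) = 2 * dotp etaC v (Z *m u).
  have tr1 (w z : 'cV[C]_n) : \tr (Z *m (w *m z^T *m etaC)) = dotp etaC z (Z *m w).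
    have -> : Z *m (w *m z^T *m etaC) = (Z *m w) *m (z^T *m etaC) by rewrite !mulmxA.
    by rewrite mxtrace_mulC /mxtrace big_ord1 /dotp.
  have trB (A B : 'M[C]_n) : \tr (Z *m ((A - B) *m etaC)) =
      \tr (Z *m (A *m etaC)) - \tr (Z *m (B *m etaC)).
    by rewrite mulmxBl mulmxBr; exact: linearB.
  apply: etrans (trB _ _) (etrans (congr2 (fun a b => a - b) (tr1 u v) (tr1 v u)) _).
  by rewrite [X in _ - X]dotN; ring.
(* Rewritten so that each frame vector occurs only through [u *m u^T]; both sums then collapse to
   [etaC]. *)
have rk1 (u v : 'cV[C]_n) : dotp etaC v (Z *m u) *: biv u v =
   (- (u *m u^T *m (etaC *m Z) *m (v *m v^T))
    - v *m v^T *m (etaC *m Z) *m (u *m u^T)) *m etaC.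
  have cl (w z y : 'cV[C]_n) : w *m w^T *m (etaC *m Z) *m (z *m y^T) =
      dotp etaC w (Z *m z) *: (w *m y^T).
    by rewrite scalemxAl -mulmx_rank1 !mulmxA.
  by rewrite !cl (dotN u v) scaleNr opprK -scalerBr /bivec scalemxAl.
pose A (a : C * 'cV[C]_n) := a.1 *: (a.2 *m a.2^T).
have AE a b : A a *m (etaC *m Z) *m A b =
    (a.1 * b.1) *: (a.2 *m a.2^T *m (etaC *m Z) *m (b.2 *m b.2^T)).
  by rewrite /A -[_ *: _ *m _]scalemxAl -[_ *: _ *m _]scalemxAl -scalemxAr scalerA.
have sumE (s1 s2 : seq (C * 'cV[C]_n)) : \sum_(a <- s1) \sum_(b <- s2)
    A a *m (etaC *m Z) *m A b = (\sum_(a <- s1) A a) *m (etaC *m Z) *m \sum_(b <- s2) A b.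
  by rewrite !mulmx_suml; apply: eq_bigr => a _; rewrite mulmx_sumr.
have K1 : \sum_(a <- s) \sum_(b <- s) (a.1 * b.1 * \tr (Z *m biv a.2 b.2)) *: biv a.2 b.2 =
   - 4 *: Z.
  transitivity (2 *: ((- (\sum_(a <- s) \sum_(b <- s) A a *m (etaC *m Z) *m A b)
    - \sum_(b <- s) \sum_(a <- s) A b *m (etaC *m Z) *m A a) *m etaC)).
    rewrite [X in _ - X]exchange_big -!sumrN -big_split mulmx_suml scaler_sumr.
    apply: eq_bigr => a _ /=.
    rewrite -!sumrN -big_split mulmx_suml scaler_sumr; apply: eq_bigr => b _ /=.
    rewrite trE; have -> : a.1 * b.1 * (2 * dotp etaC b.2 (Z *m a.2)) =
      2 * (a.1 * b.1) * dotp etaC b.2 (Z *m a.2) by ring.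
    rewrite -scalerA rk1 -scalerA; congr (_ *: _).
    rewrite scalemxAl; congr (_ *m _).
    by rewrite !AE [b.1 * a.1]mulrC scalerBr scalerN.
  rewrite !sumE sE !mulmxA etaK_sqr mul1mx mulmxBl mulNmx -!mulmxA etaK_sqr mulmx1.
  by apply/matrixP => r c; rewrite !mxE; ring.
by rewrite K1 scalerA mulrN mulNr opprK mulVf ?scale1r// pnatr_eq0.
Qed.

(** Independence of the Casimir element from the dual bases: each [X_i] is expanded in the frame,
    after which the sum over [i] reassembles the second argument. It holds for any bilinear [b],
    hence for the left and the right jet alike. *)
Lemma casimir_frame (b : 'M[C]_n -> 'M[C]_n -> C) (s : seq (C * 'cV[C]_n)) :
  (forall c A B Z, b (c *: A + B) Z = c * b A Z + b B Z) ->
  (forall c A B Z, b Z (c *: A + B) = c * b Z A + b Z B) ->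
  \sum_(a <- s) a.1 *: (a.2 *m a.2^T) = etaC ->
  \sum_(i < m) b (mxC (tnth X i)) (mxC (tnth X' i)) =
    - 4^-1 * \sum_(u <- s) \sum_(v <- s)
      u.1 * v.1 * b (biv u.2 v.2) (biv u.2 v.2).
Proof.
move=> bl br sE.
have b0l Z : b 0 Z = 0.
  by have := bl (-1) 0 0 Z; rewrite scaler0 addr0 mulN1r addNr.
have b0r Z : b Z 0 = 0.
  by have := br (-1) 0 0 Z; rewrite scaler0 addr0 mulN1r addNr.
have bZl c A Z : b (c *: A) Z = c * b A Z by rewrite -[c *: A]addr0 bl b0l addr0.
have bZr c A Z : b Z (c *: A) = c * b Z A by rewrite -[c *: A]addr0 br b0r addr0.
have bsl I (r : seq I) (A : I -> 'M[C]_n) Z : b (\sum_(i <- r) A i) Z = \sum_(i <- r) b (A i) Z.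
  by apply: (big_morph (b^~ Z)) => [x y|//]; rewrite -[x]scale1r bl mul1r scale1r.
have bsr I (r : seq I) (A : I -> 'M[C]_n) Z : b Z (\sum_(i <- r) A i) = \sum_(i <- r) b Z (A i).
  by apply: (big_morph (b Z)) => [x y|//]; rewrite -[x]scale1r br mul1r scale1r.
have [bX _ _] := XX'.
transitivity (\sum_(i < m) - 4^-1 * \sum_(u <- s) \sum_(v <- s)
   u.1 * v.1 * \tr (mxC (tnth X i) *m biv u.2 v.2) * b (biv u.2 v.2) (mxC (tnth X' i))).
  apply: eq_bigr => i _.
  have Xso : (mxC (tnth X i))^T *m etaC + etaC *m mxC (tnth X i) = 0.
    have : tnth X i \in so by rewrite (basis_mem bX)// mem_tnth.
    rewrite so_algE => /eqP/(congr1 (@mxC _ _ _)).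
    by rewrite mxCD !mxCM mxC_tr mxC_eta /mxC map_mx0.
  rewrite {1}(frame_complete sE Xso) bZl bsl; congr (_ * _); apply: eq_bigr => u _.
  by rewrite bsl; apply: eq_bigr => v _; rewrite bZl.
rewrite -mulr_sumr exchange_big; congr (_ * _); apply: eq_bigr => u _ /=.
rewrite exchange_big; apply: eq_bigr => v _ /=.
transitivity (u.1 * v.1 * b (biv u.2 v.2)
    (\sum_(i < m) \tr (biv u.2 v.2 *m mxC (tnth X i)) *: mxC (tnth X' i))).
  2: by rewrite -dual_bases_complete_biv.
rewrite bsr mulr_sumr; apply: eq_bigr => i _.
by rewrite bZr mxtrace_mulC mulrA.
Qed.

End CasimirFrame.

(** * Equivariance as relations between complex jets *)

Section EquivariantRelations.
Variables (R : realType) (p q : nat).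
Let d := (p + q)%N.
Local Notation n := (p + q).+2.
Local Notation mat := 'M[R]_n.
Local Notation G := (@SO0_pq R p q).
Local Notation C := R[i].
Local Notation eta := (etaK R p n).
Local Notation biv := (bivec (etaK C p n)).
Local Notation evC := (ev C n).
Local Notation Fmx := (@Fmx R p q).
Hypotheses (qp : (q <= p)%N) (d2 : (2 < p + q)%N).
Variables (alpha beta : C) (lam rho : mat -> C).
Hypotheses (hlam : acts_by lam alpha) (hrho : acts_by rho beta).
Variables (f : mat -> C) (hf : in_EW lam rho f).
Variables (x : mat) (a : 'I_n * 'I_n -> C) (b : 'I_n * 'I_n -> 'I_n * 'I_n -> C).
Hypothesis Gx : G x.
Hypothesis J1 : forall (g : R -> mat) D, (forall s, G (g s)) -> g 0 = x ->
  mx_is_derive g 0 D -> is_cderive1 (fun s => f (g s)) 0 (jetD a (mxC D)).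
Hypothesis J2 : forall (g : R -> R -> mat) (V : R -> mat) W V',
  (forall s t, G (g s t)) -> g 0 0 = x ->
  (forall s, mx_is_derive (g s) 0 (V s)) ->
  mx_is_derive (fun s => g s 0) 0 W -> mx_is_derive V 0 V' ->
  is_cderive1 (fun s => cderive1 (fun t => f (g s t)) 0) 0
    (jetD a (mxC V') + jetQ b (mxC W) (mxC (V 0))).

Local Notation N := (jetN x a).
Local Notation N2 := (jetN2 x a b).
Local Notation xC := (mxC x).

Lemma jetN_lin c (A B : 'M[C]_n) : N (c *: A + B) = c * N A + N B.
Proof. by rewrite /jetN mulmxDl -scalemxAl jetD_lin. Qed.

Lemma jetN2_linl c (A B Z : 'M[C]_n) : N2 (c *: A + B) Z = c * N2 A Z + N2 B Z.
Proof.
rewrite /jetN2 !mulmxDl -!scalemxAl jetD_lin jetQ_linr.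
by rewrite mulrDr addrACA.
Qed.

Lemma jetN2_linr c (A B Z : 'M[C]_n) : N2 Z (c *: A + B) = c * N2 Z A + N2 Z B.
Proof.
rewrite /jetN2 mulmxDr mulmxDl mulmxDl -scalemxAr -!scalemxAl jetD_lin jetQ_linl.
by rewrite mulrDr addrACA.
Qed.

(* Vectors in the span of [e_1 .. e_d], on which the Levi subgroup [M] acts. *)
Definition inner_vec (u : 'cV[C]_n) : Prop :=
  forall i : 'I_n, ~~ (0 < i <= d)%N -> u i 0 = 0.

Lemma lam1 : lam 1%:M = 1. Proof. by have [[]] := hlam. Qed.
Lemma rho1 : rho 1%:M = 1. Proof. by have [[]] := hrho. Qed.

Lemma EW_left Y s g : Y \in so_alg R p q -> Y *m Fmx 0 d.+1 = Fmx 0 d.+1 *m Y ->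
  G g -> f (expm (s *: Y) *m g) = lam (expm (s *: Y)) * f g.
Proof.
move=> Yso YF Gg; have [_ fE] := hf.
have hY : @H_grp R p q (expm (s *: Y)).
  by apply: H_expm; rewrite ?memvZ// -scalemxAl -scalemxAr YF.
have := fE _ _ _ hY Gg (@H_1 R p q).
by rewrite mulmx1 rho1 mulr1.
Qed.

Lemma EW_right Y s g : Y \in so_alg R p q -> Y *m Fmx 0 d.+1 = Fmx 0 d.+1 *m Y ->
  G g -> f (g *m expm (s *: Y)) = f g * rho (expm (s *: Y)).
Proof.
move=> Yso YF Gg; have [_ fE] := hf.
have hY : @H_grp R p q (expm (s *: Y)).
  by apply: H_expm; rewrite ?memvZ// -scalemxAl -scalemxAr YF.
have := fE _ _ _ (@H_1 R p q) Gg hY.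
by rewrite mul1mx lam1 mul1r.
Qed.

Lemma evE (i : 'I_n) : ev R n i = delta_mx i 0.
Proof. by apply/matrixP => r c; rewrite !mxE !ord1 eqxx andbT. Qed.

Lemma Fmx_delta (i j : 'I_n) : Fmx i j = bivec eta (delta_mx i 0) (delta_mx j 0).
Proof. by rewrite Fmx_bivec !evE. Qed.

Let innerF (i j : 'I_n) : (0 < i <= d)%N -> (0 < j <= d)%N ->
  Fmx i j *m Fmx 0 d.+1 = Fmx 0 d.+1 *m Fmx i j.
Proof. by move=> id jd; apply: Fmx_disjoint; rewrite ?ltn_ord//; lia. Qed.

Let inner_left (i j : 'I_n) : (0 < i <= d)%N -> (0 < j <= d)%N ->
  forall s g, G g -> f (expm (s *: Fmx i j) *m g) = (fun=> 1) s * f g.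
Proof.
move=> id jd s g Gg; have [lamP _ _] := hlam.
rewrite EW_left ?Fmx_so//; last exact: innerF.
by rewrite (character_Fmx lamP qp d2).
Qed.

Let inner_right (i j : 'I_n) : (0 < i <= d)%N -> (0 < j <= d)%N ->
  forall s g, G g -> f (g *m expm (s *: Fmx i j)) = f g * (fun=> 1) s.
Proof.
move=> id jd s g Gg; have [rhoP _ _] := hrho.
rewrite EW_right ?Fmx_so//; last exact: innerF.
by rewrite (character_Fmx rhoP qp d2).
Qed.

Let d1 : is_cderive1 (fun=> 1 : C) (0 : R) 0.
Proof. exact: is_cderive1_cst. Qed.

Let dl : is_cderive1 (fun s => lam (expm (s *: Fmx 0 d.+1))) 0 alpha.
Proof. by have [] := hlam. Qed.

Let dr : is_cderive1 (fun s => rho (expm (s *: Fmx 0 d.+1))) 0 beta.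
Proof. by have [] := hrho. Qed.

Let l0 : lam (expm (0 *: Fmx 0 d.+1)) = 1.
Proof. by rewrite scale0r expm0 lam1. Qed.

Let boost_left s g : G g ->
  f (expm (s *: Fmx 0 d.+1) *m g) = lam (expm (s *: Fmx 0 d.+1)) * f g.
Proof. by move=> Gg; apply: EW_left; rewrite ?Fmx_so. Qed.

Let boost_right s g : G g ->
  f (g *m expm (s *: Fmx 0 d.+1)) = f g * rho (expm (s *: Fmx 0 d.+1)).
Proof. by move=> Gg; apply: EW_right; rewrite ?Fmx_so. Qed.

Let biv_so (u v : 'cV[R]_n) : bivec eta u v \in so_alg R p q := @bivec_so R p q u v.

Let conj_x (u v : 'cV[R]_n) : bivec eta (x *m u) (x *m v) *m x = x *m bivec eta u v.
Proof.
by rewrite bivec_conj//; have /SO0_SO[] := Gx; rewrite eta_etaK.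
Qed.

(* Bilinear identities on [so] extend from real bivectors to complex ones. *)
Let ext2 (L : 'M[C]_n -> 'M[C]_n -> C) (Z1 Z2 : mat) (S1 S2 : pred 'I_n) :
  (forall c A B Z, L (c *: A + B) Z = c * L A Z + L B Z) ->
  (forall c A B Z, L Z (c *: A + B) = c * L Z A + L Z B) ->
  (forall i j k l, S1 i -> S1 j -> S2 k -> S2 l ->
     L (mxC (bivec eta (Z1 *m delta_mx i 0) (Z1 *m delta_mx j 0)))
       (mxC (bivec eta (Z2 *m delta_mx k 0) (Z2 *m delta_mx l 0))) = 0) ->
  forall u v w z : 'cV[C]_n, (forall i, ~~ S1 i -> u i 0 = 0) ->
    (forall i, ~~ S1 i -> v i 0 = 0) -> (forall i, ~~ S2 i -> w i 0 = 0) ->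
    (forall i, ~~ S2 i -> z i 0 = 0) ->
  L (biv (mxC Z1 *m u) (mxC Z1 *m v)) (biv (mxC Z2 *m w) (mxC Z2 *m z)) = 0.
Proof.
move=> Ll Lr L0 u v w z uS vS wS zS.
apply: (@bivec_ext _ _ _ (L^~ (biv (mxC Z2 *m w) (mxC Z2 *m z))) _ S1) => // i j Si Sj.
apply: (@bivec_ext _ _ _ (L (biv (mxC Z1 *m delta_mx i 0) (mxC Z1 *m delta_mx j 0))) _ S2) => //.
move=> k l Sk Sl.
have := L0 i j k l Si Sj Sk Sl.
by rewrite !mxC_bivec !mxCM !mxC_delta.
Qed.

Let comm_linl c (A B Y : 'M[C]_n) : (c *: A + B) *m Y - Y *m (c *: A + B) =
  c *: (A *m Y - Y *m A) + (B *m Y - Y *m B).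
Proof.
by rewrite mulmxDl mulmxDr -scalemxAl -scalemxAr opprD addrACA scalerBr.
Qed.

Let comm_linr c (A B Y : 'M[C]_n) : Y *m (c *: A + B) - (c *: A + B) *m Y =
  c *: (Y *m A - A *m Y) + (Y *m B - B *m Y).
Proof.
by rewrite mulmxDl mulmxDr -scalemxAl -scalemxAr opprD addrACA scalerBr.
Qed.

Let mxC1 : mxC (1%:M : mat) = 1%:M. Proof. exact: map_mx1. Qed.

Lemma inner_N u v : inner_vec u -> inner_vec v -> N (biv u v) = 0.
Proof.
move=> uP vP; rewrite -[u]mul1mx -[v]mul1mx.
apply: (@bivec_ext _ _ _ N _ (fun i : 'I_n => 0 < i <= d)%N) => //; first exact: jetN_lin.
move=> i j Si Sj; rewrite !mul1mx biv_delta -Fmx_delta.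
by rewrite (left_weight_N Gx J1 (Fmx_so R p q _ _) d1 (inner_left Si Sj)) mul0r.
Qed.

Lemma inner_N2 u v w z : inner_vec u -> inner_vec v -> N2 (biv u v) (biv w z) = 0.
Proof.
move=> uP vP; rewrite -[u]mul1mx -[v]mul1mx -[w]mul1mx -[z]mul1mx -mxC1.
apply: (@ext2 N2 _ _ (fun i : 'I_n => 0 < i <= d)%N xpredT) => //;
  [exact: jetN2_linl|exact: jetN2_linr|].
move=> i j k l Si Sj _ _; rewrite !mul1mx -Fmx_delta.
by rewrite (left_weight_N2 Gx J1 J2 (Fmx_so R p q _ _) d1 (inner_left Si Sj)) ?mul0r// biv_so.
Qed.

Lemma inner_N2r u v w z : inner_vec u -> inner_vec v ->
  N2 (biv w z) (biv u v) = N (biv w z *m biv u v - biv u v *m biv w z).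
Proof.
move=> uP vP; apply/eqP; rewrite -subr_eq0; apply/eqP.
rewrite -[u]mul1mx -[v]mul1mx -[w]mul1mx -[z]mul1mx -mxC1.
apply: (@ext2 (fun A B => N2 A B - N (A *m B - B *m A)) _ _ xpredT
  (fun i : 'I_n => 0 < i <= d)%N) => //.
- by move=> c A B Z; rewrite jetN2_linl comm_linl jetN_lin opprD addrACA -mulrBr.
- by move=> c A B Z; rewrite jetN2_linr comm_linr jetN_lin opprD addrACA -mulrBr.
move=> i j k l _ _ Si Sj; rewrite !mul1mx -(Fmx_delta k l); lazy beta.
rewrite (left_weight_N2r Gx J1 J2 (Fmx_so R p q _ _) d1 erefl (inner_left Si Sj)) ?biv_so//.
by rewrite mul0r add0r subrr.
Qed.

(** The bivector of [x u] and [x v] is [Ad(x)(u /\ v)], so it acts at [x] like [u /\ v] from the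
    right, where [rho] is trivial. *)
Lemma inner_N' u v : inner_vec u -> inner_vec v -> N (biv (xC *m u) (xC *m v)) = 0.
Proof.
move=> uP vP.
apply: (@bivec_ext _ _ _ N _ (fun i : 'I_n => 0 < i <= d)%N) => //; first exact: jetN_lin.
move=> i j Si Sj; rewrite -!mxC_delta -!mxCM -mxC_bivec.
rewrite (right_weight_N Gx J1 (Fmx_so R p q _ _) d1 (inner_right Si Sj)) ?mul0r//.
by rewrite conj_x -Fmx_delta.
Qed.

Lemma inner_N2' u v w z : inner_vec u -> inner_vec v ->
  N2 (biv w z) (biv (xC *m u) (xC *m v)) = 0.
Proof.
move=> uP vP; rewrite -[w]mul1mx -[z]mul1mx -mxC1.
apply: (@ext2 N2 _ _ xpredT (fun i : 'I_n => 0 < i <= d)%N) => //;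
  [exact: jetN2_linl|exact: jetN2_linr|].
move=> i j k l _ _ Si Sj; rewrite !mul1mx.
rewrite (right_weight_N2 Gx J1 J2 (Fmx_so R p q _ _) d1 (inner_right Si Sj)) ?mul0r ?biv_so//.
by rewrite conj_x -Fmx_delta.
Qed.

Let mxC_ev k : mxC (ev R n k) = evC k.
Proof. by apply/matrixP => i j; rewrite !mxE rmorph_nat. Qed.

Let bivC0 : biv (evC 0) (evC d.+1) = mxC (Fmx 0 d.+1).
Proof. by rewrite Fmx_bivec mxC_bivec !mxC_ev. Qed.

Lemma boost_N : N (biv (evC 0) (evC d.+1)) = alpha * f x.
Proof.
by rewrite bivC0 (left_weight_N Gx J1 (Fmx_so R p q _ _) dl boost_left).
Qed.

Lemma boost_N2 w z : N2 (biv (evC 0) (evC d.+1)) (biv w z) = alpha * N (biv w z).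
Proof.
rewrite bivC0; apply/eqP; rewrite -subr_eq0; apply/eqP.
rewrite -[w]mul1mx -[z]mul1mx.
apply: (@bivec_ext _ _ _ (fun A => N2 (mxC (Fmx 0 d.+1)) A - alpha * N A) _ xpredT) => //.
  by move=> c A B; rewrite jetN2_linr jetN_lin; ring.
move=> i j _ _; rewrite !mul1mx biv_delta; lazy beta.
by rewrite (left_weight_N2 Gx J1 J2 (Fmx_so R p q _ _) dl boost_left) ?biv_so// subrr.
Qed.

Lemma boost_N2r w z : N2 (biv w z) (biv (evC 0) (evC d.+1)) = alpha * N (biv w z) +
  N (biv w z *m biv (evC 0) (evC d.+1) - biv (evC 0) (evC d.+1) *m biv w z).
Proof.
rewrite bivC0; apply/eqP; rewrite -subr_eq0; apply/eqP.
rewrite -[w]mul1mx -[z]mul1mx.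
apply: (@bivec_ext _ _ _ (fun A => N2 A (mxC (Fmx 0 d.+1)) - (alpha * N A +
  N (A *m mxC (Fmx 0 d.+1) - mxC (Fmx 0 d.+1) *m A))) _ xpredT) => //.
  by move=> c A B; rewrite jetN2_linl comm_linl !jetN_lin; ring.
move=> i j _ _; rewrite !mul1mx biv_delta; lazy beta.
rewrite (left_weight_N2r Gx J1 J2 (Fmx_so R p q _ _) dl l0 boost_left) ?biv_so//.
by rewrite subrr.
Qed.

Let bivCx : biv (xC *m evC 0) (xC *m evC d.+1) =
  mxC (bivec eta (x *m ev R n 0) (x *m ev R n d.+1)).
Proof. by rewrite mxC_bivec !mxCM !mxC_ev. Qed.

Let conj_x0 : bivec eta (x *m ev R n 0) (x *m ev R n d.+1) *m x = x *m Fmx 0 d.+1.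
Proof. by rewrite conj_x Fmx_bivec. Qed.

Lemma boost_N' : N (biv (xC *m evC 0) (xC *m evC d.+1)) = beta * f x.
Proof.
by rewrite bivCx (right_weight_N Gx J1 (Fmx_so R p q _ _) dr boost_right conj_x0).
Qed.

Lemma boost_N2' w z :
  N2 (biv w z) (biv (xC *m evC 0) (xC *m evC d.+1)) = beta * N (biv w z).
Proof.
rewrite bivCx; apply/eqP; rewrite -subr_eq0; apply/eqP.
rewrite -[w]mul1mx -[z]mul1mx; set F' := mxC _.
apply: (@bivec_ext _ _ _ (fun A => N2 A F' - beta * N A) _ xpredT) => //.
  by move=> c A B; rewrite jetN2_linl jetN_lin; ring.
move=> i j _ _; rewrite !mul1mx biv_delta /F'; lazy beta.
rewrite (right_weight_N2 Gx J1 J2 (Fmx_so R p q _ _) dr boost_right conj_x0) ?biv_so//.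
by rewrite subrr.
Qed.

End EquivariantRelations.

(** * Complex hyperbolic functions *)

Section ComplexHyperbolic.
Variable R : realType.
Local Notation C := R[i].

Lemma cexpD (z w : C) : cexp (z + w) = cexp z * cexp w.
Proof.
case: z w => [a b] [c e]; rewrite /cexp /= expRD cosD sinD.
by apply/eqP; rewrite eq_complex /=; apply/andP; split; apply/eqP; ring.
Qed.

Lemma cexp0 : cexp 0 = 1 :> C.
Proof. by rewrite /cexp /= expR0 cos0 sin0 mulr1 mulr0. Qed.

Lemma cexpNK (z : C) : cexp z * cexp (- z) = 1.
Proof. by rewrite -cexpD subrr cexp0. Qed.

Lemma cexp_neq0 (z : C) : cexp z != 0.
Proof.
by apply/eqP => z0; have := cexpNK z; rewrite z0 mul0r => /eqP; rewrite eq_sym oner_eq0.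
Qed.

Lemma cexpN (z : C) : cexp (- z) = (cexp z)^-1.
Proof. by apply: (mulfI (cexp_neq0 z)); rewrite cexpNK divff// cexp_neq0. Qed.

Definition ccosh (z : C) : C := (cexp z + cexp (- z)) / 2.
Definition csinh (z : C) : C := (cexp z - cexp (- z)) / 2.

Lemma ccosh_sqr (z : C) : ccosh z ^+ 2 - csinh z ^+ 2 = 1.
Proof.
rewrite /ccosh /csinh; transitivity (cexp z * cexp (- z)); first by field.
exact: cexpNK.
Qed.

Lemma ccoshD (z w : C) : ccosh (z + w) = ccosh z * ccosh w + csinh z * csinh w.
Proof. by rewrite /ccosh /csinh opprD !cexpD; field. Qed.

Lemma csinhD (z w : C) : csinh (z + w) = ccosh z * csinh w + csinh z * ccosh w.
Proof. by rewrite /ccosh /csinh opprD !cexpD; field. Qed.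

Lemma ccoshE (a b : R) :
  ccosh (a +i* b) = (coshR a)%:C * (cos b)%:C + 'i * ((sinhR a)%:C * (sin b)%:C).
Proof.
rewrite /ccosh /cexp /= cosN sinN /coshR /sinhR.
have -> : (2 : C) = (2 : R)%:C by rewrite rmorph_nat.
rewrite -(fmorphV (real_complex R)).
by apply/eqP; rewrite eq_complex /=; apply/andP; split; apply/eqP; field.
Qed.

Lemma csinhE (a b : R) :
  csinh (a +i* b) = (sinhR a)%:C * (cos b)%:C + 'i * ((coshR a)%:C * (sin b)%:C).
Proof.
rewrite /csinh /cexp /= cosN sinN /coshR /sinhR.
have -> : (2 : C) = (2 : R)%:C by rewrite rmorph_nat.
rewrite -(fmorphV (real_complex R)).
by apply/eqP; rewrite eq_complex /=; apply/andP; split; apply/eqP; field.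
Qed.

Lemma sinhR_eq0 (a : R) : (sinhR a == 0) = (a == 0).
Proof.
rewrite /sinhR mulf_eq0 invr_eq0 (pnatr_eq0 _ 2) orbF subr_eq0.
rewrite (inj_eq (@expR_inj R)) -subr_eq0 opprK -mulr2n mulrn_eq0 //.
Qed.

Lemma coshR_gt0 (a : R) : 0 < coshR a.
Proof. by rewrite /coshR divr_gt0// addr_gt0// expR_gt0. Qed.

(** The real and imaginary parts are [sinh a cos b] and [cosh a sin b]; with [a] nonzero both vanish
    only if [cos b] and [sin b] do. *)
Lemma csinh_neq0_re (a b : R) : a != 0 -> csinh (a +i* b) != 0.
Proof.
move=> a0; rewrite csinhE eq_complex /=.
rewrite !(mul0r, mulr0, subr0, addr0, add0r, mul1r).
rewrite negb_and !(mulf_eq0 (sinhR a)) !(mulf_eq0 (coshR a)) sinhR_eq0 (negPf a0) (gt_eqF (coshR_gt0 a)) /=.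
rewrite -negb_and; apply/negP => /andP[/eqP c0 /eqP s0].
by have := cos2Dsin2 b; rewrite c0 s0 expr0n addr0 => /eqP; rewrite eq_sym oner_eq0.
Qed.

Lemma csinh_neq0_im (a b : R) : sin b != 0 -> csinh (a +i* b) != 0.
Proof.
move=> b0; rewrite csinhE eq_complex /=.
rewrite !(mul0r, mulr0, subr0, addr0, add0r, mul1r).
by rewrite negb_and !(mulf_eq0 (coshR a)) (negPf b0) (gt_eqF (coshR_gt0 a)) orbT.
Qed.

Lemma coth_exp (z : C) : csinh z != 0 ->
  (1 + cexp (- (2 * z))) / (1 - cexp (- (2 * z))) = ccosh z / csinh z.
Proof.
have -> : - (2 * z) = - z + - z by ring.
rewrite /csinh /ccosh cexpD !cexpN; have := cexp_neq0 z.
move: (cexp z) => e e0 s0.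
have s1 : e - e^-1 != 0.
  by apply: contra_neq s0 => ->; rewrite mul0r.
have s1E : e - e^-1 = e * (1 - e^-1 * e^-1) by field.
have s2 : 1 - e^-1 * e^-1 != 0.
  by apply: contra_neq s1 => h; rewrite s1E h mulr0.
have s3 : e * e - 1 != 0.
  have s3E : e - e^-1 = (e * e - 1) / e by field.
  by apply: contra_neq s1 => h; rewrite s3E h mul0r.
by field; rewrite e0 s3 /=.
Qed.

End ComplexHyperbolic.

Lemma etaK_sum (K : comPzRingType) p m :
  etaK K p m = \sum_(k <- iota 0 m) sgn_eta K p k *: (ev K m k *m (ev K m k)^T).
Proof.
have -> : iota 0 m = index_iota 0 m by rewrite /index_iota subn0.
rewrite big_mkord; apply/matrixP => i j; rewrite summxE (bigD1 i)//= big1 => [|k ki].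
  rewrite !mxE big_ord1 !mxE eqxx mul1r addr0 mulrC eq_sym.
  by rewrite -(inj_eq val_inj).
rewrite !mxE big_ord1 !mxE.
by rewrite (negPf (_ : i != k :> nat)) ?mul0r ?mulr0// eq_sym.
Qed.

(** Applied to [w+], [w-] and to their boosted images: the determinants are [zeta] and [- zeta]. *)
Lemma bivec_det (K : comPzRingType) m (E : 'M[K]_m) (e g : 'cV[K]_m) c1 c2 e1 e2 :
  bivec E (c1 *: e + c2 *: g) (e1 *: e + e2 *: g) = (c1 * e2 - c2 * e1) *: bivec E e g.
Proof.
rewrite bivecDl !bivecDr !bivecZl !bivecZr !bivecvv (bivecC _ e g).
by rewrite !scaler0 add0r addr0 !scalerN !scalerA scalerBl.
Qed.

(** * The Casimir element at one point of a slice *)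

Section PointRadial.
Variables (R : realType) (p q : nat).
Let d := (p + q)%N.
Local Notation n := (p + q).+2.
Local Notation mat := 'M[R]_n.
Local Notation G := (@SO0_pq R p q).
Local Notation C := R[i].
Local Notation etaC := (etaK C p n).
Local Notation biv := (bivec (etaK C p n)).
Local Notation dot := (dotp (etaK C p n)).
Local Notation evC := (ev C n).
Local Notation sg := (sgn_eta C p).
Hypotheses (qp : (q <= p)%N) (d2 : (2 < p + q)%N).
Variables (alpha beta : C) (lam rho : mat -> C).
Hypotheses (hlam : acts_by lam alpha) (hrho : acts_by rho beta).
Variables (f : mat -> C) (hf : in_EW lam rho f).
Variables (x : mat) (a : 'I_n * 'I_n -> C) (b : 'I_n * 'I_n -> 'I_n * 'I_n -> C).
Hypothesis Gx : G x.
Hypothesis J1 : forall (g : R -> mat) D, (forall s, G (g s)) -> g 0 = x ->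
  mx_is_derive g 0 D -> is_cderive1 (fun s => f (g s)) 0 (jetD a (mxC D)).
Hypothesis J2 : forall (g : R -> R -> mat) (V : R -> mat) W V',
  (forall s t, G (g s t)) -> g 0 0 = x ->
  (forall s, mx_is_derive (g s) 0 (V s)) ->
  mx_is_derive (fun s => g s 0) 0 W -> mx_is_derive V 0 V' ->
  is_cderive1 (fun s => cderive1 (fun t => f (g s t)) 0) 0
    (jetD a (mxC V') + jetQ b (mxC W) (mxC (V 0))).
Variables (m : nat) (X X' : m.-tuple mat).
Hypothesis XX' : B_dual_bases X X'.

Local Notation N := (jetN x a).
Local Notation N2 := (jetN2 x a b).
Local Notation xC := (mxC x).

Let Xso i : tnth X i \in so_alg R p q.
Proof. by have [bX _ _] := XX'; rewrite (basis_mem bX)// mem_tnth. Qed.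

Let X'so i : tnth X' i \in so_alg R p q.
Proof. by have [_ bX _] := XX'; rewrite (basis_mem bX)// mem_tnth. Qed.

Lemma casimirR_jet :
  casimirR f X X' x = \sum_(i < m) N2 (mxC (tnth X i)) (mxC (tnth X' i)).
Proof. by apply: eq_bigr => i _; rewrite (lieR2_jet Gx J2). Qed.

Let xC_orth : xC^T *m etaC *m xC = etaC.
Proof.
have /SO0_SO[] := Gx; rewrite eta_etaK => /(congr1 (@mxC _ _ _)).
by rewrite !mxCM mxC_tr mxC_eta.
Qed.

Let xC_orth' : xC *m etaC *m xC^T = etaC.
Proof.
have : (etaC *m xC^T *m etaC) *m xC = 1%:M by rewrite -!mulmxA [xC^T *m _]mulmxA xC_orth etaK_sqr.
move=> /mulmx1C; rewrite !mulmxA => h.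
by rewrite -[LHS]mulmx1 -(etaK_sqr C p n) mulmxA h mul1mx.
Qed.

(* Both sums are frame sums: for a frame [u_k] on the left and for the frame
   [x u_k] on the right. *)
Lemma casimirLR : casimirL X X' f x = casimirR f X X' x.
Proof.
pose s := [seq (sg k, evC k) | k <- iota 0 n].
have sE : \sum_(u <- s) u.1 *: (u.2 *m u.2^T) = etaC by rewrite big_map -etaK_sum.
pose s' := [seq (u.1, xC *m u.2) | u <- s].
have sE' : \sum_(u <- s') u.1 *: (u.2 *m u.2^T) = etaC.
  rewrite big_map -[RHS]xC_orth' -sE mulmx_sumr mulmx_suml; apply: eq_bigr => u _ /=.
  by rewrite -scalemxAr -scalemxAl trmx_mul !mulmxA.
rewrite casimirR_jet (casimir_frame XX' (jetN2_linl _ _ _) (jetN2_linr _ _ _) sE').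
pose bL (Z W : 'M[C]_n) := jetD a (xC *m Z *m W) + jetQ b (xC *m Z) (xC *m W).
have bLl c A B Z : bL (c *: A + B) Z = c * bL A Z + bL B Z.
  rewrite /bL mulmxDr mulmxDl -scalemxAr -scalemxAl jetD_lin jetQ_linl.
  by rewrite mulrDr addrACA.
have bLr c A B Z : bL Z (c *: A + B) = c * bL Z A + bL Z B.
  rewrite /bL !mulmxDr -!scalemxAr jetD_lin jetQ_linr.
  by rewrite mulrDr addrACA.
transitivity (\sum_(i < m) bL (mxC (tnth X i)) (mxC (tnth X' i))).
  by apply: eq_bigr => i _; rewrite (lieL2_jet Gx J2)// /bL !mxCM.
apply: etrans (casimir_frame XX' bLl bLr sE) _; rewrite [in RHS]big_map; apply: (congr1 ( *%R _)).
apply: eq_bigr => u _; rewrite [in RHS]big_map; apply: eq_bigr => v _ /=.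
apply: (congr1 ( *%R _)); have := bivec_conj u.2 v.2 xC_orth; rewrite /bL /jetN2.
move: (biv u.2 v.2) (biv (xC *m u.2) (xC *m v.2)) => F F' FE.
by rewrite FE -[F' *m xC *m F]mulmxA FE mulmxA.
Qed.

Variables (A B : nat).
Hypotheses (Ad : (0 < A <= d)%N) (Bd : (0 < B <= d)%N) (AB : A != B).
Let ks := rem B (rem A (iota 1 d)).
Hypothesis xfix : forall k, (0 < k <= d)%N -> k != A -> k != B ->
  x *m ev R n k = ev R n k.
Variables (p1 p2 m1 m2 a1 a2 b1 b2 : C).
Let vp := p1 *: evC A + p2 *: evC B.
Let vm := m1 *: evC A + m2 *: evC B.
Let wp := a1 *: evC 0 + a2 *: evC d.+1.
Let wm := b1 *: evC 0 + b2 *: evC d.+1.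

Let ksP k : (k \in ks) = [&& k != B, k != A & (0 < k <= d)%N].
Proof.
by rewrite mem_rem_uniq ?rem_uniq ?iota_uniq// inE mem_rem_uniq ?iota_uniq// inE mem_iota add1n ltnS.
Qed.

Lemma size_ks : size ks = (d - 2)%N.
Proof.
rewrite size_rem; last first.
  by rewrite mem_rem_uniq ?iota_uniq// inE eq_sym AB mem_iota; lia.
rewrite size_rem; last by rewrite mem_iota; lia.
by rewrite size_iota; lia.
Qed.

Let mid := [seq (sg k, evC k) | k <- ks].

Hypotheses (O1 : p1 ^+ 2 + m1 ^+ 2 = sg A) (O2 : p2 ^+ 2 + m2 ^+ 2 = sg B)
  (O3 : p1 * p2 + m1 * m2 = 0) (O4 : a1 ^+ 2 + b1 ^+ 2 = -1)
  (O5 : a2 ^+ 2 + b2 ^+ 2 = 1) (O6 : a1 * a2 + b1 * b2 = 0).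

(** [O1] to [O6] compare coefficients in the resolution of [etaC], while [D1] to [D6] below are the
    orthonormality relations of the same vectors. The indices [A] and [B] are taken out of
    [1, .., d]; the others contribute equal terms on both sides. *)
Lemma frame_sum :
  \sum_(u <- frame vp vm wp wm mid) u.1 *: (u.2 *m u.2^T) = etaC.
Proof.
rewrite etaK_sum (_ : iota 0 n = 0%N :: iota 1 d ++ [:: d.+1]); last first.
  by have := iotaD 1 d 1; rewrite addn1 add1n /= => <-.
rewrite [RHS]big_cons [X in _ = _ + X]big_cat big_seq1 /frame /= !big_cons /=.
rewrite (big_rem A) /=; last by rewrite mem_iota; lia.
rewrite (big_rem B) /=; last first.
  by rewrite mem_rem_uniq ?iota_uniq// inE eq_sym AB mem_iota; lia.
rewrite big_map /= -/ks.
move: (\sum_(k <- ks) _) => S.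
have s0 : sg 0 = - (a1 ^+ 2 + b1 ^+ 2) by rewrite O4 opprK.
have sd : sg d.+1 = - (a2 ^+ 2 + b2 ^+ 2).
  by rewrite O5 /sgn_eta; case: ifP => //; lia.
rewrite s0 sd -O1 -O2 /vp /vm /wp /wm.
move: (evC A) (evC B) (evC 0) (evC d.+1) => eA eB e0 e1.
apply/matrixP => i j; rewrite !mxE !big_ord1 !mxE.
move: (eA i 0) (eA j 0) (eB i 0) (eB j 0) (e0 i 0) (e0 j 0) (e1 i 0) (e1 j 0) (S i j).
move=> x1 x2 x3 x4 x5 x6 x7 x8 x9.
set L := LHS.
have -> : L = (p1 ^+ 2 + m1 ^+ 2) * (x1 * x2) + (p2 ^+ 2 + m2 ^+ 2) * (x3 * x4)
  + (p1 * p2 + m1 * m2) * (x1 * x4 + x2 * x3) - (a1 ^+ 2 + b1 ^+ 2) * (x5 * x6)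
  - (a2 ^+ 2 + b2 ^+ 2) * (x7 * x8) - (a1 * a2 + b1 * b2) * (x5 * x8 + x6 * x7) + x9.
  by rewrite /L; ring.
by rewrite O3 O6; ring.
Qed.

Lemma dot_evD (k l : nat) c1 c2 e1 e2 j r : (k < n)%N -> (l < n)%N -> k != l ->
  j != r -> dot (c1 *: evC k + c2 *: evC l) (e1 *: evC j + e2 *: evC r) =
  c1 * e1 * ((k == j)%:R * sg j) + c1 * e2 * ((k == r)%:R * sg r) +
  (c2 * e1 * ((l == j)%:R * sg j) + c2 * e2 * ((l == r)%:R * sg r)).
Proof.
move=> kn ln kl jr.
have es := etaK_tr C p n.
by rewrite !(dotpDl es) !dotpDr !(dotpZl es) !dotpZr !dotp_ev//; ring.
Qed.

Lemma inner_ev c1 c2 : @inner_vec R p q (c1 *: evC A + c2 *: evC B).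
Proof.
move=> i iP.
have iA : (nat_of_ord i == A) = false by apply/eqP => h; move: iP; rewrite h Ad.
have iB : (nat_of_ord i == B) = false by apply/eqP => h; move: iP; rewrite h Bd.
by rewrite !mxE iA iB !mulr0 addr0.
Qed.

Hypotheses (D1 : p1 ^+ 2 * sg A + p2 ^+ 2 * sg B = 1)
  (D2 : m1 ^+ 2 * sg A + m2 ^+ 2 * sg B = 1)
  (D3 : p1 * m1 * sg A + p2 * m2 * sg B = 0)
  (D4 : a1 ^+ 2 - a2 ^+ 2 = -1) (D5 : b1 ^+ 2 - b2 ^+ 2 = -1) (D6 : a1 * b1 - a2 * b2 = 0).
Let zeta := a1 * b2 - a2 * b1.
Hypothesis zeta2 : zeta ^+ 2 = -1.
Variables (chp shp chm shm u1 u2 v1 v2 g1 g2 h1 h2 : C).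
Hypotheses (hyp : chp ^+ 2 - shp ^+ 2 = 1) (hym : chm ^+ 2 - shm ^+ 2 = 1).
Hypotheses (shp0 : shp != 0) (shm0 : shm != 0).
Let c1 := chp * chm + shp * shm.
Let s1 := chp * shm + shp * chm.
Let c2 := chp * chm - shp * shm.
Let s2 := shp * chm - chp * shm.
Hypotheses (s10 : s1 != 0) (s20 : s2 != 0).
Hypothesis vpE : chp *: vp + shp *: wp = xC *m (u1 *: evC A + u2 *: evC B).
Hypothesis vmE : chm *: vm + shm *: wm = xC *m (v1 *: evC A + v2 *: evC B).
Hypothesis wpE : chp *: wp + shp *: vp = xC *m (g1 *: evC 0 + g2 *: evC d.+1).
Hypothesis wmE : chm *: wm + shm *: vm = xC *m (h1 *: evC 0 + h2 *: evC d.+1).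
Hypothesis ghE : g1 * h2 - g2 * h1 = - zeta.

Lemma point_radial :
  casimirR f X X' x =
  N2 (2^-1 *: (biv wp vp + biv wm vm)) (2^-1 *: (biv wp vp + biv wm vm))
  + N2 (2^-1 *: (biv wp vp - biv wm vm)) (2^-1 *: (biv wp vp - biv wm vm))
  + (d - 2)%:R / 2 * (chp / shp * N (biv wp vp) + chm / shm * N (biv wm vm))
  + c1 / s1 * N (2^-1 *: (biv wp vp + biv wm vm))
  + c2 / s2 * N (2^-1 *: (biv wp vp - biv wm vm))
  - 4^-1 * ((alpha ^+ 2 + beta ^+ 2 + 2 * c1 * alpha * beta) / s1 ^+ 2 +
            (alpha ^+ 2 + beta ^+ 2 + 2 * c2 * alpha * beta) / s2 ^+ 2) * f x.
Proof.
have s00 : sg 0 = 1 by [].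
have sgd : sg d.+1 = -1 by rewrite /sgn_eta; case: ifP => //; lia.
have A0 : (A == 0%N) = false by lia.
have B0 : (B == 0%N) = false by lia.
have Ad1 : (A == d.+1) = false by lia.
have Bd1 : (B == d.+1) = false by lia.
have ABf : (A == B) = false by exact: negPf.
have BAf : (B == A) = false by rewrite eq_sym.
have AA : (A == A) = true by exact: eqxx.
have BB : (B == B) = true by exact: eqxx.
have TE : true%:R = 1 :> C by [].
have FE : false%:R = 0 :> C by [].
have E0 : (0 == d.+1)%N = false by [].
have E1 : (d.+1 == 0)%N = false by [].
have es := etaK_tr C p n.
have An : (A < n)%N by lia.
have Bn : (B < n)%N by lia.
rewrite casimirR_jet (casimir_frame XX' (jetN2_linl _ _ _) (jetN2_linr _ _ _) frame_sum).
have xCfix k : k \in ks -> xC *m evC k = evC k.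
  rewrite ksP => /and3P[kB kA kd].
  have := congr1 (@mxC _ _ _) (xfix kd kA kB); rewrite mxCM.
  have -> : mxC (ev R n k) = evC k by apply/matrixP => i j; rewrite !mxE rmorph_nat.
  by [].
have innerk k : k \in ks -> @inner_vec R p q (evC k).
  rewrite ksP => /and3P[kB kA kd] i iP.
  have ik : (nat_of_ord i == k) = false by apply/eqP => h; move: iP; rewrite h kd.
  by rewrite mxE ik.
rewrite -size_ks -(size_map (fun k => (sg k, evC k))).
(* [P'] is the set of [x]-images of vectors in [P]. The vectors of [mid] lie in it because [x] fixes
   them. *)
apply: (@frame_radial _ _ _ (etaK_tr _ _ _) N N2 (jetN_lin x a) (jetN2_linl x a b)
  (jetN2_linr x a b) (f x) alpha beta zeta vp vm wp wm (evC 0) (evC d.+1)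
  (xC *m evC 0) (xC *m evC d.+1) mid chp shp chm shm (@inner_vec R p q)
  (fun v => exists2 u, @inner_vec R p q u & v = xC *m u)).
- exact: hyp.
- exact: hym.
- exact: shp0.
- exact: shm0.
- exact: s10.
- exact: s20.
- by rewrite /vp dot_evD// AA BB ABf BAf !TE !FE; apply: etrans D1; ring.
- by rewrite /vm dot_evD// AA BB ABf BAf !TE !FE; apply: etrans D2; ring.
- by rewrite /wp dot_evD// s00 sgd !eqxx !E0 !E1 !TE !FE; apply: etrans D4; ring.
- by rewrite /wm dot_evD// s00 sgd !eqxx !E0 !E1 !TE !FE; apply: etrans D5; ring.
- by rewrite /vp /vm dot_evD// AA BB ABf BAf !TE !FE; apply: etrans D3; ring.
- by rewrite /wp /wm dot_evD// s00 sgd !eqxx !E0 !E1 !TE !FE; apply: etrans D6; ring.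
- by rewrite /vp /wp dot_evD// A0 B0 Ad1 Bd1 !FE; ring.
- by rewrite /vp /wm dot_evD// A0 B0 Ad1 Bd1 !FE; ring.
- by rewrite /vm /wp dot_evD// A0 B0 Ad1 Bd1 !FE; ring.
- by rewrite /vm /wm dot_evD// A0 B0 Ad1 Bd1 !FE; ring.
- move=> _ /mapP[k kks ->] /=.
  have := kks; rewrite ksP => /and3P[kB kA kd].
  have kn : (k < n)%N by lia.
  have kA' : (A == k) = false by rewrite eq_sym (negPf kA).
  have kB' : (B == k) = false by rewrite eq_sym (negPf kB).
  have k0 : (0%N == k) = false by lia.
  have kd1 : (d.+1 == k) = false by lia.
  have dk (i j : nat) e1 e2 : (i < n)%N -> (j < n)%N -> (i == k) = false -> (j == k) = false ->
      dot (e1 *: evC i + e2 *: evC j) (evC k) = 0.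
    move=> ni nj ik jk; rewrite (dotpDl es) !(dotpZl es) !dotp_ev// ik jk.
    by rewrite !mul0r !mulr0 addr0.
  split; first by rewrite dotp_ev// eqxx mul1r.
    exact: sgn_eta_sqr.
  by split; apply: dk.
- exact: inner_ev.
- exact: inner_ev.
- by move=> _ /mapP[k kks ->] /=; exact: innerk.
- by exists (u1 *: evC A + u2 *: evC B); [exact: inner_ev | exact: vpE].
- by exists (v1 *: evC A + v2 *: evC B); [exact: inner_ev | exact: vmE].
- move=> _ /mapP[k kks ->] /=; exists (evC k); first exact: innerk.
  by rewrite xCfix.
- move=> u v; exact: (inner_N qp d2 hlam hrho hf Gx J1).
- move=> u v w z; exact: (inner_N2 qp d2 hlam hrho hf Gx J1 J2).
- move=> u v w z; exact: (inner_N2r qp d2 hlam hrho hf Gx J1 J2).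
- move=> _ _ [u uP ->] [v vP ->]; exact: (inner_N' qp d2 hlam hrho hf Gx J1).
- move=> _ _ w z [u uP ->] [v vP ->]; exact: (inner_N2' qp d2 hlam hrho hf Gx J1 J2).
- exact: zeta2.
- exact: bivec_det.
- by rewrite wpE wmE !mulmxDr -!scalemxAr bivec_det ghE.
- exact: (boost_N hlam hrho hf Gx J1).
- exact: (boost_N2 hlam hrho hf Gx J1 J2).
- exact: (boost_N2r hlam hrho hf Gx J1 J2).
- exact: (boost_N' hlam hrho hf Gx J1).
- exact: (boost_N2' hlam hrho hf Gx J1 J2).
Qed.

End PointRadial.

(** * The operator [L(k)] in the charts *)

Lemma ord2P (k : 'I_2) : k = 0 \/ k = 1.
Proof. by case: k => -[|[|//]] lt2; [left|right]; exact: val_inj. Qed.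

Section ChartCalculus.
Variables (R : realType) (p q : nat).
Let d := (p + q)%N.
Local Notation n := (p + q).+2.
Local Notation mat := 'M[R]_n.
Local Notation G := (@SO0_pq R p q).
Local Notation C := R[i].

(** The charts are affine, so moving along a tangent vector is moving one chart coordinate. *)
Lemma dir_derive_chart I (u : C * C -> C) (s t : R) :
  dir_derive (tangent R I 0) u (chart I s t) =
    cderive1 (fun h => u (chart I (s + h) t)) 0 /\
  dir_derive (tangent R I 1) u (chart I s t) =
    cderive1 (fun h => u (chart I s (t + h))) 0.
Proof.
have E0 h : ((chart I s t).1 + h%:C * (tangent R I 0).1,
             (chart I s t).2 + h%:C * (tangent R I 0).2) = chart I (s + h) t.
  by case: I; congr pair; apply/eqP; rewrite eq_complex /=; apply/andP; split; apply/eqP; ring.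
have E1 h : ((chart I s t).1 + h%:C * (tangent R I 1).1,
             (chart I s t).2 + h%:C * (tangent R I 1).2) = chart I s (t + h).
  by case: I {E0}; congr pair; apply/eqP; rewrite eq_complex /=; apply/andP; split; apply/eqP; ring.
by split; rewrite /dir_derive; congr cderive1; apply/funext => h; rewrite ?E0 ?E1.
Qed.

Variables (I : cell) (f : mat -> C) (X : 'I_2 -> mat).
Hypothesis Xso : forall k, X k \in so_alg R p q.
Hypothesis xX0 : forall s t h : R, x_elt p q I (chart I (s + h) t) =
  expm (h *: X 0) *m x_elt p q I (chart I s t).
Hypothesis xX1 : forall s t h : R, x_elt p q I (chart I s (t + h)) =
  expm (h *: X 1) *m x_elt p q I (chart I s t).

(** A shift of a chart coordinate multiplies [x] on the left by a one-parameter group, so it is seen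
    by the action from the left on the argument. *)
Lemma dir_derive_Psi k s t :
  dir_derive (tangent R I k) (Psi I f) (chart I s t) =
    lieR f (X k) (x_elt p q I (chart I s t)).
Proof.
have [D0 D1] := dir_derive_chart I (Psi I f) s t.
have [->|->] := ord2P k.
- have E : (fun h => Psi I f (chart I (s + h) t)) =
      (fun h => f (expm (h *: X 0) *m x_elt p q I (chart I s t))).
    by apply/funext => h; rewrite /Psi xX0.
  by rewrite D0 E.
- have E : (fun h => Psi I f (chart I s (t + h))) =
      (fun h => f (expm (h *: X 1) *m x_elt p q I (chart I s t))).
    by apply/funext => h; rewrite /Psi xX1.
  by rewrite D1 E.
Qed.

Variables (x : mat) (a : 'I_n * 'I_n -> C) (b : 'I_n * 'I_n -> 'I_n * 'I_n -> C).
Variables s0 t0 : R.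
Hypothesis xE : x = x_elt p q I (chart I s0 t0).
Hypothesis Gx : G x.
Hypothesis J1 : forall (g : R -> mat) D, (forall s, G (g s)) -> g 0 = x ->
  mx_is_derive g 0 D -> is_cderive1 (fun s => f (g s)) 0 (jetD a (mxC D)).
Hypothesis J2 : forall (g : R -> R -> mat) (V : R -> mat) W V',
  (forall s t, G (g s t)) -> g 0 0 = x ->
  (forall s, mx_is_derive (g s) 0 (V s)) ->
  mx_is_derive (fun s => g s 0) 0 W -> mx_is_derive V 0 V' ->
  is_cderive1 (fun s => cderive1 (fun t => f (g s t)) 0) 0
    (jetD a (mxC V') + jetQ b (mxC W) (mxC (V 0))).
Local Notation N := (jetN x a).
Local Notation N2 := (jetN2 x a b).

Variable T : 'I_2 -> 'M[C]_n.
Hypothesis tangentU : tangent_mx R I \in unitmx.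
Hypothesis XT : forall k, mxC (X k) = \sum_j tangent_mx R I k j *: T j.

Let TE i : T i = \sum_k invmx (tangent_mx R I) i k *: mxC (X k).
Proof.
under eq_bigr do rewrite XT scaler_sumr.
rewrite exchange_big (bigD1 i)//= [X in _ + X]big1 => [|j ji].
  under eq_bigr do rewrite scalerA.
  rewrite -scaler_suml addr0; have := mulVmx tangentU => /matrixP/(_ i i).
  by rewrite !mxE eqxx => ->; rewrite scale1r.
under eq_bigr do rewrite scalerA.
rewrite -scaler_suml; have := mulVmx tangentU => /matrixP/(_ i j).
by rewrite !mxE eq_sym (negPf ji) => ->; rewrite scale0r.
Qed.

Lemma dchi_jet i : dchi I i (Psi I f) (chart I s0 t0) = N (T i).
Proof.
rewrite TE (N_sum (jetN_lin x a)) /dchi; apply: eq_bigr => k _; congr (_ * _).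
by rewrite dir_derive_Psi -xE (lieR_jet Gx J1).
Qed.

(** The generators [X k] do not depend on the point of the slice. Hence the first derivative is,
    along the whole chart, a fixed combination of the functions [lieR f (X k)], and differentiating
    it again stays within second jets. *)
Lemma dchi2_jet i : dchi I i (dchi I i (Psi I f)) (chart I s0 t0) = N2 (T i) (T i).
Proof.
pose c k := invmx (tangent_mx R I) i k.
have dlie l : is_cderive1 (fun h => \sum_k c k * lieR f (X k) (expm (h *: X l) *m x)) 0
    (\sum_k c k * N2 (mxC (X k)) (mxC (X l))).
  by apply: is_cderive1_sum => k; apply/is_cderive1Z/(is_cderive1_lieR2 Gx J2).
have dchiE s t : dchi I i (Psi I f) (chart I s t) =
    \sum_k c k * lieR f (X k) (x_elt p q I (chart I s t)).
  by apply: eq_bigr => k _; rewrite dir_derive_Psi.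
have F0 h : dchi I i (Psi I f) (chart I (s0 + h) t0) =
    \sum_k c k * lieR f (X k) (expm (h *: X 0) *m x).
  by rewrite dchiE xX0 -xE.
have F1 h : dchi I i (Psi I f) (chart I s0 (t0 + h)) =
    \sum_k c k * lieR f (X k) (expm (h *: X 1) *m x).
  by rewrite dchiE xX1 -xE.
have dirE l : dir_derive (tangent R I l) (dchi I i (Psi I f)) (chart I s0 t0) =
    \sum_k c k * N2 (mxC (X k)) (mxC (X l)).
  have [D0 D1] := dir_derive_chart I (dchi I i (Psi I f)) s0 t0.
  have [->|->] := ord2P l.
  - by rewrite D0 (funext F0); apply: is_cderive1_val (dlie 0).
  - by rewrite D1 (funext F1); apply: is_cderive1_val (dlie 1).
have N2l := jetN2_linl x a b; have N2r := jetN2_linr x a b.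
rewrite TE (N2_sum N2l N2r) {1}/dchi; apply: eq_bigr => l _.
by rewrite dirE.
Qed.

End ChartCalculus.

Section OperatorFormula.
Variable R : realType.
Local Notation C := R[i].

Lemma pairingE (g : Defs.root) (y : C * C) : pairing g y = g.1%:~R * y.1 + g.2%:~R * y.2.
Proof. by []. Qed.

(** The half-angle identity [sinh^2 z = 2 sinh^2(z/2) (cosh z + 1)]. It brings the short-root
    potential to the denominator [sinh^2 z] shared with the long roots. *)
Lemma cexp_diff_sqr (z : C) : csinh z != 0 ->
  - (1 / (cexp (z / 2) - cexp (- (z / 2))) ^+ 2) = - 2^-1 * (ccosh z + 1) / csinh z ^+ 2.
Proof.
move=> s0; have zE : z = z / 2 + z / 2 by field.
have c2 := ccosh_sqr z; have cE : ccosh z = 1 + 2 * csinh (z / 2) ^+ 2.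
  by rewrite {1}zE ccoshD -!expr2 -[X in _ = X + _](ccosh_sqr (z / 2)); ring.
have sE : cexp (z / 2) - cexp (- (z / 2)) = 2 * csinh (z / 2) by rewrite /csinh; field.
have h0 : csinh (z / 2) != 0.
  by apply: contra_neq s0 => h; rewrite {1}zE csinhD h !mulr0 mul0r addr0.
have p0 : ccosh z + 1 != 0.
  apply: contra_neq s0 => h; have cN : ccosh z = - 1 by apply/eqP; rewrite -addr_eq0 h.
  have : csinh z ^+ 2 = ccosh z ^+ 2 - 1 by rewrite -c2; ring.
  by rewrite cN sqrrN expr1n subrr => /eqP; rewrite expf_eq0 /= => /eqP.
rewrite sE; have -> : csinh z ^+ 2 = (ccosh z - 1) * (ccosh z + 1).
  by transitivity (ccosh z ^+ 2 - 1); [rewrite -c2|]; ring.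
have -> : ccosh z - 1 = 2 * csinh (z / 2) ^+ 2 by rewrite cE; ring.
by field; rewrite h0 p0.
Qed.

(** For the potential, [al^2 + be^2 + 2 c al be = (al - be)^2 + 2 (c + 1) al be]: the first term
    belongs to the long root, the second to the short root by the half-angle identity. For the
    first-order part, a long root contributes multiplicity 1/2 times the derivative along
    [2 epsilon_i], that is coefficient 1. *)
Lemma L_op_formula (d : nat) (I : cell) (u : C * C -> C) (y : C * C) (al be F : C) :
  (2 <= d)%N ->
  csinh ((y.1 + y.2) / 2) != 0 -> csinh ((y.1 - y.2) / 2) != 0 ->
  csinh y.1 != 0 -> csinh y.2 != 0 ->
  L_op d I u y + potential al be y * F =
  dchi I 0 (dchi I 0 u) y + dchi I 1 (dchi I 1 u) y
  + (d - 2)%:R / 2 *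
    (ccosh ((y.1 + y.2) / 2) / csinh ((y.1 + y.2) / 2) * (dchi I 0 u y + dchi I 1 u y) +
     ccosh ((y.1 - y.2) / 2) / csinh ((y.1 - y.2) / 2) * (dchi I 0 u y - dchi I 1 u y))
  + ccosh y.1 / csinh y.1 * dchi I 0 u y + ccosh y.2 / csinh y.2 * dchi I 1 u y
  - 4^-1 * ((al ^+ 2 + be ^+ 2 + 2 * ccosh y.1 * al * be) / csinh y.1 ^+ 2 +
            (al ^+ 2 + be ^+ 2 + 2 * ccosh y.2 * al * be) / csinh y.2 ^+ 2) * F.
Proof.
move=> d2 sp sm s1 s2.
have k1 : k_mult R d (1, 0) = 0 by [].
have k2 : k_mult R d (0, 1) = 0 by [].
have k3 : k_mult R d (2, 0) = 2^-1 by [].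
have k4 : k_mult R d (0, 2) = 2^-1 by [].
have k5 : k_mult R d (1, 1) = (d - 2)%:R / 2 by rewrite natrB.
have k6 : k_mult R d (1, -1) = (d - 2)%:R / 2 by rewrite natrB.
have l1 : l_sqr al be (1, 0) = - (al * be) by [].
have l2 : l_sqr al be (0, 1) = - (al * be) by [].
have l3 : l_sqr al be (2, 0) = - ((al - be) / 2) ^+ 2 by [].
have l4 : l_sqr al be (0, 2) = - ((al - be) / 2) ^+ 2 by [].
have l5 : l_sqr al be (1, 1) = 0 by [].
have l6 : l_sqr al be (1, -1) = 0 by [].
have g1 : pairing (1, 0) y = y.1 by rewrite pairingE /= mul1r mul0r addr0.
have g2 : pairing (0, 1) y = y.2 by rewrite pairingE /= mul1r mul0r add0r.
have g3 : pairing (2, 0) y = 2 * y.1 by rewrite pairingE /= mul0r addr0.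
have g4 : pairing (0, 2) y = 2 * y.2 by rewrite pairingE /= mul0r add0r.
have g5 : pairing (1, 1) y = 2 * ((y.1 + y.2) / 2) by rewrite pairingE /=; field.
have g6 : pairing (1, -1) y = 2 * ((y.1 - y.2) / 2) by rewrite pairingE /=; field.
rewrite /L_op /potential /pos_roots !big_cons !big_nil k1 k2 k3 k4 k5 k6 l1 l2 l3 l4 l5 l6.
rewrite g1 g2 g3 g4 g5 g6 !(mul0r, add0r, addr0) !coth_exp// /droot /=.
have e2 (z : C) : 2 * z / 2 = z by field.
rewrite !e2.
have b1 : (Bstar (1, 0) (1, 0))%:~R = 1 :> C by [].
have b2 : (Bstar (0, 1) (0, 1))%:~R = 1 :> C by [].
have b3 : (Bstar (2, 0) (2, 0))%:~R = 4 :> C by [].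
have b4 : (Bstar (0, 2) (0, 2))%:~R = 4 :> C by [].
rewrite ?b1 ?b2 ?b3 ?b4.
have P1 := cexp_diff_sqr s1; have P2 := cexp_diff_sqr s2.
have S1 : cexp y.1 - cexp (- y.1) = 2 * csinh y.1 by rewrite /csinh; field.
have S2 : cexp y.2 - cexp (- y.2) = 2 * csinh y.2 by rewrite /csinh; field.
rewrite S1 S2.
have -> (w : C) : - (al * be) * 1 / w = al * be * (- (1 / w)) by rewrite mulr1 mulrN mulNr mul1r.
have -> (w : C) : - (al * be) * 1 / w = al * be * (- (1 / w)) by rewrite mulr1 mulrN mulNr mul1r.
rewrite P1 P2; clear - s1 s2 sp sm; move: s1 s2 sp sm.
generalize (csinh y.1), (csinh y.2), (csinh ((y.1 + y.2) / 2)), (csinh ((y.1 - y.2) / 2)),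
  (ccosh y.1), (ccosh y.2), (ccosh ((y.1 + y.2) / 2)), (ccosh ((y.1 - y.2) / 2)),
  (dchi I 0 (dchi I 0 u) y), (dchi I 1 (dchi I 1 u) y), (dchi I 0 u y), (dchi I 1 u y), ((d - 2)%:R : C).
by move=> S1 S2 SP SM *; field; apply/and4P; split.
Qed.

End OperatorFormula.

Lemma sum_ord2 (V : nmodType) (F : 'I_2 -> V) : \sum_j F j = F 0 + F 1.
Proof. by rewrite 2!big_ord_recl big_ord0 addr0; congr (F _ + F _); exact: val_inj. Qed.

Lemma det_mx22 (K : comPzRingType) (M : 'M[K]_2) : \det M = M 0 0 * M 1 1 - M 0 1 * M 1 0.
Proof.
rewrite (expand_det_row _ 0) !big_ord_recl big_ord0 /cofactor !det_mx11 !mxE /=.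
have -> : lift 0 0 = 1 :> 'I_2 by exact: val_inj.
have -> : lift 1 0 = 0 :> 'I_2 by exact: val_inj.
by rewrite addr0 expr0 expr1 mul1r mulN1r mulrN.
Qed.

Lemma mxC_ev (R : realType) m k : mxC (ev R m k) = ev R[i] m k.
Proof. by apply/matrixP => i j; rewrite !mxE rmorph_nat. Qed.

Section ChartRadial.
Variables (R : realType) (p q : nat).
Let d := (p + q)%N.
Local Notation n := (p + q).+2.
Local Notation mat := 'M[R]_n.
Local Notation G := (@SO0_pq R p q).
Local Notation C := R[i].
Local Notation biv := (bivec (etaK C p n)).
Local Notation evC := (ev C n).
Local Notation sg := (sgn_eta C p).
Hypotheses (qp : (q <= p)%N) (d2 : (2 < p + q)%N).
Variables (alpha beta : C) (lam rho : mat -> C).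
Hypotheses (hlam : acts_by lam alpha) (hrho : acts_by rho beta).
Variables (f : mat -> C) (hf : in_EW lam rho f).
Variables (m : nat) (X X' : m.-tuple mat).
Hypothesis XX' : B_dual_bases X X'.

(** Joins the two descriptions at a point. [T0] and [T1] represent the derivatives in [chi_1] and
    [chi_2], as the expressions of [X0] and [X1] in the tangent coordinates say, and the addition
    theorems turn half angles into [chi_1] and [chi_2]. *)
Lemma chart_radial (I : cell) (s0 t0 : R) (X0 X1 : mat) (A B : nat)
    (p1 p2 m1 m2 a1 a2 b1 b2 u1 u2 v1 v2 g1 g2 h1 h2 : C) :
  let x := x_elt p q I (chart I s0 t0) in let xC := mxC x in
  let y1 := (chart I s0 t0).1 in let y2 := (chart I s0 t0).2 in
  let chp := ccosh ((y1 + y2) / 2) in let shp := csinh ((y1 + y2) / 2) in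
  let chm := ccosh ((y1 - y2) / 2) in let shm := csinh ((y1 - y2) / 2) in
  let vp := p1 *: evC A + p2 *: evC B in let vm := m1 *: evC A + m2 *: evC B in
  let wp := a1 *: evC 0 + a2 *: evC d.+1 in let wm := b1 *: evC 0 + b2 *: evC d.+1 in
  let T0 := 2^-1 *: (biv wp vp + biv wm vm) in let T1 := 2^-1 *: (biv wp vp - biv wm vm) in
  let ta := tangent R I 0 in let tb := tangent R I 1 in
  G x -> X0 \in so_alg R p q -> X1 \in so_alg R p q ->
  (forall s t h : R, x_elt p q I (chart I (s + h) t) = expm (h *: X0) *m x_elt p q I (chart I s t)) ->
  (forall s t h : R, x_elt p q I (chart I s (t + h)) = expm (h *: X1) *m x_elt p q I (chart I s t)) ->
  ta.1 * tb.2 - ta.2 * tb.1 != 0 ->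
  mxC X0 = ta.1 *: T0 + ta.2 *: T1 -> mxC X1 = tb.1 *: T0 + tb.2 *: T1 ->
  (0 < A <= d)%N -> (0 < B <= d)%N -> A != B ->
  (forall k, (0 < k <= d)%N -> k != A -> k != B -> x *m ev R n k = ev R n k) ->
  [/\ p1 ^+ 2 + m1 ^+ 2 = sg A, p2 ^+ 2 + m2 ^+ 2 = sg B & p1 * p2 + m1 * m2 = 0] ->
  [/\ a1 ^+ 2 + b1 ^+ 2 = -1, a2 ^+ 2 + b2 ^+ 2 = 1 & a1 * a2 + b1 * b2 = 0] ->
  [/\ p1 ^+ 2 * sg A + p2 ^+ 2 * sg B = 1, m1 ^+ 2 * sg A + m2 ^+ 2 * sg B = 1 &
      p1 * m1 * sg A + p2 * m2 * sg B = 0] ->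
  [/\ a1 ^+ 2 - a2 ^+ 2 = -1, b1 ^+ 2 - b2 ^+ 2 = -1 & a1 * b1 - a2 * b2 = 0] ->
  (a1 * b2 - a2 * b1) ^+ 2 = -1 -> g1 * h2 - g2 * h1 = - (a1 * b2 - a2 * b1) ->
  [/\ shp != 0, shm != 0, csinh y1 != 0 & csinh y2 != 0] ->
  chp *: vp + shp *: wp = xC *m (u1 *: evC A + u2 *: evC B) ->
  chm *: vm + shm *: wm = xC *m (v1 *: evC A + v2 *: evC B) ->
  chp *: wp + shp *: vp = xC *m (g1 *: evC 0 + g2 *: evC d.+1) ->
  chm *: wm + shm *: vm = xC *m (h1 *: evC 0 + h2 *: evC d.+1) ->
  casimirL X X' f x = casimirR f X X' x /\
  casimirR f X X' x =
    L_op d I (Psi I f) (chart I s0 t0) + potential alpha beta (chart I s0 t0) * f x.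
Proof.
move=> x xC y1 y2 chp shp chm shm vp vm wp wm T0 T1 ta tb Gx X0so X1so xX0 xX1 tU XT0 XT1
  Ad Bd AB xfix [Q1 Q2 Q3] [Q4 Q5 Q6] [D1 D2 D3] [D4 D5 D6] z2 gh [sp0 sm0 s10 s20]
  vpE vmE wpE wmE.
have [a [b [J1 J2]]] := smooth_on_jet hf.1 Gx.
split; first by have h := casimirLR Gx J2 XX'; exact: h.
pose XX (k : 'I_2) := if k == 0 then X0 else X1.
pose TT (k : 'I_2) := if k == 0 then T0 else T1.
have XXso k : XX k \in so_alg R p q by rewrite /XX; case: ifP.
have tangU : tangent_mx R I \in unitmx by rewrite unitmxE det_mx22 !mxE unitfE.
have XXT k : mxC (XX k) = \sum_j tangent_mx R I k j *: TT j.
  apply: etrans (esym (sum_ord2 _)); rewrite {1}/tangent_mx mxE {1}/tangent_mx mxE.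
  by have [->|->] := ord2P k; [apply: etrans XT0 _ | apply: etrans XT1 _].
have L0 := dchi_jet XXso xX0 xX1 (erefl x) Gx J1 tangU XXT 0.
have L1 := dchi_jet XXso xX0 xX1 (erefl x) Gx J1 tangU XXT 1.
have M0 := dchi2_jet XXso xX0 xX1 (erefl x) Gx J2 tangU XXT 0.
have M1 := dchi2_jet XXso xX0 xX1 (erefl x) Gx J2 tangU XXT 1.
have yp : (y1 + y2) / 2 + (y1 - y2) / 2 = y1 by field.
have ym : (y1 + y2) / 2 - (y1 - y2) / 2 = y2 by field.
have chN (z : C) : ccosh (- z) = ccosh z by rewrite /ccosh opprK addrC.
have shN (z : C) : csinh (- z) = - csinh z by rewrite /csinh opprK -mulNr opprB.
have c1E : chp * chm + shp * shm = ccosh y1 by rewrite -ccoshD yp.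
have s1E : chp * shm + shp * chm = csinh y1 by rewrite -csinhD yp.
have c2E : chp * chm - shp * shm = ccosh y2 by rewrite -ym ccoshD chN shN mulrN.
have s2E : shp * chm - chp * shm = csinh y2 by rewrite -ym csinhD chN shN mulrN addrC.
have S10 : chp * shm + shp * chm != 0 by rewrite s1E.
have S20 : shp * chm - chp * shm != 0 by rewrite s2E.
have half_sum (V W : 'M[C]_n) : 2^-1 *: (V + W) + 2^-1 *: (V - W) = V.
  by apply/matrixP => i j; rewrite !mxE; field.
have half_diff (V W : 'M[C]_n) : 2^-1 *: (V + W) - 2^-1 *: (V - W) = W.
  by apply/matrixP => i j; rewrite !mxE; field.
pose Np := jetN x a (biv wp vp); pose Nm := jetN x a (biv wm vm).
(* [w+ /\ v+] is [T0 + T1] and [w- /\ v-] is [T0 - T1]: the derivatives along the two middle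
   roots. *)
have NP : Np = jetN x a T0 + jetN x a T1.
  rewrite /Np -{1}(half_sum (biv wp vp) (biv wm vm)) -/T0 -/T1.
  by have := jetN_lin x a 1 T0 T1; rewrite scale1r mul1r.
have NM : Nm = jetN x a T0 - jetN x a T1.
  rewrite /Nm -{1}(half_diff (biv wp vp) (biv wm vm)) -/T0 -/T1.
  by have := jetN_lin x a (-1) T1 T0; rewrite scaleN1r mulN1r addrC => ->; rewrite addrC.
have PR : casimirR f X X' x = jetN2 x a b T0 T0 + jetN2 x a b T1 T1
    + (d - 2)%:R / 2 * (chp / shp * Np + chm / shm * Nm)
    + ccosh y1 / csinh y1 * jetN x a T0 + ccosh y2 / csinh y2 * jetN x a T1
    - 4^-1 * ((alpha ^+ 2 + beta ^+ 2 + 2 * ccosh y1 * alpha * beta) / csinh y1 ^+ 2 +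
              (alpha ^+ 2 + beta ^+ 2 + 2 * ccosh y2 * alpha * beta) / csinh y2 ^+ 2) * f x.
  rewrite -c1E -s1E -c2E -s2E.
  exact: (point_radial qp d2 hlam hrho hf Gx J1 J2 XX' Ad Bd AB xfix Q1 Q2 Q3 Q4 Q5 Q6
    D1 D2 D3 D4 D5 D6 z2 (ccosh_sqr _) (ccosh_sqr _) sp0 sm0 S10 S20 vpE vmE wpE wmE gh).
rewrite PR (L_op_formula I (Psi I f) alpha beta (f x) (ltnW d2) sp0 sm0 s10 s20).
rewrite M0 M1 L0 L1 /TT; lazy beta.
have [-> ->] : (0 == 0 :> 'I_2) = true /\ (1 == 0 :> 'I_2) = false by [].
by clear PR; clearbody Np Nm; rewrite NP NM.
Qed.
End ChartRadial.

(** * Slices of the cells *)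

Section Combinations.
Variable K : fieldType.

Lemma bivec_comb n (E : 'M[K]_n) (e0 e1 eA eB : 'cV[K]_n) a1 a2 p1 p2 :
  bivec E (a1 *: e0 + a2 *: e1) (p1 *: eA + p2 *: eB) =
  (a1 * p1) *: bivec E e0 eA + (a1 * p2) *: bivec E e0 eB
  - ((a2 * p1) *: bivec E eA e1 + (a2 * p2) *: bivec E eB e1).
Proof.
rewrite bivecDl !bivecDr !bivecZl !bivecZr (bivecC _ eA e1) (bivecC _ eB e1).
by rewrite !scalerN !scalerA opprD.
Qed.

Lemma half_comb m n (F1 F2 F3 F4 : 'M[K]_(m, n)) (t1 t2 c1 c2 c3 c4 e1 e2 e3 e4 : K) :
  t1 *: (2^-1 *: ((c1 *: F1 + c2 *: F2 - (c3 *: F3 + c4 *: F4)) +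
                  (e1 *: F1 + e2 *: F2 - (e3 *: F3 + e4 *: F4)))) +
  t2 *: (2^-1 *: ((c1 *: F1 + c2 *: F2 - (c3 *: F3 + c4 *: F4)) -
                  (e1 *: F1 + e2 *: F2 - (e3 *: F3 + e4 *: F4)))) =
  (t1 / 2 * (c1 + e1) + t2 / 2 * (c1 - e1)) *: F1 + (t1 / 2 * (c2 + e2) + t2 / 2 * (c2 - e2)) *: F2
  + (- (t1 / 2 * (c3 + e3) + t2 / 2 * (c3 - e3))) *: F3
  + (- (t1 / 2 * (c4 + e4) + t2 / 2 * (c4 - e4))) *: F4.
Proof. by apply/matrixP => i j; rewrite !mxE; ring. Qed.

Lemma vec_comb n (v0 vA vB vd : 'cV[K]_n) (c k z1 z2 z3 z4 f0 f1 y00 y0A y0B y0d yd0 ydA ydB ydd : K) :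
  k * z1 = f0 * y00 + f1 * yd0 -> c * z2 = f0 * y0A + f1 * ydA ->
  c * z3 = f0 * y0B + f1 * ydB -> k * z4 = f0 * y0d + f1 * ydd ->
  c *: (z2 *: vA + z3 *: vB) + k *: (z1 *: v0 + z4 *: vd) =
  f0 *: (y00 *: v0 + y0A *: vA + y0B *: vB + y0d *: vd) +
  f1 *: (yd0 *: v0 + ydA *: vA + ydB *: vB + ydd *: vd).
Proof.
by move=> e1 e2 e3 e4; apply/matrixP => i j; rewrite !mxE !mulrDr !mulrA e1 e2 e3 e4; ring.
Qed.

Lemma oppr_comb n (v w : 'cV[K]_n) (c s : K) : - (c *: v + s *: w) = (- c) *: v + (- s) *: w.
Proof. by rewrite opprD !scaleNr. Qed.

Lemma oppr_comb4 n (v0 vA vB vd : 'cV[K]_n) (c1 c2 c3 c4 : K) :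
  - (c1 *: v0 + c2 *: vA + c3 *: vB + c4 *: vd) =
  (- c1) *: v0 + (- c2) *: vA + (- c3) *: vB + (- c4) *: vd.
Proof. by rewrite !opprD !scaleNr. Qed.

Lemma scale_comb2 n (v0 vA vB vd : 'cV[K]_n) (c1 c2 al be ga de : K) :
  c1 *: (al *: v0 + be *: vA) + c2 *: (ga *: vB + de *: vd) =
  (c1 * al) *: v0 + (c1 * be) *: vA + (c2 * ga) *: vB + (c2 * de) *: vd.
Proof. by rewrite !scalerDr !scalerA addrA. Qed.

Lemma pad0A n (v0 vA vB vd : 'cV[K]_n) (c s : K) :
  (c *: v0 + s *: vA = c *: v0 + s *: vA + 0 *: vB + 0 *: vd) *
  (s *: vA + c *: v0 = c *: v0 + s *: vA + 0 *: vB + 0 *: vd).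
Proof. by rewrite !scale0r !addr0 [s *: vA + _]addrC. Qed.

Lemma padBd n (v0 vA vB vd : 'cV[K]_n) (c s : K) :
  (c *: vB + s *: vd = 0 *: v0 + 0 *: vA + c *: vB + s *: vd) *
  (s *: vd + c *: vB = 0 *: v0 + 0 *: vA + c *: vB + s *: vd).
Proof. by rewrite !scale0r !add0r [s *: vd + _]addrC. Qed.

End Combinations.

Section SliceTools.
Variables (R : realType) (p q : nat).
Let d := (p + q)%N.
Local Notation n := (p + q).+2.
Local Notation mat := 'M[R]_n.
Local Notation C := R[i].
Local Notation biv := (bivec (etaK C p n)).
Local Notation evC := (ev C n).
Local Notation F := (@Fmx R p q).

Lemma expm_lin2 (P Q : mat) a a' b b' : P *m Q = Q *m P ->
  expm (a *: P + b *: Q) *m expm (a' *: P + b' *: Q) = expm ((a + a') *: P + (b + b') *: Q).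
Proof.
move=> PQ; rewrite -expmD; first by rewrite addrACA -!scalerDl.
by rewrite !(mulmxDl, mulmxDr) -!scalemxAl -!scalemxAr PQ !scalerA ![_ * a]mulrC ![_ * b]mulrC
  addrACA [X in _ + _ + X]addrC addrACA.
Qed.

(** Turns affine dependence of a commuting exponent on a chart coordinate into left multiplication
    by a one-parameter group. *)
Lemma expm_shift (P Q : mat) a b c c' h u v : P *m Q = Q *m P ->
  u = h * c + a -> v = h * c' + b ->
  expm (u *: P + v *: Q) = expm (h *: (c *: P + c' *: Q)) *m expm (a *: P + b *: Q).
Proof. by move=> PQ -> ->; rewrite scalerDr !scalerA expm_lin2. Qed.

Lemma expm_comb (P Q : mat) a b : P *m Q = Q *m P ->
  expm (a *: P + b *: Q) = expm (a *: P) *m expm (b *: Q) /\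
  expm (a *: P + b *: Q) = expm (b *: Q) *m expm (a *: P).
Proof.
move=> PQ; have PQab : (a *: P) *m (b *: Q) = (b *: Q) *m (a *: P).
  by rewrite -!scalemxAl -!scalemxAr PQ scalerA mulrC -scalerA.
by split; [rewrite expmD | rewrite addrC expmD].
Qed.

Lemma expm_pair_l j k l r a b i : [&& j < n, k < n, l < n & r < n]%N ->
  uniq [:: j; k; l; r] -> i \in [:: j; k] ->
  expm (a *: F j k + b *: F l r) *m ev R n i = expm (a *: F j k) *m ev R n i.
Proof.
move=> /and4P[jn kn ln rn].
rewrite /= !inE !negb_or andbT => /and3P[/and3P[jk jl jr] /andP[kl kr] lr] ijk.
have PQ : F j k *m F l r = F l r *m F j k by apply: Fmx_disjoint.
rewrite (expm_comb a b PQ).1 -mulmxA; congr (_ *m _); apply: expm_Fmx_fix => //.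
  by case/orP: ijk => /eqP ->.
by case/orP: ijk => /eqP ->.
Qed.

Lemma expm_pair_r j k l r a b i : [&& j < n, k < n, l < n & r < n]%N ->
  uniq [:: j; k; l; r] -> i \notin [:: j; k] ->
  expm (a *: F j k + b *: F l r) *m ev R n i = expm (b *: F l r) *m ev R n i.
Proof.
move=> /and4P[jn kn ln rn].
rewrite /= !inE !negb_or andbT => /and3P[/and3P[jk jl jr] /andP[kl kr] lr] /andP[ij ik].
have PQ : F j k *m F l r = F l r *m F j k by apply: Fmx_disjoint.
by rewrite (expm_comb a b PQ).2 -mulmxA; congr (_ *m _); apply: expm_Fmx_fix.
Qed.

Lemma mxC_img (x : mat) i (v : 'cV[R]_n) : x *m ev R n i = v -> mxC x *m evC i = mxC v.
Proof. by move=> <-; rewrite mxCM mxC_ev. Qed.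

Lemma mxC_Fmx j k : mxC (F j k) = biv (evC j) (evC k).
Proof. by rewrite Fmx_bivec mxC_bivec !mxC_ev. Qed.

Lemma rotation_image j k a : (j < n)%N -> (k < n)%N -> j != k -> (j <= p)%N = (k <= p)%N ->
  expm (a *: F j k) *m ev R n j = cos a *: ev R n j + (- (sgn_eta R p k * sin a)) *: ev R n k /\
  expm (a *: F j k) *m ev R n k = cos a *: ev R n k + (sgn_eta R p k * sin a) *: ev R n j.
Proof.
move=> jn kn jk jkp; have sjk := (sgnP R p j k).2 jkp.
by rewrite expm_Fmx_rot1// expm_Fmx_rot2// scaleNr.
Qed.

Lemma boost_image j k a : (j < n)%N -> (k < n)%N -> j != k -> (j <= p)%N = ~~ (k <= p)%N ->
  expm (a *: F j k) *m ev R n j = coshR a *: ev R n j + (sgn_eta R p k * sinhR a) *: ev R n k /\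
  expm (a *: F j k) *m ev R n k = coshR a *: ev R n k + (sgn_eta R p k * sinhR a) *: ev R n j.
Proof.
move=> jn kn jk jkp.
have sjk : sgn_eta R p j = - sgn_eta R p k by rewrite /sgn_eta jkp; case: (k <= p)%N; rewrite /= ?opprK.
by rewrite expm_Fmx_boost1// expm_Fmx_boost2.
Qed.

(** The two planes are disjoint, so each basis vector sees only the exponential of its own plane.
    The plane images are hypotheses in order to cover rotations and boosts together. *)
Lemma pair_images j k l r a b (c s s' e h h' : R) :
  [&& j < n, k < n, l < n & r < n]%N -> uniq [:: j; k; l; r] ->
  expm (a *: F j k) *m ev R n j = c *: ev R n j + s *: ev R n k /\
  expm (a *: F j k) *m ev R n k = c *: ev R n k + s' *: ev R n j ->
  expm (b *: F l r) *m ev R n l = e *: ev R n l + h *: ev R n r /\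
  expm (b *: F l r) *m ev R n r = e *: ev R n r + h' *: ev R n l ->
  let x := expm (a *: F j k + b *: F l r) in
  [/\ mxC x *m evC j = c%:C *: evC j + s%:C *: evC k,
      mxC x *m evC k = c%:C *: evC k + s'%:C *: evC j,
      mxC x *m evC l = e%:C *: evC l + h%:C *: evC r,
      mxC x *m evC r = e%:C *: evC r + h'%:C *: evC l &
      forall i, i \notin [:: j; k; l; r] -> x *m ev R n i = ev R n i].
Proof.
move=> Bn U [Ej Ek] [El Er] x.
have comb i i1 i2 (u v : R) : x *m ev R n i = u *: ev R n i1 + v *: ev R n i2 ->
    mxC x *m evC i = u%:C *: evC i1 + v%:C *: evC i2.
  by move=> /mxC_img ->; rewrite mxCD !mxCZ !mxC_ev.
have lr i : i \in [:: l; r] -> i \notin [:: j; k].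
  move: U => /= /and4P[]; rewrite !inE !negb_or => /and3P[_ jl jr] /andP[kl kr] lr _.
  by case/orP=> /eqP ->; rewrite ![_ == j]eq_sym ![_ == k]eq_sym ?jl ?jr ?kl ?kr.
split.
- by apply: comb; rewrite /x expm_pair_l// !inE eqxx.
- by apply: comb; rewrite /x expm_pair_l// !inE eqxx orbT.
- by apply: comb; rewrite /x expm_pair_r ?lr// !inE eqxx.
- by apply: comb; rewrite /x expm_pair_r ?lr// !inE eqxx orbT.
move=> i; rewrite !inE !negb_or => /and4P[ij ik il ir].
move: Bn => /and4P[jn kn ln rn].
by rewrite /x expm_pair_r ?inE ?negb_or ?ij ?ik ?jn ?kn ?ln//; apply: expm_Fmx_fix.
Qed.

Lemma t_elt_half_turn : (0 < q <= p)%N ->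
  [/\ mxC (t_elt p q 0 pi) *m evC 0 = evC 0, mxC (t_elt p q 0 pi) *m evC 1 = evC 1,
      mxC (t_elt p q 0 pi) *m evC d = - evC d, mxC (t_elt p q 0 pi) *m evC d.+1 = - evC d.+1 &
      forall i, i \notin [:: d; d.+1] -> t_elt p q 0 pi *m ev R n i = ev R n i].
Proof.
move=> qp; have tE : t_elt p q 0 pi = expm (pi *: F d d.+1) by rewrite /t_elt scale0r add0r.
have tv i : t_elt p q 0 pi *m ev R n i = (if (i == d) || (i == d.+1) then -1 else 1) *: ev R n i.
  by rewrite tE; apply: expm_Fmx_pi; [lia|lia|lia|apply/sgnP; lia].
have tf i : i \notin [:: d; d.+1] -> t_elt p q 0 pi *m ev R n i = ev R n i.
  by rewrite !inE negb_or => /andP[/negPf di /negPf di1]; rewrite tv di di1 scale1r.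
split=> //.
- by rewrite (mxC_img (tf 0%N _)) ?mxC_ev// !inE; lia.
- by rewrite (mxC_img (tf 1%N _)) ?mxC_ev// !inE; lia.
- by rewrite (mxC_img (tv d)) eqxx mxCZ mxC_ev rmorphN1 scaleN1r.
- by rewrite (mxC_img (tv d.+1)) eqxx orbT mxCZ mxC_ev rmorphN1 scaleN1r.
Qed.

Lemma t_elt_quarter_turn : (0 < q <= p)%N -> (2 < p + q)%N ->
  let t := t_elt p q (pi / 2) (pi / 2) in
  [/\ mxC t *m evC 0 = - evC 1, mxC t *m evC 1 = evC 0,
      mxC t *m evC d = evC d.+1, mxC t *m evC d.+1 = - evC d &
      forall i, i \notin [:: 0; 1; d; d.+1]%N -> t *m ev R n i = ev R n i].
Proof.
move=> qp d2 t.
have Bn : [&& 0 < n, 1 < n, d < n & d.+1 < n]%N by lia.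
have U : uniq [:: 0; 1; d; d.+1]%N by rewrite /= !inE; lia.
have s01 : (0 <= p)%N = (1 <= p)%N by lia.
have sdd : (d <= p)%N = (d.+1 <= p)%N by lia.
have [] := pair_images Bn U (rotation_image (pi / 2) _ _ _ s01)
  (rotation_image (pi / 2) _ _ _ sdd); [lia..|].
rewrite cos_pihalf sin_pihalf !mulr1.
have -> : sgn_eta R p 1 = 1 by rewrite /sgn_eta ifT//; lia.
have -> : sgn_eta R p d.+1 = -1 by rewrite /sgn_eta ifF//; lia.
rewrite opprK rmorphN1 rmorph0 rmorph1 !scale0r !add0r !scale1r !scaleN1r.
by split.
Qed.

Lemma Re_div2i (z : C) : complex.Re (z / (2 * (0 +i* 1))) = complex.Im z / 2.
Proof.
have -> : z / (2 * (0 +i* 1)) = (complex.Im z / 2) +i* (- (complex.Re z / 2)); last by [].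
have i0 : (2 * (0 +i* 1) : C) != 0 by rewrite mulf_neq0 ?pnatr_eq0// eq_complex /= oner_eq0 andbF.
apply: (mulIf i0); rewrite divfK//.
have -> : (2 : C) = (2 : R)%:C by rewrite rmorph_nat.
by apply/eqP; rewrite eq_complex /=; apply/andP; split; apply/eqP; field.
Qed.

Lemma half_complex (a b : R) : (a +i* b) / 2 = (a / 2) +i* (b / 2) :> C.
Proof.
have -> : (2 : C) = (2 : R)%:C by rewrite rmorph_nat.
rewrite -(fmorphV (real_complex R)).
by apply/eqP; rewrite eq_complex /=; apply/andP; split; apply/eqP; field.
Qed.

Lemma half_addc (a b a' b' : R) :
  ((a +i* b) + (a' +i* b')) / 2 = ((a + a') / 2) +i* ((b + b') / 2) :> C.
Proof. by rewrite -half_complex. Qed.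

Lemma half_subc (a b a' b' : R) :
  ((a +i* b) - (a' +i* b')) / 2 = ((a - a') / 2) +i* ((b - b') / 2) :> C.
Proof. by rewrite -half_complex. Qed.

Lemma Im_sub2i (z : C) (b : R) : complex.Im (z - 2 * (0 +i* b)) = complex.Im z - 2 * b.
Proof.
have -> : (2 : C) = (2 : R)%:C by rewrite rmorph_nat.
by case: z => u v /=; rewrite mul0r addr0.
Qed.

Lemma coshR0 : coshR 0 = 1 :> R.
Proof. by rewrite /coshR oppr0 expR0; field. Qed.

Lemma sinhR0 : sinhR 0 = 0 :> R.
Proof. by rewrite /sinhR oppr0 subrr mul0r. Qed.

Lemma coshRN (u : R) : coshR (- u) = coshR u.
Proof. by rewrite /coshR opprK addrC. Qed.

Lemma sinhRN (u : R) : sinhR (- u) = - sinhR u.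
Proof. by rewrite /sinhR opprK -mulNr opprB. Qed.

(** Supplies the normalisation of the mixed frame vectors for the cells [{0}] and [{2}]. *)
Lemma sqrtN2 : exists w : C, w ^+ 2 = - 2.
Proof.
exists ((0 +i* 1) * (Num.sqrt 2)%:C).
by rewrite exprMn sqr_i -rmorphXn sqr_sqrtr ?ler0n// mulN1r rmorph_nat.
Qed.

(** The imaginary unit is hidden behind an existential so that [ring] and [field] treat it as an
    atom with the single relation [i0 ^+ 2 = -1]. *)
Lemma hyperbolic_i : exists i0 : C, [/\ i0 = 0 +i* 1, i0 ^+ 2 = -1,
  forall a b, ccosh (a +i* b) = (coshR a)%:C * (cos b)%:C + i0 * ((sinhR a)%:C * (sin b)%:C) &
  forall a b, csinh (a +i* b) = (sinhR a)%:C * (cos b)%:C + i0 * ((coshR a)%:C * (sin b)%:C)].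
Proof.
exists (0 +i* 1); split=> //; first exact: sqr_i; move=> a b; [exact: ccoshE | exact: csinhE].
Qed.

Lemma sin_neq0 (u : R) : 0 < u < pi \/ 0 < - u < pi -> sin u != 0.
Proof.
case=> /sin_gt0_pi/gt_eqF; first by move=> ->.
by rewrite sinN oppr_eq0 => ->.
Qed.

Lemma sgn_eta_pos (K : comPzRingType) k : (k <= p)%N -> sgn_eta K p k = 1.
Proof. by move=> kp; rewrite /sgn_eta ifT. Qed.

Lemma sgn_eta_neg (K : comPzRingType) k : (p < k)%N -> sgn_eta K p k = -1.
Proof. by move=> pk; rewrite /sgn_eta ifF// leqNgt pk. Qed.

End SliceTools.

(** * Frames for the individual cells *)

Section Cells.
Variables (R : realType) (p q : nat).
Let d := (p + q)%N.
Local Notation n := (p + q).+2.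
Local Notation mat := 'M[R]_n.
Local Notation G := (@SO0_pq R p q).
Local Notation C := R[i].
Local Notation biv := (bivec (etaK C p n)).
Local Notation evC := (ev C n).
Local Notation sg := (sgn_eta C p).
Local Notation F := (@Fmx R p q).
Hypotheses (qp : (q <= p)%N) (d2 : (2 < p + q)%N).
Variables (alpha beta : C) (lam rho : mat -> C).
Hypotheses (hlam : acts_by lam alpha) (hrho : acts_by rho beta).
Variables (f : mat -> C) (hf : in_EW lam rho f).
Variables (m : nat) (X X' : m.-tuple mat).
Hypothesis XX' : B_dual_bases X X'.

Definition radial_at (I : cell) (s t : R) : Prop :=
  casimirL X X' f (x_elt p q I (chart I s t)) = casimirR f X X' (x_elt p q I (chart I s t)) /\
  casimirR f X X' (x_elt p q I (chart I s t)) =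
    L_op d I (Psi I f) (chart I s t)
    + potential alpha beta (chart I s t) * f (x_elt p q I (chart I s t)).

(* The frame is [v+ = p1 e_A + p2 e_B], [v- = m1 e_A + m2 e_B], [w+ = a1 e_0 + a2 e_(d+1)],
   [w- = b1 e_0 + b2 e_(d+1)]; row [xi] holds the coordinates of [x e_i] in the order
   [e_0, e_A, e_B, e_(d+1)].  The last four conjunctions say that [ch v + sh w] and
   [ch w + sh v], for [ch] and [sh] of [(chi_1 +- chi_2) / 2], are [x]-images of vectors of
   [span(e_A, e_B)] and [span(e_0, e_(d+1))]. *)
Lemma radial_coef (I : cell) (s t : R) (A B : nat) (X0 X1 : mat) (r1 r2 r3 r4 l1 l2 l3 l4 : R)
    (x00 x0A x0B x0d xA0 xAA xAB xAd xB0 xBA xBB xBd xd0 xdA xdB xdd : C)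
    (p1 p2 m1 m2 a1 a2 b1 b2 u1 u2 v1 v2 g1 g2 h1 h2 ta1 ta2 tb1 tb2 yp1 ym1 : C) :
  let x := x_elt p q I (chart I s t) in
  let comb c0 cA cB cd := c0 *: evC 0 + cA *: evC A + cB *: evC B + cd *: evC d.+1 in
  G x ->
  (forall s t h : R, x_elt p q I (chart I (s + h) t) = expm (h *: X0) *m x_elt p q I (chart I s t)) ->
  (forall s t h : R, x_elt p q I (chart I s (t + h)) = expm (h *: X1) *m x_elt p q I (chart I s t)) ->
  X0 = r1 *: F 0 A + r2 *: F 0 B + r3 *: F A d.+1 + r4 *: F B d.+1 ->
  X1 = l1 *: F 0 A + l2 *: F 0 B + l3 *: F A d.+1 + l4 *: F B d.+1 ->
  [/\ tangent R I 0 = (ta1, ta2), tangent R I 1 = (tb1, tb2) & ta1 * tb2 - ta2 * tb1 != 0] ->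
  [/\ r1%:C = ta1 / 2 * (a1 * p1 + b1 * m1) + ta2 / 2 * (a1 * p1 - b1 * m1),
      r2%:C = ta1 / 2 * (a1 * p2 + b1 * m2) + ta2 / 2 * (a1 * p2 - b1 * m2),
      r3%:C = - (ta1 / 2 * (a2 * p1 + b2 * m1) + ta2 / 2 * (a2 * p1 - b2 * m1)) &
      r4%:C = - (ta1 / 2 * (a2 * p2 + b2 * m2) + ta2 / 2 * (a2 * p2 - b2 * m2))] ->
  [/\ l1%:C = tb1 / 2 * (a1 * p1 + b1 * m1) + tb2 / 2 * (a1 * p1 - b1 * m1),
      l2%:C = tb1 / 2 * (a1 * p2 + b1 * m2) + tb2 / 2 * (a1 * p2 - b1 * m2),
      l3%:C = - (tb1 / 2 * (a2 * p1 + b2 * m1) + tb2 / 2 * (a2 * p1 - b2 * m1)) &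
      l4%:C = - (tb1 / 2 * (a2 * p2 + b2 * m2) + tb2 / 2 * (a2 * p2 - b2 * m2))] ->
  [/\ (0 < A <= d)%N, (0 < B <= d)%N & A != B] ->
  (forall k, (0 < k <= d)%N -> k != A -> k != B -> x *m ev R n k = ev R n k) ->
  [/\ p1 ^+ 2 + m1 ^+ 2 = sg A, p2 ^+ 2 + m2 ^+ 2 = sg B & p1 * p2 + m1 * m2 = 0] ->
  [/\ a1 ^+ 2 + b1 ^+ 2 = -1, a2 ^+ 2 + b2 ^+ 2 = 1 & a1 * a2 + b1 * b2 = 0] ->
  [/\ p1 ^+ 2 * sg A + p2 ^+ 2 * sg B = 1, m1 ^+ 2 * sg A + m2 ^+ 2 * sg B = 1 &
      p1 * m1 * sg A + p2 * m2 * sg B = 0] ->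
  [/\ a1 ^+ 2 - a2 ^+ 2 = -1, b1 ^+ 2 - b2 ^+ 2 = -1 & a1 * b1 - a2 * b2 = 0] ->
  [/\ (a1 * b2 - a2 * b1) ^+ 2 = -1 & g1 * h2 - g2 * h1 = - (a1 * b2 - a2 * b1)] ->
  ((chart I s t).1 + (chart I s t).2) / 2 = yp1 -> ((chart I s t).1 - (chart I s t).2) / 2 = ym1 ->
  [/\ csinh yp1 != 0, csinh ym1 != 0, csinh (chart I s t).1 != 0 & csinh (chart I s t).2 != 0] ->
  [/\ mxC x *m evC 0 = comb x00 x0A x0B x0d, mxC x *m evC A = comb xA0 xAA xAB xAd,
      mxC x *m evC B = comb xB0 xBA xBB xBd & mxC x *m evC d.+1 = comb xd0 xdA xdB xdd] ->
  [/\ csinh yp1 * a1 = u1 * xA0 + u2 * xB0, ccosh yp1 * p1 = u1 * xAA + u2 * xBA,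
      ccosh yp1 * p2 = u1 * xAB + u2 * xBB & csinh yp1 * a2 = u1 * xAd + u2 * xBd] ->
  [/\ csinh ym1 * b1 = v1 * xA0 + v2 * xB0, ccosh ym1 * m1 = v1 * xAA + v2 * xBA,
      ccosh ym1 * m2 = v1 * xAB + v2 * xBB & csinh ym1 * b2 = v1 * xAd + v2 * xBd] ->
  [/\ ccosh yp1 * a1 = g1 * x00 + g2 * xd0, csinh yp1 * p1 = g1 * x0A + g2 * xdA,
      csinh yp1 * p2 = g1 * x0B + g2 * xdB & ccosh yp1 * a2 = g1 * x0d + g2 * xdd] ->
  [/\ ccosh ym1 * b1 = h1 * x00 + h2 * xd0, csinh ym1 * m1 = h1 * x0A + h2 * xdA,
      csinh ym1 * m2 = h1 * x0B + h2 * xdB & ccosh ym1 * b2 = h1 * x0d + h2 * xdd] ->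
  radial_at I s t.
Proof.
move=> x comb Gx xX0 xX1 X0E X1E [taE tbE tU] [R1 R2 R3 R4] [L1 L2 L3 L4] [Ad Bd AB] xfix
  PM AB1 PM2 AB2 [z2 gh] ypE ymE nz [Ex0 ExA ExB Exd] [V1 V2 V3 V4] [W1 W2 W3 W4]
  [G1 G2 G3 G4] [H1 H2 H3 H4].
have so4 c1 c2 c3 c4 : c1 *: F 0 A + c2 *: F 0 B + c3 *: F A d.+1 + c4 *: F B d.+1
    \in so_alg R p q by rewrite !memvD// memvZ// Fmx_so.
have XE (r1' r2' r3' r4' : R) (t1 t2 : C) :
    r1'%:C = t1 / 2 * (a1 * p1 + b1 * m1) + t2 / 2 * (a1 * p1 - b1 * m1) ->
    r2'%:C = t1 / 2 * (a1 * p2 + b1 * m2) + t2 / 2 * (a1 * p2 - b1 * m2) ->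
    r3'%:C = - (t1 / 2 * (a2 * p1 + b2 * m1) + t2 / 2 * (a2 * p1 - b2 * m1)) ->
    r4'%:C = - (t1 / 2 * (a2 * p2 + b2 * m2) + t2 / 2 * (a2 * p2 - b2 * m2)) ->
    mxC (r1' *: F 0 A + r2' *: F 0 B + r3' *: F A d.+1 + r4' *: F B d.+1) =
    t1 *: (2^-1 *: (biv (a1 *: evC 0 + a2 *: evC d.+1) (p1 *: evC A + p2 *: evC B) +
                    biv (b1 *: evC 0 + b2 *: evC d.+1) (m1 *: evC A + m2 *: evC B))) +
    t2 *: (2^-1 *: (biv (a1 *: evC 0 + a2 *: evC d.+1) (p1 *: evC A + p2 *: evC B) -
                    biv (b1 *: evC 0 + b2 *: evC d.+1) (m1 *: evC A + m2 *: evC B))).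
  move=> e1 e2 e3 e4; rewrite !mxCD !mxCZ !mxC_Fmx e1 e2 e3 e4 !bivec_comb.
  exact/esym/half_comb.
have vE (c1 k1 z1 z2' z3 z4 : C) (e0 ed : 'cV[C]_n) y00 y0A y0B y0d yd0 ydA ydB ydd f0 f1 :
    mxC x *m e0 = y00 *: evC 0 + y0A *: evC A + y0B *: evC B + y0d *: evC d.+1 ->
    mxC x *m ed = yd0 *: evC 0 + ydA *: evC A + ydB *: evC B + ydd *: evC d.+1 ->
    k1 * z1 = f0 * y00 + f1 * yd0 -> c1 * z2' = f0 * y0A + f1 * ydA ->
    c1 * z3 = f0 * y0B + f1 * ydB -> k1 * z4 = f0 * y0d + f1 * ydd ->
    c1 *: (z2' *: evC A + z3 *: evC B) + k1 *: (z1 *: evC 0 + z4 *: evC d.+1) =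
    mxC x *m (f0 *: e0 + f1 *: ed).
  move=> h0 h1' k0 kA kB kd; rewrite mulmxDr -!scalemxAr h0 h1'.
  exact: vec_comb.
have vE' (c1 k1 z1 z2' z3 z4 : C) (e0 ed : 'cV[C]_n) y00 y0A y0B y0d yd0 ydA ydB ydd f0 f1 :
    mxC x *m e0 = y00 *: evC 0 + y0A *: evC A + y0B *: evC B + y0d *: evC d.+1 ->
    mxC x *m ed = yd0 *: evC 0 + ydA *: evC A + ydB *: evC B + ydd *: evC d.+1 ->
    k1 * z1 = f0 * y00 + f1 * yd0 -> c1 * z2' = f0 * y0A + f1 * ydA ->
    c1 * z3 = f0 * y0B + f1 * ydB -> k1 * z4 = f0 * y0d + f1 * ydd ->
    k1 *: (z1 *: evC 0 + z4 *: evC d.+1) + c1 *: (z2' *: evC A + z3 *: evC B) =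
    mxC x *m (f0 *: e0 + f1 *: ed).
  by move=> h0 h1' k0 kA kB kd; rewrite addrC; apply: vE h0 h1' _ _ _ _.
apply: (@chart_radial R p q qp d2 alpha beta lam rho hlam hrho f hf m X X' XX' I s t X0 X1 A B
  p1 p2 m1 m2 a1 a2 b1 b2 u1 u2 v1 v2 g1 g2 h1 h2 Gx _ _ xX0 xX1 _ _ _ Ad Bd AB xfix PM AB1 PM2 AB2
  z2 gh).
- by rewrite X0E.
- by rewrite X1E.
- by rewrite taE tbE.
- by rewrite X0E taE; apply: XE.
- by rewrite X1E tbE; apply: XE.
- by rewrite ypE ymE.
- by rewrite ypE; apply: vE ExA ExB _ _ _ _.
- by rewrite ymE; apply: vE ExA ExB _ _ _ _.
- by rewrite ypE; apply: vE' Ex0 Exd _ _ _ _.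
- by rewrite ymE; apply: vE' Ex0 Exd _ _ _ _.
Qed.

Let so_pair j k l r (a b : R) : a *: F j k + b *: F l r \in so_alg R p q.
Proof. by rewrite memvD// memvZ// Fmx_so. Qed.


Lemma radial_C_empty s t : (0 < q)%N -> chart_dom C_empty s t -> radial_at C_empty s t.
Proof.
move=> q0 [s0 [st tpi]].
have [i0 [i0E i2 chE shE]] := hyperbolic_i R.
have xE u v : x_elt p q C_empty (chart C_empty u v) =
    expm (((u + v) / 2 - pi) *: F 0 1 + ((u - v) / 2) *: F d d.+1).
  rewrite /x_elt /chart !Re_div2i Im_sub2i; lazy [complex.Im complex.Re GRing.add].
  have -> : (u + v - 2 * pi) / 2 = (u + v) / 2 - pi :> R by field.
  by [].
have Bn : [&& 0 < n, 1 < n, d < n & d.+1 < n]%N by lia.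
have U : uniq [:: 0; 1; d; d.+1]%N by rewrite /= !inE; lia.
have PQ : F 0 1 *m F d d.+1 = F d d.+1 *m F 0 1 by apply: Fmx_disjoint; lia.
have s01 : (0 <= p)%N = (1 <= p)%N by lia.
have sdd : (d <= p)%N = (d.+1 <= p)%N by lia.
have [] := pair_images Bn U (rotation_image ((s + t) / 2 - pi) _ _ _ s01)
  (rotation_image ((s - t) / 2) _ _ _ sdd); [lia..|].
rewrite -xE sgn_eta_pos ?sgn_eta_neg; [|lia..].
rewrite mul1r mulN1r opprK cosB sinB cospi sinpi !mulr0 !mulrN1 addr0 subr0 opprK.
move=> x0 x1 xd xd1 xf.
have X0T u v h : x_elt p q C_empty (chart C_empty (u + h) v) =
    expm (h *: (2^-1 *: F 0 1 + 2^-1 *: F d d.+1)) *m x_elt p q C_empty (chart C_empty u v).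
  by rewrite xE [in RHS]xE; apply: expm_shift => //; field.
have X1T u v h : x_elt p q C_empty (chart C_empty u (v + h)) =
    expm (h *: (2^-1 *: F 0 1 + (- 2^-1) *: F d d.+1)) *m x_elt p q C_empty (chart C_empty u v).
  by rewrite xE [in RHS]xE; apply: expm_shift => //; field.
have yp : ((chart C_empty s t).1 + (chart C_empty s t).2) / 2 = 0 +i* ((s + t) / 2) :> C.
  by rewrite /= half_addc addr0 mul0r.
have ym : ((chart C_empty s t).1 - (chart C_empty s t).2) / 2 = 0 +i* ((s - t) / 2) :> C.
  by rewrite /= half_subc subr0 mul0r.
have ta : tangent R C_empty 0 = (i0, 0).
  by rewrite i0E; congr pair; apply/eqP; rewrite eq_complex /= ?subr0 ?subrr ?eqxx.
have tb : tangent R C_empty 1 = (0, i0).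
  by rewrite i0E; congr pair; apply/eqP; rewrite eq_complex /= ?subr0 ?subrr ?eqxx.
have Gx : G (x_elt p q C_empty (chart C_empty s t)) by rewrite xE; apply/SO0_expm/so_pair.
pose c := cos ((s + t) / 2); pose z := sin ((s + t) / 2).
pose c' := cos ((s - t) / 2); pose z' := sin ((s - t) / 2).
(* Frame: [v+ = e_1], [v- = i e_d], [w+ = -i e_0], [w- = e_{d+1}]. The factors [i] correct the
   squares of [e_d] and [e_0]; the signs in the coordinates of [x e_0] and [x e_1] come from the
   shift of the angle by [pi]. *)
apply: (@radial_coef C_empty s t
  1 d _ _ 2^-1 0 0 2^-1 2^-1 0 0 (- 2^-1)
  (- c)%:C z%:C 0 0  (- z)%:C (- c)%:C 0 0  0 0 c'%:C z'%:C  0 0 (- z')%:C c'%:C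
  1 0 0 i0 (- i0) 0 0 1 (-1) 0 0 i0 i0 0 0 1 _ _ _ _ _ _ Gx X0T X1T _ _ (And3 ta tb _)
  _ _ _ _ _ _ _ _ _ yp ym).
- by rewrite !scale0r !addr0.
- by rewrite !scale0r !addr0.
- by rewrite mulr0 subr0 -expr2 i2 oppr_eq0 oner_eq0.
- by split; field: i2.
- by split; field: i2.
- by split; lia.
- by move=> k kd k1 kA; apply: xf; rewrite !inE !negb_or k1 kA; lia.
- by rewrite sgn_eta_pos ?sgn_eta_neg; [split; ring: i2|lia..].
- by split; ring: i2.
- by rewrite sgn_eta_pos ?sgn_eta_neg; [split; ring: i2|lia..].
- by split; ring: i2.
- by split; ring: i2.
- split; apply/csinh_neq0_im/sin_neq0; [|by right; lra|..]; by left; lra.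
- split; first exact: etrans x0 (pad0A _ _ _ _ _ _).1.
  + exact: etrans x1 (pad0A _ _ _ _ _ _).2.
  + exact: etrans xd (padBd _ _ _ _ _ _).1.
  + exact: etrans xd1 (padBd _ _ _ _ _ _).2.
all: rewrite chE shE coshR0 sinhR0 -/c -/z -/c' -/z'; by split; ring: i2.
Qed.

Let Z_comm : F 0 d *m F 1 d.+1 = F 1 d.+1 *m F 0 d.
Proof. by apply: Fmx_disjoint; lia. Qed.

Let Z_images u v : (0 < q)%N -> let x := expm (u *: F 0 d + v *: F 1 d.+1) in
  [/\ mxC x *m evC 0 = (coshR u)%:C *: evC 0 + (- sinhR u)%:C *: evC d,
      mxC x *m evC d = (coshR u)%:C *: evC d + (- sinhR u)%:C *: evC 0,
      mxC x *m evC 1 = (coshR v)%:C *: evC 1 + (- sinhR v)%:C *: evC d.+1,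
      mxC x *m evC d.+1 = (coshR v)%:C *: evC d.+1 + (- sinhR v)%:C *: evC 1 &
      forall i, i \notin [:: 0; d; 1; d.+1]%N -> x *m ev R n i = ev R n i].
Proof.
move=> q0; have Bn : [&& 0 < n, d < n, 1 < n & d.+1 < n]%N by lia.
have U : uniq [:: 0; d; 1; d.+1]%N by rewrite /= !inE; lia.
have s0d : (0 <= p)%N = ~~ (d <= p)%N by lia.
have s1d : (1 <= p)%N = ~~ (d.+1 <= p)%N by lia.
have [] := pair_images Bn U (boost_image u _ _ _ s0d) (boost_image v _ _ _ s1d); [lia..|].
rewrite !sgn_eta_neg; [|lia..]; rewrite !mulN1r => z0 zd z1 zd1 zf.
by split; [exact: z0 | exact: zd | exact: z1 | exact: zd1 | exact: zf].
Qed.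

Lemma radial_C_01 s t : (0 < q)%N -> chart_dom C_01 s t -> radial_at C_01 s t.
Proof.
move=> q0 [s0 st].
have [i0 [i0E i2 chE shE]] := hyperbolic_i R.
have xE u v : x_elt p q C_01 (chart C_01 u v) =
    expm (((u + v) / 2) *: F 0 d + ((u - v) / 2) *: F 1 d.+1) by [].
have [] := Z_images ((s + t) / 2) ((s - t) / 2) q0; rewrite -xE => x0 xd x1 xd1 xf.
have X0T u v h : x_elt p q C_01 (chart C_01 (u + h) v) =
    expm (h *: (2^-1 *: F 0 d + 2^-1 *: F 1 d.+1)) *m x_elt p q C_01 (chart C_01 u v).
  by rewrite xE [in RHS]xE; apply: expm_shift Z_comm _ _; field.
have X1T u v h : x_elt p q C_01 (chart C_01 u (v + h)) =
    expm (h *: (2^-1 *: F 0 d + (- 2^-1) *: F 1 d.+1)) *m x_elt p q C_01 (chart C_01 u v).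
  by rewrite xE [in RHS]xE; apply: expm_shift Z_comm _ _; field.
have yp : ((chart C_01 s t).1 + (chart C_01 s t).2) / 2 = ((s + t) / 2) +i* pi :> C.
  by rewrite /= half_addc; have -> : (pi + pi) / 2 = pi :> R by field.
have ym : ((chart C_01 s t).1 - (chart C_01 s t).2) / 2 = ((s - t) / 2) +i* 0 :> C.
  by rewrite /= half_subc subrr mul0r.
have ta : tangent R C_01 0 = (1, 0).
  by congr pair; apply/eqP; rewrite eq_complex /= ?subr0 ?subrr ?eqxx.
have tb : tangent R C_01 1 = (0, 1).
  by congr pair; apply/eqP; rewrite eq_complex /= ?subr0 ?subrr ?eqxx.
have Gx : G (x_elt p q C_01 (chart C_01 s t)) by rewrite xE; apply/SO0_expm/so_pair.
pose c := coshR ((s + t) / 2); pose z := sinhR ((s + t) / 2).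
pose c' := coshR ((s - t) / 2); pose z' := sinhR ((s - t) / 2).
(* Frame: [v+ = -i e_d], [v- = e_1], [w+ = i e_0], [w- = -e_{d+1}], so that [w+ /\ v+ = F_{0,d}] and
   [w- /\ v- = F_{1,d+1}] are real. *)
apply: (@radial_coef C_01 s t
  d 1 _ _ 2^-1 0 0 2^-1 2^-1 0 0 (- 2^-1)
  c%:C (- z)%:C 0 0  (- z)%:C c%:C 0 0  0 0 c'%:C (- z')%:C  0 0 (- z')%:C c'%:C
  (- i0) 0 0 1 i0 0 0 (-1) i0 0 0 1 (- i0) 0 0 (-1) _ _ _ _ _ _ Gx X0T X1T _ _ (And3 ta tb _)
  _ _ _ _ _ _ _ _ _ yp ym).
- by rewrite !scale0r !addr0.
- by rewrite !scale0r !addr0.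
- by rewrite mulr0 subr0 mulr1 oner_neq0.
- by split; field: i2.
- by split; field: i2.
- by split; lia.
- by move=> k kd k1 kA; apply: xf; rewrite !inE !negb_or k1 kA; lia.
- by rewrite [sgn_eta _ _ 1]sgn_eta_pos ?sgn_eta_neg; [split; ring: i2|lia..].
- by split; ring: i2.
- by rewrite [sgn_eta _ _ 1]sgn_eta_pos ?sgn_eta_neg; [split; ring: i2|lia..].
- by split; ring: i2.
- by split; ring: i2.
- split; apply: csinh_neq0_re; [|by apply: ltr0_neq0; lra|..];
    by apply: lt0r_neq0; lra.
- split; first exact: etrans x0 (pad0A _ _ _ _ _ _).1.
  + exact: etrans xd (pad0A _ _ _ _ _ _).2.
  + exact: etrans x1 (padBd _ _ _ _ _ _).1.
  + exact: etrans xd1 (padBd _ _ _ _ _ _).2.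
all: rewrite chE shE ?cos0 ?sin0 ?cospi ?sinpi -/c -/z -/c' -/z'; by split; ring: i2.
Qed.

Lemma radial_C_12 s t : (0 < q)%N -> chart_dom C_12 s t -> radial_at C_12 s t.
Proof.
move=> q0 [s0 st].
have [i0 [i0E i2 chE shE]] := hyperbolic_i R.
have xE u v : x_elt p q C_12 (chart C_12 u v) =
    expm (((u + v) / 2) *: F 0 d + ((u - v) / 2) *: F 1 d.+1) *m t_elt p q 0 pi by [].
have [z0 zd z1 zd1 zf] := Z_images ((s + t) / 2) ((s - t) / 2) q0.
have [|t0 t1 td td1 tf] := @t_elt_half_turn R p q; first lia.
have x0 := etrans (congr1 _ t0) z0; have x1 := etrans (congr1 _ t1) z1.
have xd := etrans (congr1 _ td) (etrans (mulmxN _ _) (congr1 -%R zd)).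
have xd1 := etrans (congr1 _ td1) (etrans (mulmxN _ _) (congr1 -%R zd1)).
rewrite mulmxA -mxCM -xE in x0; rewrite mulmxA -mxCM -xE in x1.
rewrite mulmxA -mxCM -xE oppr_comb in xd; rewrite mulmxA -mxCM -xE oppr_comb in xd1.
have X0T u v h : x_elt p q C_12 (chart C_12 (u + h) v) =
    expm (h *: (2^-1 *: F 0 d + 2^-1 *: F 1 d.+1)) *m x_elt p q C_12 (chart C_12 u v).
  by rewrite xE [in RHS]xE mulmxA; congr (_ *m _); apply: expm_shift Z_comm _ _; field.
have X1T u v h : x_elt p q C_12 (chart C_12 u (v + h)) =
    expm (h *: (2^-1 *: F 0 d + (- 2^-1) *: F 1 d.+1)) *m x_elt p q C_12 (chart C_12 u v).
  by rewrite xE [in RHS]xE mulmxA; congr (_ *m _); apply: expm_shift Z_comm _ _; field.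
have yp : ((chart C_12 s t).1 + (chart C_12 s t).2) / 2 = ((s + t) / 2) +i* 0 :> C.
  by rewrite /= half_addc addr0 mul0r.
have ym : ((chart C_12 s t).1 - (chart C_12 s t).2) / 2 = ((s - t) / 2) +i* 0 :> C.
  by rewrite /= half_subc subr0 mul0r.
have ta : tangent R C_12 0 = (1, 0).
  by congr pair; apply/eqP; rewrite eq_complex /= ?subr0 ?subrr ?eqxx.
have tb : tangent R C_12 1 = (0, 1).
  by congr pair; apply/eqP; rewrite eq_complex /= ?subr0 ?subrr ?eqxx.
have Gx : G (x_elt p q C_12 (chart C_12 s t)) by rewrite xE; apply: SO0_expmr (so_pair _ _ _ _ _ _) (SO0_expm (so_pair _ _ _ _ _ _)).
pose c := coshR ((s + t) / 2); pose z := sinhR ((s + t) / 2).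
pose c' := coshR ((s - t) / 2); pose z' := sinhR ((s - t) / 2).
(* The frame of the cell [{0,1}]. The missing summand [i pi] in the angle is made up for by the half
   turn in [x], which changes the signs of [x e_d] and [x e_{d+1}]. *)
apply: (@radial_coef C_12 s t
  d 1 _ _ 2^-1 0 0 2^-1 2^-1 0 0 (- 2^-1)
  c%:C (- z)%:C 0 0  (- (- z)%:C) (- c%:C) 0 0  0 0 c'%:C (- z')%:C  0 0 (- (- z')%:C) (- c'%:C)
  (- i0) 0 0 1 i0 0 0 (-1) i0 0 0 1 i0 0 0 1 _ _ _ _ _ _ Gx X0T X1T _ _ (And3 ta tb _)
  _ _ _ _ _ _ _ _ _ yp ym).
- by rewrite !scale0r !addr0.
- by rewrite !scale0r !addr0.
- by rewrite mulr0 subr0 mulr1 oner_neq0.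
- by split; field: i2.
- by split; field: i2.
- by split; lia.
- move=> k kd k1 kA; rewrite xE -mulmxA (tf k) ?inE; last by clear - kd k1 kA; lia.
  by apply: zf; rewrite !inE !negb_or k1 kA; lia.
- by rewrite [sgn_eta _ _ 1]sgn_eta_pos ?sgn_eta_neg; [split; ring: i2|lia..].
- by split; ring: i2.
- by rewrite [sgn_eta _ _ 1]sgn_eta_pos ?sgn_eta_neg; [split; ring: i2|lia..].
- by split; ring: i2.
- by split; ring: i2.
- split; apply: csinh_neq0_re; [|by apply: ltr0_neq0; lra|..];
    by apply: lt0r_neq0; lra.
- split; first exact: etrans x0 (pad0A _ _ _ _ _ _).1.
  + exact: etrans xd (pad0A _ _ _ _ _ _).2.
  + exact: etrans x1 (padBd _ _ _ _ _ _).1.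
  + exact: etrans xd1 (padBd _ _ _ _ _ _).2.
all: rewrite chE shE ?cos0 ?sin0 ?cospi ?sinpi -/c -/z -/c' -/z'; by split; ring: i2.
Qed.

Lemma radial_C_02 s t : (0 < q)%N -> chart_dom C_02 s t -> radial_at C_02 s t.
Proof.
move=> q0 [s0 t0'].
have [i0 [i0E i2 chE shE]] := hyperbolic_i R.
have xE u v : x_elt p q C_02 (chart C_02 u v) =
    expm (((u + v) / 2) *: F 0 d + ((u - v) / 2) *: F 1 d.+1) *m t_elt p q (pi / 2) (pi / 2) by [].
have [z0 zd z1 zd1 zf] := Z_images ((s + t) / 2) ((s - t) / 2) q0.
have [||t0 t1 td td1 tf] := @t_elt_quarter_turn R p q; [lia|lia|].
have x0 := etrans (congr1 _ t0) (etrans (mulmxN _ _) (congr1 -%R z1)).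
have x1 := etrans (congr1 _ t1) z0; have xd := etrans (congr1 _ td) zd1.
have xd1 := etrans (congr1 _ td1) (etrans (mulmxN _ _) (congr1 -%R zd)).
rewrite mulmxA -mxCM -xE oppr_comb in x0; rewrite mulmxA -mxCM -xE in x1.
rewrite mulmxA -mxCM -xE in xd; rewrite mulmxA -mxCM -xE oppr_comb in xd1.
have X0T u v h : x_elt p q C_02 (chart C_02 (u + h) v) =
    expm (h *: (2^-1 *: F 0 d + 2^-1 *: F 1 d.+1)) *m x_elt p q C_02 (chart C_02 u v).
  by rewrite xE [in RHS]xE mulmxA; congr (_ *m _); apply: expm_shift Z_comm _ _; field.
have X1T u v h : x_elt p q C_02 (chart C_02 u (v + h)) =
    expm (h *: (2^-1 *: F 0 d + (- 2^-1) *: F 1 d.+1)) *m x_elt p q C_02 (chart C_02 u v).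
  by rewrite xE [in RHS]xE mulmxA; congr (_ *m _); apply: expm_shift Z_comm _ _; field.
have yp : ((chart C_02 s t).1 + (chart C_02 s t).2) / 2 = ((s + t) / 2) +i* (pi / 2) :> C.
  by rewrite /= half_addc add0r.
have ym : ((chart C_02 s t).1 - (chart C_02 s t).2) / 2 = ((s - t) / 2) +i* (- (pi / 2)) :> C.
  by rewrite /= half_subc sub0r mulNr.
have ta : tangent R C_02 0 = (1, 0).
  by congr pair; apply/eqP; rewrite eq_complex /= ?subr0 ?subrr ?eqxx.
have tb : tangent R C_02 1 = (0, 1).
  by congr pair; apply/eqP; rewrite eq_complex /= ?subr0 ?subrr ?eqxx.
have Gx : G (x_elt p q C_02 (chart C_02 s t)) by rewrite xE; apply: SO0_expmr (so_pair _ _ _ _ _ _) (SO0_expm (so_pair _ _ _ _ _ _)).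
pose c := coshR ((s + t) / 2); pose z := sinhR ((s + t) / 2).
pose c' := coshR ((s - t) / 2); pose z' := sinhR ((s - t) / 2).
(* Again the frame of the cell [{0,1}]. The imaginary parts [pi / 2] and [- pi / 2] of the angles
   interchange hyperbolic sine and cosine up to a factor [i], and the quarter turns match this by
   interchanging the roles of [e_0, e_1] and of [e_d, e_{d+1}]. *)
apply: (@radial_coef C_02 s t
  d 1 _ _ 2^-1 0 0 2^-1 2^-1 0 0 (- 2^-1)
  0 0 (- c'%:C) (- (- z')%:C)  0 0 (- z')%:C c'%:C  c%:C (- z)%:C 0 0  (- (- z)%:C) (- c%:C) 0 0
  (- i0) 0 0 1 i0 0 0 (-1) 0 (-1) i0 0 0 (-1) i0 0 _ _ _ _ _ _ Gx X0T X1T _ _ (And3 ta tb _)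
  _ _ _ _ _ _ _ _ _ yp ym).
- by rewrite !scale0r !addr0.
- by rewrite !scale0r !addr0.
- by rewrite mulr0 subr0 mulr1 oner_neq0.
- by split; field: i2.
- by split; field: i2.
- by split; lia.
- move=> k kd k1 kA; rewrite xE -mulmxA (tf k) ?inE; last by clear - kd k1 kA; lia.
  by apply: zf; rewrite !inE !negb_or k1 kA; lia.
- by rewrite [sgn_eta _ _ 1]sgn_eta_pos ?sgn_eta_neg; [split; ring: i2|lia..].
- by split; ring: i2.
- by rewrite [sgn_eta _ _ 1]sgn_eta_pos ?sgn_eta_neg; [split; ring: i2|lia..].
- by split; ring: i2.
- by split; ring: i2.
- have ph0 : sin (pi / 2) != 0 :> R by rewrite sin_pihalf oner_neq0.
  split; [exact: csinh_neq0_im| |apply: csinh_neq0_re; apply: lt0r_neq0; lra..].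
  by apply: csinh_neq0_im; rewrite sinN oppr_eq0.
- split; first exact: etrans x0 (padBd _ _ _ _ _ _).1.
  + exact: etrans xd (padBd _ _ _ _ _ _).2.
  + exact: etrans x1 (pad0A _ _ _ _ _ _).1.
  + exact: etrans xd1 (pad0A _ _ _ _ _ _).2.
all: rewrite chE shE ?cosN ?sinN ?cos_pihalf ?sin_pihalf -/c -/z -/c' -/z'; by split; ring: i2.
Qed.

Lemma radial_C_1 s t : chart_dom C_1 s t -> radial_at C_1 s t.
Proof.
(* The slice uses the index [d] for [q = 0] and 2 otherwise; either way it is a positive index
   different from 0 and 1, which is all that the computation needs. *)
move=> [s0 [t0 tpi]]; pose k := if q == 0%N then d else 2%N.
have kP : (1 < k <= d)%N && (k <= p)%N by rewrite /k; case: eqP; lia.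
have [i0 [i0E i2 chE shE]] := hyperbolic_i R.
have xE u v : x_elt p q C_1 (chart C_1 u v) =
    expm ((v - pi) *: F 0 1 + (- u) *: F k d.+1).
  rewrite /x_elt /chart !Re_div2i Im_sub2i half_subc; lazy [complex.Im complex.Re GRing.add].
  have -> : (v + v - 2 * pi) / 2 = v - pi :> R by field.
  have -> : (- u - u) / 2 = - u :> R by field.
  by rewrite /k; case: (q == 0%N).
have Bn : [&& 0 < n, 1 < n, k < n & d.+1 < n]%N by lia.
have U : uniq [:: 0; 1; k; d.+1]%N by rewrite /= !inE; lia.
have PQ : F 0 1 *m F k d.+1 = F k d.+1 *m F 0 1 by apply: Fmx_disjoint; lia.
have s01 : (0 <= p)%N = (1 <= p)%N by lia.
have skd : (k <= p)%N = ~~ (d.+1 <= p)%N by lia.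
have [] := pair_images Bn U (rotation_image (t - pi) _ _ _ s01)
  (boost_image (- s) _ _ _ skd); [lia..|].
rewrite -xE sgn_eta_pos ?sgn_eta_neg; [|lia..].
rewrite mul1r mulN1r cosB sinB cospi sinpi !mulr0 !mulrN1 addr0 subr0 opprK.
move=> x0 x1 xk xd1 xf.
have X0T u v h : x_elt p q C_1 (chart C_1 (u + h) v) =
    expm (h *: (0 *: F 0 1 + (-1) *: F k d.+1)) *m x_elt p q C_1 (chart C_1 u v).
  by rewrite xE [in RHS]xE; apply: expm_shift => //; ring.
have X1T u v h : x_elt p q C_1 (chart C_1 u (v + h)) =
    expm (h *: (1 *: F 0 1 + 0 *: F k d.+1)) *m x_elt p q C_1 (chart C_1 u v).
  by rewrite xE [in RHS]xE; apply: expm_shift => //; ring.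
have yp : ((chart C_1 s t).1 + (chart C_1 s t).2) / 2 = 0 +i* t :> C.
  rewrite /= half_addc addNr mul0r.
  by have -> : (t + t) / 2 = t :> R by field.
have ym : ((chart C_1 s t).1 - (chart C_1 s t).2) / 2 = (- s) +i* 0 :> C.
  rewrite /= half_subc subrr mul0r.
  by have -> : (- s - s) / 2 = - s :> R by field.
have ta : tangent R C_1 0 = (-1, 1).
  by congr pair; apply/eqP; rewrite eq_complex /=; apply/andP; split; apply/eqP; ring.
have tb : tangent R C_1 1 = (i0, i0).
  by rewrite i0E; congr pair; apply/eqP; rewrite eq_complex /=; apply/andP; split; apply/eqP; ring.
have Gx : G (x_elt p q C_1 (chart C_1 s t)) by rewrite xE; apply/SO0_expm/so_pair.
pose c := cos t; pose z := sin t; pose c' := coshR (- s); pose z' := sinhR (- s).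
(* Frame: [v+ = e_1], [v- = e_k], [w+ = -i e_0], [w- = -e_{d+1}]: a rotation in the first plane and
   a boost in the second. *)
apply: (@radial_coef C_1 s t
  1 k _ _ 0 0 0 (-1) 1 0 0 0
  (- c)%:C z%:C 0 0  (- z)%:C (- c)%:C 0 0  0 0 c'%:C (- z')%:C  0 0 (- z')%:C c'%:C
  1 0 0 1 (- i0) 0 0 (-1) (-1) 0 0 1 i0 0 0 (-1) _ _ _ _ _ _ Gx X0T X1T _ _ (And3 ta tb _)
  _ _ _ _ _ _ _ _ _ yp ym).
- by rewrite !scale0r !add0r.
- by rewrite !scale0r !addr0.
- have i00 : i0 != 0 by rewrite -sqrf_eq0 i2 oppr_eq0 oner_eq0.
  have -> : -1 * i0 - 1 * i0 = - (2 * i0) by ring.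
  by rewrite oppr_eq0 mulf_neq0// pnatr_eq0.
- by split; field: i2.
- by split; field: i2.
- by split; lia.
- by move=> j jd j1 jk; apply: xf; rewrite !inE !negb_or j1 jk; lia.
- by rewrite !sgn_eta_pos; [split; ring: i2|lia..].
- by split; ring: i2.
- by rewrite !sgn_eta_pos; [split; ring: i2|lia..].
- by split; ring: i2.
- by split; ring: i2.
- split; first by apply/csinh_neq0_im/sin_neq0; left; lra.
  + by apply: csinh_neq0_re; apply: ltr0_neq0; lra.
  + by apply: csinh_neq0_re; apply: ltr0_neq0; lra.
  + by apply: csinh_neq0_re; apply: lt0r_neq0.
- split; first exact: etrans x0 (pad0A _ _ _ _ _ _).1.
  + exact: etrans x1 (pad0A _ _ _ _ _ _).2.
  + exact: etrans xk (padBd _ _ _ _ _ _).1.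
  + exact: etrans xd1 (padBd _ _ _ _ _ _).2.
all: rewrite chE shE ?coshR0 ?sinhR0 ?cos0 ?sin0 -/c -/z -/c' -/z'; by split; ring: i2.
Qed.

Lemma radial_C_1' s t : (1 < q)%N -> chart_dom C_1' s t -> radial_at C_1' s t.
Proof.
move=> q1 [s0 [t0 tpi]].
have [i0 [i0E i2 chE shE]] := hyperbolic_i R.
have xE u v : x_elt p q C_1' (chart C_1' u v) =
    expm ((v - pi) *: F d d.+1 + (- u) *: F 0 d.-1).
  rewrite /x_elt /chart !Re_div2i Im_sub2i; lazy [complex.Im complex.Re GRing.add].
  have -> : (v + v - 2 * pi) / 2 = v - pi :> R by field.
  by have -> : (- u - u) / 2 = - u :> R by field.
have Bn : [&& d < n, d.+1 < n, 0 < n & d.-1 < n]%N by lia.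
have U : uniq [:: d; d.+1; 0; d.-1]%N by rewrite /= !inE; lia.
have PQ : F d d.+1 *m F 0 d.-1 = F 0 d.-1 *m F d d.+1 by apply: Fmx_disjoint; lia.
have sdd : (d <= p)%N = (d.+1 <= p)%N by lia.
have s0d : (0 <= p)%N = ~~ (d.-1 <= p)%N by lia.
have [] := pair_images Bn U (rotation_image (t - pi) _ _ _ sdd)
  (boost_image (- s) _ _ _ s0d); [lia..|].
rewrite -xE !sgn_eta_neg; [|lia..].
rewrite !mulN1r cosB sinB cospi sinpi !mulr0 !mulrN1 addr0 subr0 !opprK.
move=> xd xd1 x0 xk xf.
have X0T u v h : x_elt p q C_1' (chart C_1' (u + h) v) =
    expm (h *: (0 *: F d d.+1 + (-1) *: F 0 d.-1)) *m x_elt p q C_1' (chart C_1' u v).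
  by rewrite xE [in RHS]xE; apply: expm_shift => //; ring.
have X1T u v h : x_elt p q C_1' (chart C_1' u (v + h)) =
    expm (h *: (1 *: F d d.+1 + 0 *: F 0 d.-1)) *m x_elt p q C_1' (chart C_1' u v).
  by rewrite xE [in RHS]xE; apply: expm_shift => //; ring.
have yp : ((chart C_1' s t).1 + (chart C_1' s t).2) / 2 = 0 +i* t :> C.
  rewrite /= half_addc addNr mul0r.
  by have -> : (t + t) / 2 = t :> R by field.
have ym : ((chart C_1' s t).1 - (chart C_1' s t).2) / 2 = (- s) +i* 0 :> C.
  rewrite /= half_subc subrr mul0r.
  by have -> : (- s - s) / 2 = - s :> R by field.
have ta : tangent R C_1' 0 = (-1, 1).
  by congr pair; apply/eqP; rewrite eq_complex /=; apply/andP; split; apply/eqP; ring.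
have tb : tangent R C_1' 1 = (i0, i0).
  by rewrite i0E; congr pair; apply/eqP; rewrite eq_complex /=; apply/andP; split; apply/eqP; ring.
have Gx : G (x_elt p q C_1' (chart C_1' s t)) by rewrite xE; apply/SO0_expm/so_pair.
pose c := cos t; pose z := sin t; pose c' := coshR (- s); pose z' := sinhR (- s).
(* Frame: [v+ = i e_d], [v- = -i e_{d-1}], [w+ = e_{d+1}], [w- = i e_0]: the rotation now takes
   place among negative directions, and [q > 1] makes [e_{d-1}] negative too. *)
apply: (@radial_coef C_1' s t
  d.-1 d _ _ (-1) 0 0 0 0 0 0 1
  c'%:C (- z')%:C 0 0  (- z')%:C c'%:C 0 0  0 0 (- c)%:C (- z)%:C  0 0 z%:C (- c)%:C
  0 i0 (- i0) 0 0 1 i0 0 0 (- i0) (- i0) 0 0 (-1) i0 0 _ _ _ _ _ _ Gx X0T X1T _ _ (And3 ta tb _)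
  _ _ _ _ _ _ _ _ _ yp ym).
- by rewrite !scale0r !addr0 add0r.
- by rewrite !scale0r !add0r addr0.
- have i00 : i0 != 0 by rewrite -sqrf_eq0 i2 oppr_eq0 oner_eq0.
  have -> : -1 * i0 - 1 * i0 = - (2 * i0) by ring.
  by rewrite oppr_eq0 mulf_neq0// pnatr_eq0.
- by split; field: i2.
- by split; field: i2.
- by split; lia.
- by move=> j jd j1 jk; apply: xf; rewrite !inE !negb_or jk j1; lia.
- by rewrite !sgn_eta_neg; [split; ring: i2|lia..].
- by split; ring: i2.
- by rewrite !sgn_eta_neg; [split; ring: i2|lia..].
- by split; ring: i2.
- by split; ring: i2.
- split; first by apply/csinh_neq0_im/sin_neq0; left; lra.
  + by apply: csinh_neq0_re; apply: ltr0_neq0; lra.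
  + by apply: csinh_neq0_re; apply: ltr0_neq0; lra.
  + by apply: csinh_neq0_re; apply: lt0r_neq0.
- split; first exact: etrans x0 (pad0A _ _ _ _ _ _).1.
  + exact: etrans xk (pad0A _ _ _ _ _ _).2.
  + exact: etrans xd (padBd _ _ _ _ _ _).1.
  + exact: etrans xd1 (padBd _ _ _ _ _ _).2.
all: rewrite chE shE ?coshR0 ?sinhR0 ?cos0 ?sin0 -/c -/z -/c' -/z'; by split; ring: i2.
Qed.

Let K := F 0 d - F 1 d.+1.
Let J := F 0 1 + F d d.+1.

(** The commutators of [J] with [F_{0,d}] and with [F_{1,d+1}] are equal, and [K] is the difference
    of these two. No pair of disjoint coordinate planes is available here. *)
Let JK_comm : (0 < q)%N -> K *m J = J *m K.
Proof.
move=> q0; have Jso : J \in so_alg R p q by rewrite memvD// Fmx_so.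
have sd : sgn_eta R p d = -1 by apply: sgn_eta_neg; lia.
have sd1 : sgn_eta R p d.+1 = -1 by apply: sgn_eta_neg; lia.
have s1 : sgn_eta R p 1 = 1 by apply: sgn_eta_pos; lia.
have s0 : sgn_eta R p 0 = 1 by [].
have Fe mu nu k (b1 b2 : bool) : (mu < n)%N -> (nu < n)%N -> (nu == k) = b1 -> (mu == k) = b2 ->
    F mu nu *m ev R n k = (b1%:R * sgn_eta R p k) *: ev R n mu - (b2%:R * sgn_eta R p k) *: ev R n nu.
  by move=> mun nun <- <-; apply: mul_Fmx_ev.
have J0 : J *m ev R n 0 = - ev R n 1.
  rewrite mulmxDl (Fe _ _ _ false true)// ?(Fe _ _ _ false false)//; [|lia..].
  by rewrite s0 !mul0r !mul1r !scale0r scale1r !sub0r oppr0 addr0.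
have J1 : J *m ev R n 1 = ev R n 0.
  rewrite mulmxDl (Fe _ _ _ true false)// ?(Fe _ _ _ false false)//; [|lia..].
  by rewrite s1 !mul0r !mul1r !scale0r scale1r !subr0 addr0.
have Jd : J *m ev R n d = ev R n d.+1.
  rewrite mulmxDl (Fe _ _ _ false false)// ?(Fe _ _ _ false true)//; [|lia..].
  by rewrite sd !mul0r !mul1r !scale0r scaleN1r !sub0r oppr0 add0r opprK.
have Jd1 : J *m ev R n d.+1 = - ev R n d.
  rewrite mulmxDl (Fe _ _ _ false false)// ?(Fe _ _ _ true false)//; [|lia..].
  by rewrite sd1 !mul0r !mul1r !scale0r scaleN1r !subr0 add0r.
have c0 := Fmx_comm_bivec (ev R n 0) (ev R n d) Jso.
have c1 := Fmx_comm_bivec (ev R n 1) (ev R n d.+1) Jso.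
rewrite -Fmx_bivec J0 Jd bivecNl in c0; rewrite -Fmx_bivec J1 Jd1 bivecNr in c1.
apply/esym/eqP; rewrite -subr_eq0 /K mulmxBr mulmxBl opprD addrACA -opprD c0 c1.
by rewrite addrC [X in _ + X]addrC addNr.
Qed.

(** Both [K] and [J] are sums over disjoint planes, but over different pairs of planes; the images
    are composed from a boost by [(u, -u)] after a rotation by [(c, c)]. *)
Let KJ_images u c : (0 < q)%N ->
  let x := expm (u *: K + c *: J) in
  let a := (cos c)%:C in let b := (sin c)%:C in
  let h := (coshR u)%:C in let k := (sinhR u)%:C in
  [/\ mxC x *m evC 0 = (a * h) *: evC 0 + (a * - k) *: evC d + (- b * h) *: evC 1 + (- b * k) *: evC d.+1,
      mxC x *m evC d = (a * - k) *: evC 0 + (a * h) *: evC d + (b * k) *: evC 1 + (b * h) *: evC d.+1,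
      mxC x *m evC 1 = (b * h) *: evC 0 + (b * - k) *: evC d + (a * h) *: evC 1 + (a * k) *: evC d.+1,
      mxC x *m evC d.+1 = (- b * - k) *: evC 0 + (- b * h) *: evC d + (a * k) *: evC 1 + (a * h) *: evC d.+1 &
      forall i, i \notin [:: 0; d; 1; d.+1]%N -> x *m ev R n i = ev R n i].
Proof.
move=> q0 x a b h k.
have Bn : [&& 0 < n, 1 < n, d < n & d.+1 < n]%N by lia.
have U : uniq [:: 0; 1; d; d.+1]%N by rewrite /= !inE; lia.
have s01 : (0 <= p)%N = (1 <= p)%N by lia.
have sdd : (d <= p)%N = (d.+1 <= p)%N by lia.
have KE : expm (u *: K) = expm (u *: F 0 d + (- u) *: F 1 d.+1) by rewrite scalerBr scaleNr.
have JE : expm (c *: J) = expm (c *: F 0 1 + c *: F d d.+1) by rewrite scalerDr.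
have xE : x = expm (u *: K) *m expm (c *: J) by apply: (expm_comb u c (JK_comm q0)).1.
have [] := Z_images u (- u) q0; rewrite -KE coshRN sinhRN opprK rmorphN => z0 zd z1 zd1 zf.
rewrite [RHS]addrC in zd; rewrite [RHS]addrC in zd1.
have [] := pair_images Bn U (rotation_image c _ _ _ s01) (rotation_image c _ _ _ sdd); [lia..|].
rewrite -JE sgn_eta_pos ?sgn_eta_neg; [|lia..].
rewrite !mul1r !mulN1r opprK rmorphN => y0 y1 yd yd1 yf.
rewrite [RHS]addrC in y1; rewrite [RHS]addrC in yd1.
have xi (e : 'cV[C]_n) v w (c1 c2 al be ga de : C) :
    mxC (expm (c *: J)) *m e = c1 *: v + c2 *: w ->
    mxC (expm (u *: K)) *m v = al *: evC 0 + be *: evC d ->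
    mxC (expm (u *: K)) *m w = ga *: evC 1 + de *: evC d.+1 ->
    mxC x *m e = (c1 * al) *: evC 0 + (c1 * be) *: evC d + (c2 * ga) *: evC 1 + (c2 * de) *: evC d.+1.
  move=> e1 e2 e3; rewrite xE mxCM -mulmxA e1 mulmxDr -(scalemxAr c1) -(scalemxAr c2) e2 e3.
  exact: scale_comb2.
split.
- exact: xi y0 z0 z1.
- exact: xi yd zd zd1.
- exact: xi y1 z0 z1.
- exact: xi yd1 zd zd1.
move=> i iN; rewrite xE -mulmxA yf; first exact: zf.
by move: iN; rewrite !inE !negb_or => /and4P[-> -> -> ->].
Qed.

Lemma radial_C_0 s t : (0 < q)%N -> chart_dom C_0 s t -> radial_at C_0 s t.
Proof.
move=> q0 [[s0 spi] t0].
have [i0 [i0E i2 chE shE]] := hyperbolic_i R; have [r r2] := sqrtN2 R; pose w := r / 2.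
have xE u v : x_elt p q C_0 (chart C_0 u v) =
    expm ((v / 2) *: K + ((u - pi) / 2) *: J).
  by rewrite /x_elt /chart !Re_div2i.
have [] := KJ_images (t / 2) ((s - pi) / 2) q0; rewrite -xE => x0 xd x1 xd1 xf.
have X0T u v h : x_elt p q C_0 (chart C_0 (u + h) v) =
    expm (h *: (0 *: K + 2^-1 *: J)) *m x_elt p q C_0 (chart C_0 u v).
  by rewrite xE [in RHS]xE; apply: expm_shift (JK_comm q0) _ _; field.
have X1T u v h : x_elt p q C_0 (chart C_0 u (v + h)) =
    expm (h *: (2^-1 *: K + 0 *: J)) *m x_elt p q C_0 (chart C_0 u v).
  by rewrite xE [in RHS]xE; apply: expm_shift (JK_comm q0) _ _; field.
have yp : ((chart C_0 s t).1 + (chart C_0 s t).2) / 2 = (t / 2) +i* ((s - pi) / 2 + pi) :> C.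
  by rewrite /= half_addc add0r; have -> : (s + pi) / 2 = (s - pi) / 2 + pi :> R by field.
have ym : ((chart C_0 s t).1 - (chart C_0 s t).2) / 2 = (- (t / 2)) +i* ((s - pi) / 2) :> C.
  by rewrite /= half_subc sub0r mulNr.
have ta : tangent R C_0 0 = (i0, 0).
  by rewrite i0E; congr pair; apply/eqP; rewrite eq_complex /=; apply/andP; split; apply/eqP; ring.
have tb : tangent R C_0 1 = (0, 1).
  by congr pair; apply/eqP; rewrite eq_complex /=; apply/andP; split; apply/eqP; ring.
have Gx : G (x_elt p q C_0 (chart C_0 s t)).
  by rewrite xE; apply: SO0_expm; rewrite memvD// memvZ// ?memvB ?memvD// Fmx_so.
set a := (cos _)%:C in x0 xd x1 xd1; set b := (sin _)%:C in x0 xd x1 xd1.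
set h := (coshR _)%:C in x0 xd x1 xd1; set k := (sinhR _)%:C in x0 xd x1 xd1.
(* Both angles [(chi_1 +- chi_2) / 2] are genuinely complex here, so the frame vectors mix basis
   vectors: [v+], [v-] combine [e_d] and [e_1], while [w+], [w-] combine [e_0] and [e_{d+1}]. With
   [w ^+ 2 = - 1/2] their squares are 1 and -1; [J / 2] becomes [i T0] and [K / 2] becomes [T1]. *)
apply: (@radial_coef C_0 s t
  d 1 _ _ 0 2^-1 2^-1 0 2^-1 0 0 (- 2^-1)
  _ _ _ _ _ _ _ _ _ _ _ _ _ _ _ _
  (- w) (i0 * w) w (i0 * w) w (i0 * w) w (- i0 * w)
  w (- i0 * w) w (i0 * w) (- w) (- i0 * w) w (- i0 * w)
  _ _ _ _ _ _ Gx X0T X1T _ _ (And3 ta tb _) _ _ _ _ _ _ _ _ _ yp ym _ (And4 x0 xd x1 xd1)).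
- by rewrite !scale0r scalerDr !add0r addr0.
- by rewrite !scale0r scalerBr scaleNr !addr0.
- by rewrite mulr1 mulr0 subr0 -sqrf_eq0 i2 oppr_eq0 oner_eq0.
- by split; rewrite /w; field: i2 r2.
- by split; rewrite /w; field: i2 r2.
- by split; lia.
- by move=> j jd j1 jk; apply: xf; rewrite !inE !negb_or j1 jk; lia.
- by rewrite [sgn_eta _ _ 1]sgn_eta_pos ?sgn_eta_neg; [split; rewrite /w; field: i2 r2|lia..].
- by split; rewrite /w; field: i2 r2.
- by rewrite [sgn_eta _ _ 1]sgn_eta_pos ?sgn_eta_neg; [split; rewrite /w; field: i2 r2|lia..].
- by split; rewrite /w; field: i2 r2.
- by split; rewrite /w; field: i2 r2.
- split; first by apply: csinh_neq0_re; apply: lt0r_neq0; lra.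
  + by apply: csinh_neq0_re; apply: ltr0_neq0; lra.
  + by apply/csinh_neq0_im/sin_neq0; left; lra.
  + by apply: csinh_neq0_re; apply: lt0r_neq0.
all: rewrite chE shE ?coshRN ?sinhRN ?cosDpi ?sinDpi ?rmorphN -/a -/b -/h -/k; by split; ring: i2.
Qed.

Lemma radial_C_2 s t : (0 < q)%N -> chart_dom C_2 s t -> radial_at C_2 s t.
Proof.
move=> q0 [s0 [t0 tpi]].
have [i0 [i0E i2 chE shE]] := hyperbolic_i R; have [r r2] := sqrtN2 R; pose w := r / 2.
have xE u v : x_elt p q C_2 (chart C_2 u v) =
    expm ((u / 2) *: K + (v / 2) *: J) *m t_elt p q 0 pi.
  by rewrite /x_elt /chart !Re_div2i.
have [z0 zd z1 zd1 zf] := KJ_images (s / 2) (t / 2) q0.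
have [|t0' t1' td td1 tf] := @t_elt_half_turn R p q; first lia.
have x0 := etrans (congr1 _ t0') z0; have x1 := etrans (congr1 _ t1') z1.
have xd := etrans (congr1 _ td) (etrans (mulmxN _ _) (congr1 -%R zd)).
have xd1 := etrans (congr1 _ td1) (etrans (mulmxN _ _) (congr1 -%R zd1)).
rewrite mulmxA -mxCM -xE in x0; rewrite mulmxA -mxCM -xE in x1.
rewrite mulmxA -mxCM -xE oppr_comb4 in xd; rewrite mulmxA -mxCM -xE oppr_comb4 in xd1.
have X0T u v h : x_elt p q C_2 (chart C_2 (u + h) v) =
    expm (h *: (2^-1 *: K + 0 *: J)) *m x_elt p q C_2 (chart C_2 u v).
  by rewrite xE [in RHS]xE mulmxA; congr (_ *m _); apply: expm_shift (JK_comm q0) _ _; field.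
have X1T u v h : x_elt p q C_2 (chart C_2 u (v + h)) =
    expm (h *: (0 *: K + 2^-1 *: J)) *m x_elt p q C_2 (chart C_2 u v).
  by rewrite xE [in RHS]xE mulmxA; congr (_ *m _); apply: expm_shift (JK_comm q0) _ _; field.
have yp : ((chart C_2 s t).1 + (chart C_2 s t).2) / 2 = (s / 2) +i* (t / 2) :> C.
  by rewrite /= half_addc add0r addr0.
have ym : ((chart C_2 s t).1 - (chart C_2 s t).2) / 2 = (s / 2) +i* (- (t / 2)) :> C.
  by rewrite /= half_subc sub0r subr0 mulNr.
have ta : tangent R C_2 0 = (1, 0).
  by congr pair; apply/eqP; rewrite eq_complex /=; apply/andP; split; apply/eqP; ring.
have tb : tangent R C_2 1 = (0, i0).
  by rewrite i0E; congr pair; apply/eqP; rewrite eq_complex /=; apply/andP; split; apply/eqP; ring.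
have Jso : (s / 2) *: K + (t / 2) *: J \in so_alg R p q.
  by rewrite memvD// memvZ// ?memvB ?memvD// Fmx_so.
have Gx : G (x_elt p q C_2 (chart C_2 s t)).
  by rewrite xE; apply: SO0_expmr (so_pair _ _ _ _ _ _) (SO0_expm Jso).
set a := (cos _)%:C in x0 xd x1 xd1; set b := (sin _)%:C in x0 xd x1 xd1.
set h := (coshR _)%:C in x0 xd x1 xd1; set k := (sinhR _)%:C in x0 xd x1 xd1.
(* Compared with the cell [{0}] the frame differs only in the sign of [w-]. This exchanges [T0] and
   [T1], so that [K] now belongs to [chi_1] and [J] to [chi_2]. *)
apply: (@radial_coef C_2 s t
  d 1 _ _ 2^-1 0 0 (- 2^-1) 0 2^-1 2^-1 0
  _ _ _ _ _ _ _ _ _ _ _ _ _ _ _ _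
  (- w) (i0 * w) w (i0 * w) w (i0 * w) (- w) (i0 * w)
  w (i0 * w) (- w) (i0 * w) w (- i0 * w) (- w) (- i0 * w)
  _ _ _ _ _ _ Gx X0T X1T _ _ (And3 ta tb _) _ _ _ _ _ _ _ _ _ yp ym _ (And4 x0 xd x1 xd1)).
- by rewrite !scale0r scalerBr scaleNr !addr0.
- by rewrite !scale0r scalerDr !add0r addr0.
- by rewrite mul1r mulr0 subr0 -sqrf_eq0 i2 oppr_eq0 oner_eq0.
- by split; rewrite /w; field: i2 r2.
- by split; rewrite /w; field: i2 r2.
- by split; lia.
- move=> j jd j1 jk; rewrite xE -mulmxA (tf j) ?inE; last by clear - jd j1 jk; lia.
  by apply: zf; rewrite !inE !negb_or j1 jk; lia.
- by rewrite [sgn_eta _ _ 1]sgn_eta_pos ?sgn_eta_neg; [split; rewrite /w; field: i2 r2|lia..].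
- by split; rewrite /w; field: i2 r2.
- by rewrite [sgn_eta _ _ 1]sgn_eta_pos ?sgn_eta_neg; [split; rewrite /w; field: i2 r2|lia..].
- by split; rewrite /w; field: i2 r2.
- by split; rewrite /w; field: i2 r2.
- split; first by apply: csinh_neq0_re; apply: lt0r_neq0; lra.
  + by apply: csinh_neq0_re; apply: lt0r_neq0; lra.
  + by apply: csinh_neq0_re; apply: lt0r_neq0.
  + by apply/csinh_neq0_im/sin_neq0; left; lra.
all: rewrite chE shE ?coshRN ?sinhRN ?cosN ?sinN ?rmorphN -/a -/b -/h -/k; by split; ring: i2.
Qed.

End Cells.

Theorem lemma6p35 (R : realType) (p q : nat)
    (hqp : (q <= p)%N) (hd : (2 < p + q)%N)
    (alpha beta : R[i])
    (lam rho : 'M[R]_((p + q).+2) -> R[i])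
    (hlam : acts_by lam alpha) (hrho : acts_by rho beta)
    (m : nat) (X X' : m.-tuple 'M[R]_((p + q).+2)) (hX : B_dual_bases X X')
    (f : 'M[R]_((p + q).+2) -> R[i]) (hf : in_EW lam rho f)
    (I : cell) (hI : cell_index q I) (y : R[i] * R[i]) (hy : Y_surf I y) :
  Psi I (casimirL X X' f) y = Psi I (casimirR f X X') y /\
  Psi I (casimirR f X X') y
    = L_op (p + q) I (Psi I f) y + potential alpha beta y * Psi I f y.
Proof.
case: hy => s [t [dom ->]].
suff [LR RE] : radial_at alpha beta f X X' I s t by split.
case: I hI dom => hI dom.
- exact: (radial_C_empty hqp hd hlam hrho hf hX hI dom).
- exact: (radial_C_0 hqp hd hlam hrho hf hX hI dom).
- exact: (radial_C_1 hqp hd hlam hrho hf hX dom).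
- exact: (radial_C_1' hqp hd hlam hrho hf hX hI dom).
- exact: (radial_C_2 hqp hd hlam hrho hf hX hI dom).
- exact: (radial_C_01 hqp hd hlam hrho hf hX hI dom).
- exact: (radial_C_02 hqp hd hlam hrho hf hX hI dom).
- exact: (radial_C_12 hqp hd hlam hrho hf hX hI dom).
Qed.
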